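(* Let $G=(V,E)$ be an infinite connected graph with bounded degrees, and consider the edge-averaging process $(f_t)_{t\ge0}$ on $G$. Suppose that for some $p>4$ the i.i.d.\ initial opinions $\{f_0(v)\}_{v\in V}$ are in $L^p$, and let $\mu:=\mathbb{E}[f_0(v)]$. Then for every $v\in V$, $\lim_{t\to\infty}f_t(v)=\mu$ almost surely.
   Context: Edge-averaging process: each vertex $v\in V$ carries an opinion $f_t(v)\in\mathbb R$ at each time $t\ge 0$. Each edge carries an independent rate-one Poisson clock (clocks independent of the initial opinions). When the clock of edge $\{u,v\}$ rings at time $t$, both endpoints update to $f_t(u)=f_t(v)=\frac{f_{t-}(u)+f_{t-}(v)}{2}$, where $f_{t-}(u)=\lim_{s\uparrow t}f_s(u)$; other opinions are unchanged. *)

(* Defs.v *)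
From HB Require Import structures.
From mathcomp Require Import all_boot all_order all_algebra.
From mathcomp Require Import all_classical all_reals all_analysis.
From Stdlib Require Import Relation_Operators.
From Stdlib Require Lists.List.

Set Implicit Arguments.
Unset Strict Implicit.
Unset Printing Implicit Defensive.
Import Order.TTheory GRing.Theory Num.Theory.
Import numFieldNormedType.Exports.
Local Open Scope classical_set_scope.
Local Open Scope ring_scope.

Definition mutually_independent {d} {Omega : measurableType d} {R : realType}
  (P : probability Omega R) (I : Type) (X : I -> Omega -> R) : Prop :=
  (forall i, measurable_fun setT (X i)) /\
  forall (J : seq I) (B : I -> set R),
    Stdlib.Lists.List.NoDup J -> (forall i, measurable (B i)) ->
    P (\bigcap_(i in [set i | Stdlib.Lists.List.In i J]) (X i @^-1` B i)) =
    (\prod_(i <- J) P (X i @^-1` B i))%E.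

Definition exp1_distributed {d} {Omega : measurableType d} {R : realType}
  (P : probability Omega R) (X : Omega -> R) : Prop :=
  forall s : R, 0 <= s -> P [set w | s < X w] = (expR (- s))%:E.

Definition same_law {d} {Omega : measurableType d} {R : realType}
  (P : probability Omega R) (X Y : Omega -> R) : Prop :=
  forall B : set R, measurable B -> P (X @^-1` B) = P (Y @^-1` B).

Definition incident {V E : Type} (ends : E -> V * V) (e : E) (v : V) : Prop :=
  (ends e).1 = v \/ (ends e).2 = v.

Definition adjacent {V E : Type} (ends : E -> V * V) (u v : V) : Prop :=
  exists e, ends e = (u, v) \/ ends e = (v, u).

Definition simple_graph {V E : Type} (ends : E -> V * V) : Prop :=
  (forall e, (ends e).1 <> (ends e).2) /\
  (forall e1 e2, ends e1 = ends e2 \/ ends e1 = ((ends e2).2, (ends e2).1) ->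
     e1 = e2).

Definition connected_graph {V E : Type} (ends : E -> V * V) : Prop :=
  forall u v : V, clos_refl_trans V (adjacent ends) u v.

Definition infinite_graph (V : Type) : Prop := ~ finite_set [set: V].

Definition bounded_degree {V E : Type} (ends : E -> V * V) : Prop :=
  exists D : nat, forall v : V, exists s : seq E,
    (size s <= D)%N /\ forall e, incident ends e v -> List.In e s.

(* tau e k = k-th inter-arrival time of the Poisson clock of edge e;  *)
(* ring_time tau e n = tau e 0 + ... + tau e n = (n+1)-th ring time.  *)
Definition ring_time {R : realType} {E : Type} (tau : E -> nat -> R)
  (e : E) (n : nat) : R := \sum_(k < n.+1) tau e k.

Definition edge_averaging_path {R : realType} {V E : Type}
  (ends : E -> V * V) (f0 : V -> R) (tau : E -> nat -> R)
  (f : R -> V -> R) : Prop :=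
  (forall v, f 0 v = f0 v) /\
  (forall v s t, 0 <= s -> s <= t ->
     (forall e n, incident ends e v ->
        ~ (s < ring_time tau e n <= t)) ->
     f t v = f s v) /\
  (forall e n, let t := ring_time tau e n in
     let u := (ends e).1 in let w := (ends e).2 in
     exists Lu Lw : R,
       f^~ u @ t^'- --> Lu /\ f^~ w @ t^'- --> Lw /\
       f t u = (Lu + Lw) / 2 /\ f t w = (Lu + Lw) / 2).

(* Main.v *)
Require Import Defs.
From HB Require Import structures.
From mathcomp Require Import all_boot all_order all_algebra.
From mathcomp Require Import all_classical all_reals all_analysis.
From mathcomp Require Import measurable_realfun ring lra.
From Stdlib Require Lists.List.
Import Order.TTheory GRing.Theory Num.Theory.
Import numFieldNormedType.Exports.
Set Implicit Arguments.
Unset Strict Implicit.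
Unset Printing Implicit Defensive.
Local Open Scope classical_set_scope.
Local Open Scope ring_scope.

(* Running the averaging backwards in time writes [f_t v] as [\sum_u m u * f0 u], where the random
   weights [m] are a probability vector depending on the clocks only: start from the point mass at
   [v] and apply the averagings in reverse order.  Ringing [{x, y}] decreases the energy
   [Q = \sum_u m u ^ 2] by [(m x - m y) ^ 2 / 2], and in an infinite connected graph of bounded degree
   [\sum_e (m x - m y) ^ 2 >= c Q ^ 3] (Nash); hence [E Q ^ k <= C t ^ (- k / 2)] for every real
   [k >= 1].  Conditionally on the clocks, a moment inequality for independent centred variables gives
   [E |f_t v - mu| ^ p <= C E Q ^ (p / 2) <= C t ^ (- p / 4)], which is summable over integer times as
   [p > 4].  If [f_s v] is off by [eps] at some time [s] of [[j, j + 1]], then with probability at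
   least [exp (- c)] no edge at [v] rings until [j + 1], so the whole window costs no more than its
   right endpoint, and Borel-Cantelli concludes.

   To make all this finite, time is cut into slots of length [dl = 1 / n] and the graph into a ball of
   radius [r].  A pattern [x : seq (option E)] records the unique edge of the ball ringing (once) in
   each slot, if any; conditionally on having such a pattern the slots are independent with explicit
   weights, and the probability of having none vanishes as [n] grows.  The weights reach the boundary
   of the ball with probability [O(2 ^ - r)], uniformly in [n], and otherwise the opinion at [v]
   is a function of the pattern and of the initial opinions in the ball. *)

(** * Edge averaging and means over patterns of rings *)

(** A constant vector on a finite ball is fixed by averaging, so the Nash inequality cannot hold
    there without restriction: it is asked only while the energy exceeds [2 / size U], and the ball
    is taken so large that the time horizon ends before this floor matters. The drift of the energy
    is nonlinear in [Q]; rather than through a convexity argument, it is linearized at a threshold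
    moving like [1 / t], which gives a linear recursion for the mean of [Q ^ k]. Since patterns have
    an explicit product law, every statement about random weights is a finite sum [pmean], treated
    by induction on the number of slots with the initial opinions frozen. Probability on [Omega]
    enters only through the law of a pattern and through the tail bound for one fixed pattern. The
    window is fixed first, then the radius, then the slot length, because the chance that some slot
    holds several rings depends on the number of edges in the ball. *)

Section averaging.
Variables (R : realType) (V E : choiceType) (ends : E -> V * V).
Implicit Types (e : E) (g m h : V -> R) (x : seq (option E)).

Definition average e g : V -> R := fun u =>
  if (u == (ends e).1) || (u == (ends e).2)
  then (g (ends e).1 + g (ends e).2) / 2 else g u.

Definition act (a : option E) g : V -> R := if a is Some e then average e g else g.

Definition evolve x g : V -> R := foldl (fun g a => act a g) g x.

(** With [foldr] the last mark acts first, which is the reversal of time. A mark put at the head of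
    a pattern is thus one further step backwards, and inductions on the number of slots extend
    patterns at the head. *)
Definition weights v x : V -> R := foldr act (fun u => (u == v)%:R) x.

Lemma evolve_cat x y g : evolve (x ++ y) g = evolve y (evolve x g).
Proof. by rewrite /evolve foldl_cat. Qed.

Lemma average_ge0 e g : (forall u, 0 <= g u) -> forall u, 0 <= average e g u.
Proof.
move=> g0 u; rewrite /average; case: ifP => // _.
by rewrite divr_ge0// addr_ge0.
Qed.

Lemma weights_ge0 v x u : 0 <= weights v x u.
Proof.
elim: x u => [|[e|] x IH] u /=; [by rewrite ler0n| |exact: IH].
exact: average_ge0.
Qed.

Lemma average_gt0 e m u : (forall u, 0 <= m u) -> 0 < m u -> 0 < average e m u.
Proof.
move=> m0 mu; rewrite /average; case: ifP => // /orP[]/eqP ue; subst u.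
- by rewrite divr_gt0// ltr_wpDr.
- by rewrite divr_gt0// ltr_wpDl.
Qed.

Lemma average_incident_gt0 e m u w : (forall u, 0 <= m u) ->
  (u == (ends e).1) || (u == (ends e).2) -> 0 < m u ->
  (w == (ends e).1) || (w == (ends e).2) -> 0 < average e m w.
Proof.
move=> m0 ue mu we; rewrite /average we divr_gt0//.
by case/orP: ue => /eqP ue; subst u; [rewrite ltr_wpDr|rewrite ltr_wpDl].
Qed.

Variables (U : seq V) (F : seq E) (D : nat).
Hypothesis U_uniq : uniq U.
Hypothesis F_ends : forall e, e \in F ->
  [/\ (ends e).1 \in U, (ends e).2 \in U & (ends e).1 != (ends e).2].
Hypothesis F_deg : forall u,
  \sum_(e <- F) ((u == (ends e).1)%:R + (u == (ends e).2)%:R) <= D%:R :> R.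

Lemma sum_edge_split e (h : V -> R) : e \in F ->
  \sum_(u <- U) h u = h (ends e).1 + h (ends e).2 +
    \sum_(u <- U | (u != (ends e).1) && (u != (ends e).2)) h u.
Proof.
case/F_ends => e1 e2 e12.
rewrite (bigD1_seq (ends e).1)//= -addrA; congr (_ + _).
rewrite [LHS](bigID (pred1 (ends e).2))/= ; congr (_ + _).
rewrite (eq_bigl (pred1 (ends e).2)); last first.
  by move=> u /=; rewrite andbC; case: eqP => // ->; rewrite eq_sym e12.
by rewrite -big_filter filter_pred1_uniq ?big_seq1.
Qed.

Lemma average_out e g u :
  (u != (ends e).1) && (u != (ends e).2) -> average e g u = g u.
Proof. by rewrite /average => /andP[/negPf -> /negPf ->]. Qed.

Lemma average1 e g : average e g (ends e).1 = (g (ends e).1 + g (ends e).2) / 2.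
Proof. by rewrite /average eqxx. Qed.

Lemma average2 e g : average e g (ends e).2 = (g (ends e).1 + g (ends e).2) / 2.
Proof. by rewrite /average eqxx orbT. Qed.

(** Averaging is a symmetric operator; this is what moves the dynamics from the opinions to the
    weights. *)
Lemma sum_average_adj e m g : e \in F ->
  \sum_(u <- U) average e m u * g u = \sum_(u <- U) m u * average e g u.
Proof.
move=> eF; rewrite !(sum_edge_split _ eF) !average1 !average2.
congr (_ + _); first by field.
by apply: eq_bigr => u uu; rewrite !average_out.
Qed.

Lemma sum_average e m : e \in F ->
  \sum_(u <- U) average e m u = \sum_(u <- U) m u.
Proof.
move=> eF; rewrite !(sum_edge_split _ eF) average1 average2.
congr (_ + _); first by field.
by apply: eq_bigr => u uu; rewrite !average_out.
Qed.

Definition energy m : R := \sum_(u <- U) m u ^+ 2.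

Lemma energy_average e m : e \in F ->
  energy (average e m) = energy m - (m (ends e).1 - m (ends e).2) ^+ 2 / 2.
Proof.
move=> eF; rewrite /energy !(sum_edge_split _ eF) average1 average2 [in RHS]addrAC.
congr (_ + _); first by field.
by apply: eq_bigr => u uu; rewrite !average_out.
Qed.

Lemma degree_sum h : (forall u, 0 <= h u) ->
  \sum_(e <- F) (h (ends e).1 + h (ends e).2) <= D%:R * \sum_(u <- U) h u.
Proof.
move=> h0.
have pick u0 : u0 \in U -> h u0 = \sum_(u <- U) (u == u0)%:R * h u.
  move=> uU; rewrite (bigD1_seq u0)//= eqxx mul1r big1 ?addr0//.
  by move=> u /negPf ->; rewrite mul0r.
have -> : \sum_(e <- F) (h (ends e).1 + h (ends e).2) =
    \sum_(e <- F) \sum_(u <- U) ((u == (ends e).1)%:R + (u == (ends e).2)%:R) * h u.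
  apply: eq_big_seq => e /F_ends[e1 e2 _].
  rewrite (pick _ e1) (pick _ e2) -big_split/=.
  by apply: eq_bigr => u _; rewrite mulrDl.
rewrite exchange_big/= mulr_sumr; apply: ler_sum => u _.
by rewrite -mulr_suml ler_wpM2r.
Qed.

Definition marks : seq (option E) := None :: map Some F.

Lemma mem_marks e : (Some e \in marks) = (e \in F).
Proof. by rewrite /marks inE/= mem_map// => ? ? []. Qed.

Lemma sum_weights v x : v \in U -> {subset x <= marks} ->
  \sum_(u <- U) weights v x u = 1.
Proof.
move=> vU; elim: x => [|a x IH] xM /=.
  rewrite (bigD1_seq v)//= eqxx big1 ?addr0// => u /negPf -> //.
have {}IH := IH (fun y yx => xM y (mem_behead (s := a :: x) yx)).
have := xM a (mem_head _ _); case: a {xM} => [e|] //=.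
by rewrite inE/= mem_map => [eF|? ? []//]; rewrite sum_average.
Qed.

Lemma evolve_weights v x g : v \in U -> {subset x <= marks} ->
  evolve x g v = \sum_(u <- U) weights v x u * g u.
Proof.
move=> vU; elim: x g => [|a x IH] g xM /=.
  rewrite (bigD1_seq v)//= eqxx mul1r big1 ?addr0// => u /negPf ->.
  by rewrite mul0r.
rewrite IH; last by move=> y yx; apply: xM; rewrite inE yx orbT.
have := xM a (mem_head _ _); case: a {xM} => [e|] //=.
by rewrite inE/= mem_map => [eF|? ? []//]; rewrite sum_average_adj.
Qed.

Section pattern_mean.
Variable dl : R.
Hypothesis dl0 : 0 < dl.

(** In a slot of length [dl], no ring of [F] has probability [expR (- (dl * size F))], and a single
    ring, of a given edge, has [dl] times that. Normalizing these two cases gives the weights. *)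
Definition mark_weight (a : option E) : R :=
  (if a is Some _ then dl else 1) / (1 + dl * (size F)%:R).

Definition ring_prob : R := dl / (1 + dl * (size F)%:R).

Definition pattern_weight x : R := \prod_(a <- x) mark_weight a.

Fixpoint patterns (n : nat) : seq (seq (option E)) :=
  if n is n'.+1 then [seq a :: x | a <- marks, x <- patterns n'] else [:: [::]].

Lemma patternsS n : patterns n.+1 = [seq a :: x | a <- marks, x <- patterns n].
Proof. by []. Qed.

Definition pmean n (phi : seq (option E) -> R) : R :=
  \sum_(x <- patterns n) pattern_weight x * phi x.

Let denom_gt0 : 0 < 1 + dl * (size F)%:R.
Proof. by rewrite ltr_wpDr// mulr_ge0// ltW. Qed.

Lemma ring_prob_ge0 : 0 <= ring_prob.
Proof. by rewrite divr_ge0// ltW. Qed.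

Lemma mark_weight_ge0 a : 0 <= mark_weight a.
Proof. by rewrite divr_ge0 ?(ltW denom_gt0)//; case: a => // _; exact: ltW. Qed.

Lemma pattern_weight_ge0 x : 0 <= pattern_weight x.
Proof. by apply: prodr_ge0 => a _; exact: mark_weight_ge0. Qed.

Lemma mem_patterns n x : x \in patterns n -> size x = n /\ {subset x <= marks}.
Proof.
elim: n x => [|n IH] x; first by rewrite inE => /eqP ->.
move=> /allpairsPdep [a [y [aM /IH[sy yM] ->]]]; split; first by rewrite /= sy.
by move=> b; rewrite inE => /orP[/eqP ->|/yM].
Qed.

Lemma pmean0 phi : pmean 0 phi = phi [::].
Proof. by rewrite /pmean/= big_seq1 /pattern_weight big_nil mul1r. Qed.

Lemma pmeanS_marks n phi : pmean n.+1 phi =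
  \sum_(a <- marks) mark_weight a * pmean n (fun x => phi (a :: x)).
Proof.
rewrite /pmean patternsS big_allpairs_dep/=; apply: eq_bigr => a _.
rewrite mulr_sumr; apply: eq_bigr => x _.
by rewrite /pattern_weight big_cons mulrA.
Qed.

Lemma pmeanS_exch n phi : pmean n.+1 phi =
  pmean n (fun x => \sum_(a <- marks) mark_weight a * phi (a :: x)).
Proof.
rewrite pmeanS_marks /pmean.
under eq_bigr do rewrite mulr_sumr.
rewrite exchange_big/=; apply: eq_bigr => x _.
by rewrite mulr_sumr; apply: eq_bigr => a _; rewrite mulrCA.
Qed.

Lemma sum_marks (phi : option E -> R) :
  \sum_(a <- marks) mark_weight a * phi a =
  phi None + ring_prob * \sum_(e <- F) (phi (Some e) - phi None).
Proof.
rewrite /marks big_cons big_map /mark_weight /ring_prob -mulr_sumr.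
rewrite big_split/= sumrN big_const_seq count_predT iter_addr_0 -mulr_natr.
by field; rewrite gt_eqF.
Qed.

(** Averaging over the head mark in generator form: the idle value plus [ring_prob] times the sum of
    the increments over the edges. *)
Lemma pmeanS n phi : pmean n.+1 phi = pmean n (fun x => phi (None :: x) +
  ring_prob * \sum_(e <- F) (phi (Some e :: x) - phi (None :: x))).
Proof. by rewrite pmeanS_exch; apply: eq_bigr => x _; rewrite sum_marks. Qed.

Lemma pmean_le n phi psi :
  (forall x, size x = n -> {subset x <= marks} -> phi x <= psi x) ->
  pmean n phi <= pmean n psi.
Proof.
move=> h; rewrite /pmean !big_seq; apply: ler_sum => x /mem_patterns[sx xM].
by rewrite ler_wpM2l ?pattern_weight_ge0// h.
Qed.

Lemma pmeanZ n c phi : pmean n (fun x => c * phi x) = c * pmean n phi.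
Proof. by rewrite /pmean mulr_sumr; apply: eq_bigr => x _; rewrite mulrCA. Qed.

Lemma pmeanD n phi psi :
  pmean n (fun x => phi x + psi x) = pmean n phi + pmean n psi.
Proof. by rewrite /pmean -big_split; apply: eq_bigr => x _; rewrite mulrDr. Qed.

Lemma pmean_cst n c : pmean n (fun=> c) = c.
Proof.
elim: n => [|n IH]; first by rewrite pmean0.
rewrite pmeanS -[RHS]IH; apply: eq_bigr => x _.
by rewrite big1 ?mulr0 ?addr0// => e _; rewrite subrr.
Qed.

Lemma pmean_cat n k phi :
  pmean (n + k) phi = pmean n (fun x => pmean k (fun y => phi (x ++ y))).
Proof.
elim: n phi => [|n IH] phi; first by rewrite pmean0.
rewrite addSn !pmeanS_marks; apply: eq_bigr => a _; congr (_ * _).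
exact: IH.
Qed.

End pattern_mean.

End averaging.

(** * A Nash inequality *)

Section nash.
Variables (R : realType) (V E : choiceType) (ends : E -> V * V).
Variables (U : seq V) (F : seq E) (D : nat) (v : V).
Implicit Types (e : E) (g m h : V -> R) (x : seq (option E)).
Hypothesis U_uniq : uniq U.
Hypothesis F_ends : forall e, e \in F ->
  [/\ (ends e).1 \in U, (ends e).2 \in U & (ends e).1 != (ends e).2].
Hypothesis F_deg : forall u,
  \sum_(e <- F) ((u == (ends e).1)%:R + (u == (ends e).2)%:R) <= D%:R :> R.
Hypothesis D_gt0 : (0 < D)%N.
Hypothesis vU : v \in U.

Definition adj_in : rel V := fun u w =>
  has (fun e => (ends e == (u, w)) || (ends e == (w, u))) F.

Hypothesis U_conn : forall u, u \in U -> exists2 p, path adj_in v p & last v p = u.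

(** The path is simple, so each of its edges is charged once. Restricting the sum to edges with both
    ends on the path drives the induction: the first edge is not counted for the tail, which avoids
    [w]. *)
Lemma path_variation g w p : uniq (w :: p) -> path adj_in w p ->
  `|g w - g (last w p)| <=
  \sum_(e <- F | ((ends e).1 \in w :: p) && ((ends e).2 \in w :: p))
    `|g (ends e).1 - g (ends e).2|.
Proof.
elim: p w => [|y p IH] w; first by move=> _ _ /=; rewrite subrr normr0 sumr_ge0.
rewrite cons_uniq => /andP[wp up]; rewrite [path _ _ _]/= => /andP[/hasP[e eF ee] pp].
rewrite [last _ _]/= (le_trans (ler_distD (g y) _ _))//.
have gE : `|g (ends e).1 - g (ends e).2| = `|g w - g y|.
  by case/orP: ee => /eqP -> //=; rewrite distrC.
rewrite (big_rem e)//= ifT; last first.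
  by case/orP: ee => /eqP -> /=; rewrite !inE !eqxx ?orbT.
rewrite gE lerD2l (le_trans (IH _ up pp))//.
rewrite (big_rem e)//= ifF ?add0r; last first.
  by apply/negbTE; case/orP: ee => /eqP -> /=; rewrite (negPf wp) ?andbF.
rewrite big_mkcond [leRHS]big_mkcond/=; apply: ler_sum => e' _.
case: ifP => [/andP[h1 h2]|_]; last by case: ifP.
by rewrite ifT// (in_cons w) h1 (in_cons w) h2 !orbT.
Qed.

Lemma variation_from_root g u : u \in U ->
  `|g v - g u| <= \sum_(e <- F) `|g (ends e).1 - g (ends e).2|.
Proof.
move=> /U_conn[p vp <-]; case/shortenP: vp => p' vp' up' _.
rewrite (le_trans (path_variation _ up' vp'))//.
by rewrite big_mkcond/=; apply: ler_sum => e _; case: ifP.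
Qed.

Lemma seq_argmax (m : V -> R) : exists2 u0, u0 \in U & forall u, u \in U -> m u <= m u0.
Proof.
elim: U v vU => // a s IH w _; case: s IH => [|b s] IH.
  by exists a; rewrite ?inE// => u; rewrite inE => /eqP ->.
have [u0 u0s h] := IH b (mem_head _ _).
have [am|am] := leP (m a) (m u0).
  exists u0; first by rewrite inE u0s orbT.
  by move=> u; rewrite (in_cons a) => /orP[/eqP ->//|/h].
exists a; first by rewrite mem_head.
move=> u; rewrite (in_cons a) => /orP[/eqP ->//|/h um].
exact: le_trans um (ltW am).
Qed.

Definition dirichlet m : R := \sum_(e <- F) (m (ends e).1 - m (ends e).2) ^+ 2.

(** The inequality [2 * al * z <= z ^ 2 + al ^ 2] costs [al / 2] per edge, but truncation at [M / 2]
    leaves a difference only if [a + b >= M / 2]. The cost is then at most [al / M * (a + b)], which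
    sums to the degree bound. *)
Lemma clip_edge (M al a b : R) : 0 < M -> 0 < al -> 0 <= a -> 0 <= b ->
  `|Num.max a (M / 2) - Num.max b (M / 2)| <=
  (a - b) ^+ 2 / (2 * al) + al / M * (a + b).
Proof.
move=> M0 al0 a0 b0.
have key : M / 2 <= a + b -> `|a - b| <= (a - b) ^+ 2 / (2 * al) + al / M * (a + b).
  move=> Mab; have h1 : al / 2 <= al / M * (a + b).
    rewrite [leRHS](_ : _ = al * ((a + b) / M)); last by field; rewrite gt_eqF.
    by rewrite ler_wpM2l ?(ltW al0)// ler_pdivlMr// mulrC.
  rewrite (le_trans _ (lerD (lexx _) h1))//.
  rewrite -(@ler_pM2r _ (2 * al)) ?mulr_gt0//.
  have -> : ((a - b) ^+ 2 / (2 * al) + al / 2) * (2 * al) = `|a - b| ^+ 2 + al ^+ 2.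
    by rewrite real_normK ?num_real//; field; rewrite gt_eqF.
  have := sqr_ge0 (`|a - b| - al); nra.
have pos : 0 <= (a - b) ^+ 2 / (2 * al) + al / M * (a + b).
  rewrite addr_ge0// ?divr_ge0 ?sqr_ge0 ?mulr_ge0 ?invr_ge0 ?addr_ge0//; exact: ltW.
have [aM|aM] := leP a (M / 2); have [bM|bM] := leP b (M / 2).
- by rewrite subrr normr0.
- by apply: le_trans (key _); [rewrite !ler0_norm; lra | lra].
- by apply: le_trans (key _); [rewrite !ger0_norm; lra | lra].
- by apply: key; lra.
Qed.

(* The maximum [M] of a probability vector [m] is at least its energy, and a path from an argmax to
   some vertex below [M / 2] forces the truncation [max m (M / 2)] to vary by [M / 2]; only the at
   most [2 D / M] edges touching a vertex above [M / 2] contribute. *)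
Lemma nash_inequality m : (forall u, 0 <= m u) -> \sum_(u <- U) m u = 1 ->
  2 < energy U m * (size U)%:R -> energy U m ^+ 3 <= 32 * D%:R * dirichlet m.
Proof.
move=> m0 m1 QU.
have [u0 u0U mM] := seq_argmax m; set M := m u0 in mM.
have QM : energy U m <= M.
  rewrite -[leRHS]mulr1 -m1 mulr_sumr /energy !big_seq.
  by apply: ler_sum => u uU; rewrite expr2 ler_wpM2r ?mM.
have Q0 : 0 <= energy U m by apply: sumr_ge0 => u _; exact: sqr_ge0.
have MU : 2 < M * (size U)%:R by rewrite (lt_le_trans QU)// ler_wpM2r.
have M0 : 0 < M.
  by rewrite lt_neqAle m0 andbT; apply/eqP => M0; move: MU; rewrite -M0 mul0r; lra.
have D0 : 0 < D%:R :> R by rewrite ltr0n.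
(* If all values were at least [M / 2], the total mass would be at least [size U * M / 2 > 1]. This
   is where the lower bound on the energy enters. *)
have [u1 u1U u1M] : exists2 u, u \in U & m u < M / 2.
  apply: contrapT => /forall2NP H.
  have : \sum_(u <- U) M / 2 <= \sum_(u <- U) m u.
    rewrite !big_seq; apply: ler_sum => u uU.
    by have [//|/negP] := H u; rewrite -leNgt.
  rewrite m1 big_const_seq count_predT iter_addr_0 -mulr_natr; lra.
pose g u := Num.max (m u) (M / 2).
(* Paths are available from the root only: going from [u0] to [u1] through [v] uses the total
   variation twice, hence [M / 4] instead of [M / 2]. *)
have gap : M / 4 <= \sum_(e <- F) `|g (ends e).1 - g (ends e).2|.
  have := variation_from_root g u0U; have := variation_from_root g u1U.
  have -> : g u0 = M by apply/max_idPl; rewrite -/M; lra.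
  have -> : g u1 = M / 2 by apply/max_idPr; exact: ltW.
  have := ler_norm (M - g v); have := ler_norm (g v - M / 2).
  by rewrite (distrC (g v) M); lra.
(* Chosen so that [al / M * D] is [M / 8], half of the gap. *)
pose al := M ^+ 2 / (8 * D%:R).
have al0 : 0 < al by rewrite divr_gt0 ?exprn_gt0 ?mulr_gt0.
have tv : \sum_(e <- F) `|g (ends e).1 - g (ends e).2| <=
    dirichlet m / (2 * al) + al / M * D%:R.
  have := degree_sum U_uniq F_ends F_deg m0; rewrite m1 mulr1 => dm.
  have alM : 0 <= al / M by rewrite divr_ge0 ?ltW.
  apply: le_trans (lerD (lexx _) (ler_wpM2l alM dm)).
  rewrite mulr_suml mulr_sumr -big_split/=; apply: ler_sum => e _.
  exact: clip_edge.
have := le_trans gap tv.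
have -> : dirichlet m / (2 * al) + al / M * D%:R = 4 * D%:R * dirichlet m / M ^+ 2 + M / 8.
  by rewrite /al; field; rewrite !gt_eqF.
rewrite -lerBlDr ler_pdivlMr ?exprn_gt0// => h.
have : energy U m ^+ 3 <= M ^+ 3 by rewrite lerXn2r ?nnegrE// ltW.
by move=> /le_trans; apply; lra.
Qed.

End nash.

(** * Decay of the energy *)

(** After factoring out [q ^ k] this is [y ^ k <= y] on [[0, 1]]; it makes the loss of [Q ^ k]
    linear in the loss of energy. *)
Lemma powR_sub_le (R : realType) (q del k : R) : 0 < q -> 0 <= del <= q -> 1 <= k ->
  (q - del) `^ k <= q `^ k - q `^ k * (del / q).
Proof.
move=> q0 /andP[d0 dq] k1.
have y0 : 0 <= 1 - del / q by rewrite subr_ge0 ler_pdivrMr ?mul1r.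
have y1 : 1 - del / q <= 1 by rewrite gerBl divr_ge0// ltW.
have -> : q - del = q * (1 - del / q) by field; rewrite gt_eqF.
rewrite powRM ?(ltW q0)// [leRHS](_ : _ = q `^ k * (1 - del / q)); last by ring.
rewrite ler_wpM2l ?powR_ge0//.
move: y0; rewrite le_eqVlt => /predU1P[<-|y0].
  by rewrite powR0// gt_eqF// (lt_le_trans ltr01).
by apply: ge1r_powR => //; rewrite y0.
Qed.

Lemma powR_neg_bernoulli (R : realType) (a x : R) : 0 <= a -> 0 <= x ->
  1 - a * x <= (1 + x) `^ (- a).
Proof.
move=> a0 x0; have x1 : 0 < 1 + x by rewrite ltr_wpDr.
rewrite /powR gt_eqF// mulNr (le_trans _ (expR_ge1Dx _))//.
by rewrite lerB// ler_wpM2l// le_ln1Dx// (lt_le_trans _ x0).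
Qed.

Section decay.
Variables (R : realType) (V E : choiceType) (ends : E -> V * V).
Variables (U : seq V) (F : seq E) (D : nat) (v : V).
Implicit Types (e : E) (g m h : V -> R) (x : seq (option E)).
Hypothesis U_uniq : uniq U.
Hypothesis F_ends : forall e, e \in F ->
  [/\ (ends e).1 \in U, (ends e).2 \in U & (ends e).1 != (ends e).2].
Hypothesis F_deg : forall u,
  \sum_(e <- F) ((u == (ends e).1)%:R + (u == (ends e).2)%:R) <= D%:R :> R.
Hypothesis D_gt0 : (0 < D)%N.
Hypothesis vU : v \in U.
Hypothesis U_conn : forall u, u \in U ->
  exists2 p, path (adj_in ends F) v p & last v p = u.
Variable dl : R.
Hypothesis dl0 : 0 < dl.
Hypothesis dl1 : dl <= 1.
Let q := ring_prob F dl.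

Let q0 : 0 <= q. Proof. exact: ring_prob_ge0. Qed.

Lemma ring_prob_le : ring_prob F dl <= dl.
Proof.
have F0 : 0 <= dl * (size F)%:R by rewrite mulr_ge0// ltW.
by rewrite ler_pdivrMr ?ltr_wpDr// ler_peMr ?(ltW dl0)// lerDl.
Qed.

(** Twice the constant [32 * D] of the Nash inequality, since a ring removes only half of the
    squared difference. *)
Let den := 64 * D%:R : R.

Let den0 : 0 < den. Proof. by rewrite mulr_gt0 ?ltr0n. Qed.

Lemma energy_gt0 x : {subset x <= marks F} -> 0 < energy U (weights R ends v x).
Proof.
move=> xM; have m1 := sum_weights R U_uniq F_ends vU xM.
rewrite lt_neqAle sumr_ge0 ?andbT; last by move=> u _; exact: sqr_ge0.
apply/negP => /eqP/esym/eqP.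
rewrite psumr_eq0; last by move=> u _; exact: sqr_ge0.
move=> /allP z; move: m1; rewrite big_seq big1 => [/eqP|u uU].
  by rewrite eq_sym oner_eq0.
by have := z u uU; rewrite /= sqrf_eq0 => /eqP.
Qed.

(** The threshold [s] linearizes the drift. If [Q ^ 2 <= s], the right side is nonnegative and
    averaging never increases the energy. Otherwise Nash bounds the relative loss below by
    [Q ^ 2 / den], hence by [s / den]; the condition on [s] and [size U] puts [Q] in the range of
    Nash. *)
Lemma energy_pow_step (k s : R) x : 1 <= k -> {subset x <= marks F} ->
  0 < s -> 4 < s * (size U)%:R ^+ 2 ->
  \sum_(e <- F) (energy U (weights R ends v (Some e :: x)) `^ k -
                 energy U (weights R ends v (None :: x)) `^ k) <=
  - (s / den * (energy U (weights R ends v x) `^ k - s `^ (k / 2))).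
Proof.
move=> k1 xM s0 sU /=; set m := weights R ends v x.
have m0 u : 0 <= m u by exact: weights_ge0.
have m1 : \sum_(u <- U) m u = 1 by exact: (sum_weights R U_uniq F_ends vU xM).
set Q := energy U m; have Q0 : 0 < Q by exact: energy_gt0.
have stepe e : e \in F -> energy U (average ends e m) `^ k - Q `^ k <=
    - (Q `^ k * ((m (ends e).1 - m (ends e).2) ^+ 2 / 2 / Q)).
  move=> eF; have ea := energy_average U_uniq F_ends m eF; rewrite -/Q in ea.
  have E0 : 0 <= energy U (average ends e m) by apply: sumr_ge0 => u _; exact: sqr_ge0.
  rewrite ea in E0.
  rewrite ea; move: E0; set del := _ / 2 => E0.
  have del0 : 0 <= del <= Q by rewrite divr_ge0 ?sqr_ge0//= -subr_ge0.
  by have := powR_sub_le Q0 del0 k1; rewrite -lerBlDl.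
have sum1 : \sum_(e <- F) (energy U (average ends e m) `^ k - Q `^ k) <=
    - (Q `^ k * (dirichlet ends F m / 2 / Q)).
  rewrite /dirichlet !mulr_suml mulr_sumr -sumrN !big_seq.
  by apply: ler_sum => e /stepe.
have Qk0 : 0 <= Q `^ k by exact: powR_ge0.
have dir0 : 0 <= dirichlet ends F m by apply: sumr_ge0 => e _; exact: sqr_ge0.
have [Qs|sQ] := leP (Q ^+ 2) s.
  have Qk : Q `^ k <= s `^ (k / 2).
    have -> : Q `^ k = (Q ^+ 2) `^ (k / 2).
      by rewrite -powR_mulrn ?ltW// -powRrM mulrC divfK.
    apply: ge0_ler_powR => //; rewrite ?nnegrE ?sqr_ge0 ?divr_ge0 ?ltW//; lra.
  apply: (le_trans sum1); apply: (@le_trans _ _ 0).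
    by rewrite oppr_le0 mulr_ge0// divr_ge0 ?divr_ge0// ltW.
  by rewrite oppr_ge0 mulr_ge0_le0 ?divr_ge0 ?subr_le0// ltW.
apply: (le_trans sum1); rewrite lerN2.
have QU : 2 < Q * (size U)%:R.
  rewrite -(@ltr_pXn2r _ 2) ?nnegrE ?mulr_ge0 ?(ltW Q0)// exprMn.
  apply: le_lt_trans (_ : _ <= 4) _; first by lra.
  by rewrite (lt_le_trans sU)// ler_wpM2r ?exprn_ge0// ltW.
have nash : Q ^+ 3 <= 32 * D%:R * dirichlet ends F m.
  exact: (nash_inequality U_uniq F_ends F_deg D_gt0 vU U_conn m0 m1 QU).
apply: (@le_trans _ _ (s / den * Q `^ k)).
  by rewrite ler_wpM2l ?divr_ge0 ?(ltW s0) ?(ltW den0)// gerBl powR_ge0.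
rewrite mulrC ler_wpM2l// ler_pdivlMr// mulrAC ler_pdivrMr//.
apply: (@le_trans _ _ (Q ^+ 2 * Q)); first by rewrite ler_wpM2r ?(ltW Q0) ?(ltW sQ).
by move: nash; rewrite /den exprSr; lra.
Qed.

(** The factor [k] cancels the exponent [k / 2] that the Bernoulli inequality brings down in the
    induction below. *)
Definition decay_rate (k : R) : R := (den * k)^-1.

Lemma decay_rate_gt0 k : 0 < k -> 0 < decay_rate k.
Proof. by move=> k0; rewrite invr_gt0 mulr_gt0. Qed.

(** With threshold [s = 1 / t] the new mean is at most [(1 - c)] times the old one plus
    [c * t ^ (- k / 2)]. The factor 2 in the bound leaves room: [2 * (1 - c) + c = 2 * (1 - c / 2)],
    and [1 - c / 2] is at most the decrease of the power from [t] to the next time. *)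
Lemma energy_decay (k : R) n : 1 <= k ->
  4 * (1 + decay_rate k * q * n%:R) < (size U)%:R ^+ 2 ->
  pmean F dl n (fun x => energy U (weights R ends v x) `^ k) <=
  2 * (1 + decay_rate k * q * n%:R) `^ (- (k / 2)).
Proof.
move=> k1; have k0 : 0 < k by rewrite (lt_le_trans ltr01).
have kq0 : 0 <= decay_rate k * q by rewrite mulr_ge0// ltW// decay_rate_gt0.
elim: n => [|n IH] nU.
  rewrite pmean0 mulr0 addr0 powR1 mulr1 /energy/=.
  have -> : \sum_(u <- U) ((u == v)%:R : R) ^+ 2 = 1.
    by rewrite (bigD1_seq v)//= eqxx expr1n big1 ?addr0// => u /negPf ->; rewrite expr0n.
  by rewrite powR1 ler1n.
set t := 1 + _ * n%:R in IH; have t0 : 0 < t by rewrite ltr_wpDr// mulr_ge0.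
have tS : 1 + decay_rate k * q * n.+1%:R = t + decay_rate k * q.
  by rewrite /t -addn1 natrD mulrDr mulr1 addrA.
rewrite tS in nU *.
have {}IH : pmean F dl n (fun x => energy U (weights R ends v x) `^ k) <= 2 * t `^ (- (k / 2)).
  apply: IH; apply: le_lt_trans nU; rewrite ler_pM2l//; lra.
have s0 : 0 < t^-1 by rewrite invr_gt0.
have sU : 4 < t^-1 * (size U)%:R ^+ 2.
  rewrite mulrC ltr_pdivlMr//; apply: le_lt_trans nU; rewrite ler_pM2l//; lra.
have tk : t^-1 `^ (k / 2) = t `^ (- (k / 2)).
  by rewrite -powR_inv1 ?ltW// -powRrM mulN1r.
set c := q * (t^-1 / den).
have c0 : 0 <= c by rewrite mulr_ge0// divr_ge0// ltW.
have c1 : c <= 1.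
  have q1 : q <= 1 by rewrite (le_trans (ring_prob_le)).
  have t1 : t^-1 <= 1 by rewrite invf_le1// lerDl mulr_ge0.
  have d1 : den^-1 <= 1.
    have D1 : 1 <= D%:R :> R by rewrite ler1n.
    by rewrite invf_le1// /den; lra.
  have s0' := ltW s0; have d0' : 0 <= den^-1 by rewrite invr_ge0 ltW.
  have td : t^-1 / den <= 1 by exact: mulr_ile1.
  by apply: mulr_ile1 => //; exact: mulr_ge0.
rewrite pmeanS//; apply: (@le_trans _ _ (pmean F dl n (fun x =>
    (1 - c) * energy U (weights R ends v x) `^ k + c * t `^ (- (k / 2))))).
  apply: pmean_le => // x _ xM; rewrite -/q.
  have := ler_wpM2l q0 (energy_pow_step k1 xM s0 sU); rewrite tk /= /c.
  lra.
rewrite pmeanD (pmeanZ F dl n (1 - c) (fun x => energy U (weights R ends v x) `^ k)) pmean_cst//.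
apply: (@le_trans _ _ (2 * t `^ (- (k / 2)) * (1 - (k / 2) * (decay_rate k * q / t)))).
  have -> : (k / 2) * (decay_rate k * q / t) = c / 2.
    by rewrite /c /decay_rate; field; rewrite !gt_eqF.
  have {IH} : (1 - c) * _ <= (1 - c) * _ := ler_wpM2l (_ : 0 <= 1 - c) IH.
  rewrite subr_ge0 => /(_ c1).
  by move: (pmean _ _ _ _) (t `^ _) => A B; lra.
rewrite -mulrA ler_pM2l//.
have -> : t + decay_rate k * q = t * (1 + decay_rate k * q / t).
  by field; rewrite gt_eqF.
have rt0 : 0 <= decay_rate k * q / t by rewrite divr_ge0// ltW.
rewrite powRM ?(ltW t0) ?addr_ge0// ler_wpM2l ?powR_ge0//.
by apply: powR_neg_bernoulli => //; rewrite divr_ge0// ltW.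
Qed.

End decay.

(** * Exit from a ball and a maximal inequality *)

Section exit_and_maximal.
Variables (R : realType) (V E : choiceType) (ends : E -> V * V).
Variables (U : seq V) (F : seq E) (D : nat) (v : V).
Implicit Types (e : E) (g m h : V -> R) (x : seq (option E)).
Hypothesis U_uniq : uniq U.
Hypothesis F_ends : forall e, e \in F ->
  [/\ (ends e).1 \in U, (ends e).2 \in U & (ends e).1 != (ends e).2].
Hypothesis F_deg : forall u,
  \sum_(e <- F) ((u == (ends e).1)%:R + (u == (ends e).2)%:R) <= D%:R :> R.
Hypothesis vU : v \in U.
Variable dl : R.
Hypothesis dl0 : 0 < dl.
Let q := ring_prob F dl.

Let q0 : 0 <= q. Proof. exact: ring_prob_ge0. Qed.

Section exit.
Variable d : V -> nat.
Hypothesis dv : d v = 0%N.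
Hypothesis d_lip : forall e, e \in F ->
  (d (ends e).1 <= (d (ends e).2).+1)%N /\ (d (ends e).2 <= (d (ends e).1).+1)%N.

(** Only the support of the weights is measured, each vertex counting [2 ^ d]: a ring can charge at
    most the other endpoint, whose share is at most twice as large by the Lipschitz bound on [d]. *)
Let mass m : R := \sum_(u <- U) (0 < m u)%R%:R * 2 ^+ d u.

Lemma mass_average e m : e \in F -> (forall u, 0 <= m u) ->
  mass (average ends e m) - mass m <=
  2 * ((0 < m (ends e).1)%R%:R * 2 ^+ d (ends e).1 +
       (0 < m (ends e).2)%R%:R * 2 ^+ d (ends e).2).
Proof.
move=> eF m0; rewrite /mass !(sum_edge_split U_uniq F_ends _ eF).
under [X in _ + X - _]eq_bigr => u uu do rewrite average_out//.
have cancel_common (a b z : R) : a + z - (b + z) = a - b by ring.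
rewrite cancel_common average1 average2.
have [h1 h2] := d_lip eF.
have p1 : 2 ^+ d (ends e).1 <= 2 * 2 ^+ d (ends e).2 :> R.
  by rewrite -exprS ler_weXn2l// ler1n.
have p2 : 2 ^+ d (ends e).2 <= 2 * 2 ^+ d (ends e).1 :> R.
  by rewrite -exprS ler_weXn2l// ler1n.
have q1 : 0 <= 2 ^+ d (ends e).1 :> R by rewrite exprn_ge0.
have q2 : 0 <= 2 ^+ d (ends e).2 :> R by rewrite exprn_ge0.
have := m0 (ends e).1; rewrite le_eqVlt => /predU1P[<-|m1];
have := m0 (ends e).2; rewrite le_eqVlt => /predU1P[<-|m2].
- by rewrite addr0 mul0r ltxx !mul0r; lra.
- by rewrite add0r divr_gt0// ltxx m2 !mul0r !mul1r; lra.
- by rewrite addr0 divr_gt0// ltxx m1 !mul0r !mul1r; lra.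
- by rewrite divr_gt0 ?addr_gt0// m1 m2 !mul1r; lra.
Qed.

(** Markov's inequality for [mass], which starts at 1, grows on average by at most [1 + 2 * D * q]
    per slot, and is at least [2 ^ r] once distance [r] is reached. *)
Lemma pmean_exit n r :
  pmean F dl n (fun x => (has (fun u => (r <= d u)%N && (0 < weights R ends v x u)%R) U)%R%:R)
  <= (1 + 2 * D%:R * q) ^+ n / 2 ^+ r.
Proof.
rewrite ler_pdivlMr ?exprn_gt0// mulrC -pmeanZ.
apply: (@le_trans _ _ (pmean F dl n (fun x => mass (weights R ends v x)))).
  apply: pmean_le => // x _ _; have t0 u : 0 <= (0 < weights R ends v x u)%R%:R * 2 ^+ d u :> R.
    by rewrite mulr_ge0// exprn_ge0.
  case: hasP => [[u uU /andP[ru wu]]|_]; last by rewrite mulr0 sumr_ge0.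
  rewrite mulr1 /mass (bigD1_seq u)//= wu mul1r (le_trans (_ : _ <= 2 ^+ d u))//.
    by rewrite ler_weXn2l// ler1n.
  by rewrite lerDl sumr_ge0.
elim: n => [|n IH].
  rewrite pmean0 expr0 /mass (bigD1_seq v)//= eqxx ltr01 dv expr0 mulr1 big1 ?addr0//.
  by move=> u /negPf ->; rewrite ltxx mul0r.
rewrite pmeanS// exprS.
apply: (@le_trans _ _ (pmean F dl n (fun x => (1 + 2 * D%:R * q) * mass (weights R ends v x)))).
  apply: pmean_le => // x _ xM; rewrite mulrDl mul1r lerD2l /= -/q.
  rewrite [leRHS](_ : _ = q * (2 * (D%:R * mass (weights R ends v x)))); last by ring.
  rewrite ler_wpM2l//; set m := weights R ends v x.
  have m0 u : 0 <= m u by exact: weights_ge0.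
  apply: (@le_trans _ _ (\sum_(e <- F) 2 * ((0 < m (ends e).1)%R%:R * 2 ^+ d (ends e).1 +
       (0 < m (ends e).2)%R%:R * 2 ^+ d (ends e).2))).
    by rewrite !big_seq; apply: ler_sum => e eF; exact: mass_average.
  rewrite -mulr_sumr ler_pM2l//.
  apply: (degree_sum U_uniq F_ends F_deg (h := fun u => (0 < m u)%R%:R * 2 ^+ d u)).
  by move=> u; rewrite mulr_ge0// exprn_ge0.
by rewrite pmeanZ ler_wpM2l// addr_ge0// mulr_ge0// mulr_ge0.
Qed.

End exit.

Fixpoint ever (b : R -> bool) x g : bool :=
  b (g v) || if x is a :: x' then ever b x' (act ends a g) else false.

Lemma ever_take (b : R -> bool) x g k : (k <= size x)%N ->
  b (evolve ends (take k x) g v) -> ever b x g.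
Proof.
elim: x g k => [|a x IH] g [|k] //=; try by move=> _ ->.
by rewrite ltnS => kx h; rewrite (IH _ k)// orbT.
Qed.

Hypothesis qD : D%:R * q <= 1.

Let c := 1 - D%:R * q.

Let c0 : 0 <= c. Proof. by rewrite subr_ge0. Qed.

Lemma pmean_stay (b : R -> bool) n g : b (g v) ->
  c ^+ n <= pmean F dl n (fun x => (b (evolve ends x g v))%:R).
Proof.
elim: n g => [|n IH] g bg; first by rewrite pmean0 /= bg.
rewrite pmeanS_marks//.
(* A minorant of the indicator that the mark misses the root: 1 if it does, at most 0 otherwise, and
   additive over endpoints so that [F_deg] bounds its mean. *)
pose stays (a : option E) : R :=
  if a is Some e then 1 - ((v == (ends e).1)%:R + (v == (ends e).2)%:R) else 1.
apply: (@le_trans _ _ (\sum_(a <- marks F) mark_weight F dl a * (stays a * c ^+ n))).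
  under eq_bigr do rewrite mulrA.
  rewrite -mulr_suml exprS ler_wpM2r ?exprn_ge0// sum_marks//= -/q.
  rewrite (eq_bigr (fun e => - ((v == (ends e).1)%:R + (v == (ends e).2)%:R))); last first.
    by move=> e _; rewrite addrAC subrr add0r.
  by rewrite sumrN mulrN /c lerB// mulrC ler_wpM2r.
rewrite !big_seq; apply: ler_sum => a aM; rewrite ler_wpM2l ?mark_weight_ge0//.
have pos g' : 0 <= pmean F dl n (fun x => (b (evolve ends x g' v))%:R) :> R.
  by rewrite sumr_ge0// => x _; rewrite mulr_ge0 ?pattern_weight_ge0.
have cn : 0 <= c ^+ n by rewrite exprn_ge0.
case: a aM => [e|] _ /=; last by rewrite mul1r IH.
have [ve|] := boolP ((v == (ends e).1) || (v == (ends e).2)).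
  apply: le_trans (pos _); rewrite mulr_le0_ge0// subr_le0.
  by case/orP: ve => /eqP ->; rewrite eqxx ?lerDl ?lerDr.
rewrite negb_or => /andP[v1 v2].
rewrite (negPf v1) (negPf v2) addr0 subr0 mul1r; apply: IH.
by rewrite average_out ?v1.
Qed.

(* Once [b] holds at the root, it still holds at the end if no edge at the root rings any more. *)
Lemma pmean_maximal (b : R -> bool) n g :
  c ^+ n * pmean F dl n (fun x => (ever b x g)%:R) <=
  pmean F dl n (fun x => (b (evolve ends x g v))%:R).
Proof.
elim: n g => [|n IH] g; first by rewrite !pmean0 /= orbF mul1r.
have [bg|bg] := boolP (b (g v)).
  apply: le_trans (pmean_stay _ bg); rewrite ler_piMr ?exprn_ge0//.
  rewrite -[leRHS](pmean_cst F dl0 n.+1); apply: pmean_le => // x _ _.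
  by case: ever.
rewrite !pmeanS_marks// mulr_sumr; apply: ler_sum => a _.
rewrite mulrCA ler_wpM2l ?mark_weight_ge0// /= (negPf bg) /=.
apply: le_trans (IH _); rewrite exprS -mulrA ler_piMl//.
  rewrite mulr_ge0 ?exprn_ge0// sumr_ge0// => x _.
  by rewrite mulr_ge0 ?pattern_weight_ge0.
by rewrite gerBl mulr_ge0.
Qed.

End exit_and_maximal.

(** * Independence of a driving variable from the past *)

Lemma List_InE (T : eqType) (x : T) (s : seq T) : List.In x s <-> x \in s.
Proof.
elim: s => //= y s IH; rewrite inE; split.
  by case=> [->|/IH ->]; rewrite ?eqxx ?orbT.
by case/orP => [/eqP ->|/IH ?]; [left|right].
Qed.

Lemma List_NoDupE (T : eqType) (s : seq T) : List.NoDup s <-> uniq s.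
Proof.
elim: s => [|y s IH] /=; first by split=> // _; constructor.
split.
  by move=> /List.NoDup_cons_iff [/List_InE ys /IH ->]; rewrite andbT; apply/negP.
by move=> /andP[ys us]; constructor; [move/List_InE; exact/negP|exact/IH].
Qed.

Section integral_indep.
Context d (Omega : measurableType d) (R : realType) (P : probability Omega R).
Context d1 d2 (H1 : measurableType d1) (H2 : measurableType d2).
Variables (T : Omega -> H1) (Z : Omega -> H2).
Hypotheses (mT : measurable_fun setT T) (mZ : measurable_fun setT Z).
Hypothesis TZ : forall A B, measurable A -> measurable B ->
  P (T @^-1` A `&` Z @^-1` B) = (P (T @^-1` A) * P (Z @^-1` B))%E.

(** The law of the pair is the product of the laws, as they agree on rectangles; Tonelli then
    separates the two variables. *)
Lemma integral_indep (G : H1 * H2 -> \bar R) :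
  measurable_fun setT G -> (forall y, 0 <= G y)%E ->
  (\int[P]_w G (T w, Z w) = \int[P]_w \int[P]_w' G (T w, Z w'))%E.
Proof.
move=> mG G0.
pose T' : {mfun Omega >-> H1} := mfun_Sub (mem_set mT).
pose Z' : {mfun Omega >-> H2} := mfun_Sub (mem_set mZ).
have mphi : measurable_fun setT (fun w : Omega => (T w, Z w)).
  exact/measurable_fun_pair.
pose phi : {mfun Omega >-> (H1 * H2)%type} := mfun_Sub (mem_set mphi).
transitivity (\int[distribution P phi]_y G y)%E.
  by rewrite ge0_integral_distribution.
transitivity (\int[distribution P T' \x distribution P Z']_y G y)%E.
  apply: eq_measure_integral => A mA _; apply/esym.
  apply: product_measure_unique mA => A1 A2 mA1 mA2.
  exact: TZ.
rewrite fubini_tonelli1// /fubini_F.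
have mF : measurable_fun setT (fubini_F (distribution P Z') G).
  exact: measurable_fun_fubini_tonelli_F.
rewrite (ge0_integral_distribution T' mF)//; last first.
  by move=> w; exact: integral_ge0.
apply: eq_integral => w _; rewrite /= /fubini_F.
rewrite (ge0_integral_distribution Z')//.
exact: measurableT_comp.
Qed.

End integral_indep.

Section past.
Context d (Omega : measurableType d) (R : realType) (P : probability Omega R).
Variables (I : choiceType) (X : I -> Omega -> R).
Hypothesis indX : mutually_independent P X.

Let mX i : measurable_fun setT (X i).
Proof. by have [+ _] := indX; exact. Qed.

Definition cylinder (J : seq I) (B : I -> set R) : set Omega :=
  \bigcap_(i in [set i | List.In i J]) (X i @^-1` B i).

(** A family stable under intersection that generates the sigma-algebra of the variables with index
    in [S]. *)
Definition cylinders (S : set I) : set (set Omega) :=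
  [set C | exists J B, [/\ uniq J, (forall i, i \in J -> S i),
     (forall i, measurable (B i)) & C = cylinder J B]].

(** The space [Omega] with a coarser sigma-algebra: being determined by the variables of [S] becomes
    measurability out of [past S]. *)
Local Notation past S := (g_sigma_algebraType (cylinders S)).

Lemma measurable_preimage_X i B : measurable B -> measurable (X i @^-1` B).
Proof. by move=> mB; rewrite -[_ @^-1` _]setTI; exact: mX. Qed.

Lemma cylinderP J B w : cylinder J B w <-> forall i, i \in J -> B i (X i w).
Proof.
by split=> [h i iJ|h i]; [apply: h; exact/List_InE|move=> /List_InE; exact: h].
Qed.

Lemma cylinders_measurable S : cylinders S `<=` measurable.
Proof.
move=> _ [J [B [_ _ mB ->]]]; apply: fin_bigcap_measurable => [|i _].
  rewrite (_ : [set i | List.In i J] = [set` J]); first exact: finite_seq.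
  by apply/seteqP; split => i /List_InE.
exact: measurable_preimage_X.
Qed.

Lemma past_measurable S (A : set Omega) : <<s cylinders S >> A -> measurable A.
Proof.
apply: smallest_sub; last exact: cylinders_measurable.
exact: sigma_algebra_measurable.
Qed.

Lemma cylinders_setI S : setI_closed (cylinders S).
Proof.
move=> _ _ [J1 [B1 [u1 S1 m1 ->]]] [J2 [B2 [u2 S2 m2 ->]]].
exists (undup (J1 ++ J2)), (fun i => (if i \in J1 then B1 i else setT) `&`
  (if i \in J2 then B2 i else setT)); split.
- exact: undup_uniq.
- by move=> i; rewrite mem_undup mem_cat => /orP[/S1|/S2].
- by move=> i; apply: measurableI; case: ifP.
apply/seteqP; split => w.
  move=> [/cylinderP h1 /cylinderP h2]; apply/cylinderP => i _.
  by split; case: ifP => //; [exact: h1|exact: h2].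
move/cylinderP => h; split; apply/cylinderP => i iJ.
  by have := h i; rewrite mem_undup mem_cat iJ => /(_ isT) [].
by have := h i; rewrite mem_undup mem_cat iJ orbT => /(_ isT) [].
Qed.

(** Both sides are finite measures in [A], so it is enough to compare them on cylinders; there the
    product formula for [i :: J] applies because [i] lies outside [S], hence outside [J]. *)
Lemma past_indep S i A B : ~ S i -> <<s cylinders S >> A -> measurable B ->
  P (A `&` X i @^-1` B) = (P A * P (X i @^-1` B))%E.
Proof.
move=> Si sA mB; set C := X i @^-1` B.
have mC : measurable C by exact: measurable_preimage_X.
have r0 : 0 <= fine (P C) by exact/fine_ge0/measure_ge0.
have PC : P C = (fine (P C))%:E by rewrite fineK// fin_num_measure.
rewrite muleC PC -[RHS]/(mscale (NngNum r0) P A) -[LHS]/(mrestr P mC A).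
apply: (@g_sigma_algebra_measure_unique _ _ _ (cylinders S) (@cylinders_measurable S)
  (fun=> setT)) => //.
- move=> _; exists [::], (fun=> setT); split => //.
  by apply/esym/seteqP; split => // w _; exact/cylinderP.
- by apply/seteqP; split => // w _; exists 0%N.
- exact: cylinders_setI.
- move=> _ [J [B' [uJ JS mB' ->]]]; rewrite /= /mrestr /mscale/= -PC.
  have iJ : i \notin J by apply/negP => /JS.
  have [_ prodX] := indX.
  pose B'' j := if j == i then B else B' j.
  have mB'' j : measurable (B'' j) by rewrite /B''; case: ifP.
  have B''J j : j \in J -> B'' j = B' j.
    by rewrite /B''; case: eqP => // -> h; rewrite h in iJ.
  have := prodX (i :: J) B''; rewrite big_cons /B'' eqxx -/B''.
  have -> : \bigcap_(j in [set j | List.In j (i :: J)]) X j @^-1` B'' j = cylinder J B' `&` C.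
    apply/seteqP; split => w.
      move=> h; split; last by have := h i (or_introl erefl); rewrite /= /B'' eqxx.
      by apply/cylinderP => j jJ; rewrite -B''J//; apply: h; right; exact/List_InE.
    move=> [/cylinderP h Cw] j [<-|/List_InE jJ]; first by rewrite /= /B'' eqxx.
    by rewrite /= B''J//; exact: h.
  move=> -> //; last by apply/List_NoDupE; rewrite /= iJ.
  congr (_ * _)%E; have := prodX J B''; rewrite -/(cylinder J B'').
  have -> : cylinder J B'' = cylinder J B'.
    by apply/seteqP; split => w /cylinderP h; apply/cylinderP => j jJ;
      have := h j jJ; rewrite B''J.
  by move=> -> //; exact/List_NoDupE.
- by move=> _; rewrite /= /mrestr setTI ltey_eq fin_num_measure.
Qed.

Lemma measurable_past_X S i : S i -> measurable_fun setT (X i : past S -> R).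
Proof.
move=> Si _ B mB; rewrite setTI; apply: sub_sigma_algebra.
exists [:: i], (fun=> B); split => //; first by move=> j; rewrite inE => /eqP ->.
by apply/seteqP; split => w; [move=> Bw; apply/cylinderP => j; rewrite inE => /eqP ->|
  move/cylinderP; apply; exact: mem_head].
Qed.

Lemma past_sub S1 S2 (A : set Omega) : S1 `<=` S2 ->
  <<s cylinders S1 >> A -> <<s cylinders S2 >> A.
Proof.
move=> S12; apply: sub_sigma_algebra2 => _ [J [B [uJ JS mB ->]]].
by exists J, B; split => // i /JS; exact: S12.
Qed.


(** The freezing principle: a quantity [T] of the past may be held constant while the fresh variable
    [X i] is integrated. *)
Lemma integral_past S i d' (H : measurableType d') (T : Omega -> H)
    (G : H * R -> \bar R) : ~ S i -> measurable_fun setT (T : past S -> H) ->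
  measurable_fun setT G -> (forall y, 0 <= G y)%E ->
  (\int[P]_w G (T w, X i w) = \int[P]_w \int[P]_w' G (T w, X i w'))%E.
Proof.
move=> Si mT; apply: integral_indep => //.
  move=> _ B mB; apply: (@past_measurable S).
  exact: (mT measurableT).
move=> A B mA mB; apply: (past_indep Si) => //.
by rewrite -[_ @^-1` _]setTI; exact: (mT measurableT).
Qed.

End past.

(** * Exponential clocks *)

Section exponential.
Context d (Omega : measurableType d) (R : realType) (P : probability Omega R).
Variable Z : Omega -> R.
Hypothesis mZ : measurable_fun setT Z.
Hypothesis Zexp : exp1_distributed P Z.

Let mZI (J : set R) : measurable J -> measurable (Z @^-1` J).
Proof. by move=> mJ; rewrite -[_ @^-1` _]setTI; exact: mZ. Qed.

Lemma prob_exp_gt (s : R) : 0 <= s -> P (Z @^-1` `]s, +oo[) = (expR (- s))%:E.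
Proof.
move=> s0; rewrite -(Zexp s0); congr (P _).
by apply/seteqP; split => w /=; rewrite in_itv/= andbT.
Qed.

Lemma prob_exp_itv (a b : R) : 0 <= a -> a <= b ->
  P (Z @^-1` `]a, b]) = (expR (- a) - expR (- b))%:E.
Proof.
move=> a0 ab; have b0 := le_trans a0 ab.
have : P (Z @^-1` `]a, +oo[) = (P (Z @^-1` `]a, b]) + P (Z @^-1` `]b, +oo[))%E.
  rewrite -measureU; [|exact: mZI|exact: mZI|].
    congr (P _); apply/seteqP; split => w /=; rewrite !in_itv/= !andbT.
      by move=> ->; case: leP => [|?]; [left|right].
    by case=> [/andP[]//|]; exact: le_lt_trans.
  apply/seteqP; split => w //= []; rewrite !in_itv/= andbT => /andP[_ h1] h2.
  by move: (le_lt_trans h1 h2); rewrite ltxx.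
rewrite !prob_exp_gt//; have : P (Z @^-1` `]a, b]) \is a fin_num.
  by rewrite fin_num_measure//; exact: mZI.
by case: (P _) => // r _; rewrite -EFinD => -[->]; congr (_%:E); lra.
Qed.

(** The weight [expR Z] cancels the exponential density, so that [F a b] ought to be the length of
    the interval. *)
Let F (a b : R) := (\int[P]_(w in Z @^-1` `]a, b]) (expR (Z w))%:E)%E.

Let mexpZ D : measurable D -> measurable_fun D (fun w => (expR (Z w))%:E).
Proof.
by move=> mD; apply/measurable_EFinP/measurableT_comp => //; exact: measurable_funTS.
Qed.

Lemma integral_exp_itv_bounds (a y : R) : 0 <= a -> 0 <= y ->
  ((1 - expR (- y))%:E <= F a (a + y) <= (expR y - 1)%:E)%E.
Proof.
move=> a0 y0; have ay : a <= a + y by rewrite lerDl.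
have mD : measurable (Z @^-1` `]a, a + y]) by exact: mZI.
apply/andP; split.
  apply: (@le_trans _ _ (\int[P]_(w in Z @^-1` `]a, (a + y)%R]) (expR a)%:E)%E).
    rewrite integral_cst//= prob_exp_itv// -EFinM lee_fin mulrBr -!expRD.
    by rewrite subrr expR0 (_ : a - (a + y) = - y)//; ring.
  apply: ge0_le_integral => //.
  - exact: mexpZ.
  - by move=> w /=; rewrite in_itv/= lee_fin ler_expR => /andP[/ltW].
apply: (@le_trans _ _ (\int[P]_(w in Z @^-1` `]a, (a + y)%R]) (expR (a + y))%:E)%E).
  apply: ge0_le_integral => //.
  - exact: mexpZ.
  - by move=> w /=; rewrite in_itv/= lee_fin ler_expR => /andP[_].
rewrite integral_cst//= prob_exp_itv// -EFinM lee_fin mulrBr -!expRD subrr expR0.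
by rewrite (_ : a + y - a = y)//; ring.
Qed.

Lemma integral_exp_itvD (a b c : R) : a <= b -> b <= c -> F a c = (F a b + F b c)%E.
Proof.
move=> ab bc; rewrite /F -ge0_integral_setU//.
- congr (integral _ _ _); apply/seteqP; split => w /=; rewrite !in_itv/=.
    move=> /andP[-> wc]; rewrite wc andbT.
    by case: leP => [|?]; [left|right].
  by case=> /andP[h1 h2]; rewrite ?(le_trans h2 bc) ?(le_lt_trans ab h1) ?h1 ?h2.
- exact: mZI.
- exact: mZI.
- by apply: mexpZ; apply: measurableU; exact: mZI.
- apply/disj_setPS => w /= []; rewrite !in_itv/= => /andP[_ h1] /andP[h2 _].
  by move: (le_lt_trans h1 h2); rewrite ltxx.
Qed.

Lemma integral_exp_itv_iter (a y : R) n : 0 <= a -> 0 <= y ->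
  ((n%:R * (1 - expR (- y)))%:E <= F a (a + n%:R * y) <= (n%:R * (expR y - 1))%:E)%E.
Proof.
move=> a0 y0; elim: n => [|n IH].
  rewrite !mul0r addr0 /F set_itvE preimage_set0 integral_set0.
  by rewrite !lexx.
have s1 : a <= a + n%:R * y by rewrite lerDl mulr_ge0.
have e1 : a + n.+1%:R * y = a + n%:R * y + y by rewrite -addn1 natrD; ring.
rewrite (integral_exp_itvD s1); last by rewrite e1 lerDl.
have natS (z : R) : n.+1%:R * z = n%:R * z + z by rewrite -addn1 natrD mulrDl mul1r.
rewrite e1 !natS (EFinD (_ * (1 - _))) (EFinD (_ * (expR y - 1))).
have /andP[h1 h2] := integral_exp_itv_bounds (le_trans a0 s1) y0.
by move: IH => /andP[h3 h4]; apply/andP; split; exact: leeD.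
Qed.

(** Only the tail of [Z] is given, so no density is used. Cut into [N] pieces of length [y], the
    integral lies between [N * (1 - expR (- y))] and [N * (expR y - 1)]; both are [N * y] up to
    [O(N * y ^ 2)], that is [O(h ^ 2 / N)]. *)
Lemma integral_exp_itv (a b : R) : 0 <= a -> a <= b -> F a b = (b - a)%:E.
Proof.
move=> a0 ab; set h := b - a; have h0 : 0 <= h by rewrite subr_ge0.
have bnd n : ((n.+1%:R * (1 - expR (- (h / n.+1%:R))))%:E <= F a b <=
              (n.+1%:R * (expR (h / n.+1%:R) - 1))%:E)%E.
  have := @integral_exp_itv_iter a (h / n.+1%:R) n.+1 a0.
  rewrite divr_ge0// => /(_ isT).
  by rewrite (_ : a + _ * (h / _) = b)// /h; field.
have : F a b \is a fin_num.
  have /andP[h1 h2] := bnd 0%N; rewrite fin_numE gt_eqF ?lt_eqF//.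
    by rewrite (le_lt_trans h2)// ltry.
  by rewrite (lt_le_trans _ h1)// ltNyr.
case: (F a b) bnd => // r bnd _; congr (_%:E).
(* The first bound makes the total error at most [e]; the second gives [y <= 1 / 2], needed for
   [expR y - 1 <= y + 2 * y ^ 2]. *)
have nlarge e : 0 < e -> exists n : nat, 2 * h ^+ 2 <= e * n.+1%:R /\ 2 * h <= n.+1%:R.
  move=> e0; have u0 : 0 <= 2 * h ^+ 2 / e + 2 * h.
    by rewrite addr_ge0 ?mulr_ge0 ?invr_ge0 ?sqr_ge0// ltW.
  have [n Nb] : exists n : nat, 2 * h ^+ 2 / e + 2 * h < n.+1%:R.
    by exists (Num.truncn (2 * h ^+ 2 / e + 2 * h)); exact: truncnS_gt.
  have e1 : 0 <= 2 * h ^+ 2 / e by rewrite divr_ge0 ?mulr_ge0 ?sqr_ge0// ltW.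
  have e2 : 0 <= 2 * h by rewrite mulr_ge0.
  exists n; split; last by apply/ltW; apply: le_lt_trans Nb; rewrite lerDr.
  have -> : 2 * h ^+ 2 = e * (2 * h ^+ 2 / e) by field; rewrite gt_eqF.
  by rewrite ler_pM2l//; apply/ltW; apply: le_lt_trans Nb; rewrite lerDl.
apply/eqP; rewrite eq_le; apply/andP; split; apply/ler_addgt0Pr => e e0.
  have [n [n1 n2]] := nlarge _ e0; have /andP[_] := bnd n.
  have N0 : 0 < n.+1%:R :> R by rewrite ltr0n.
  move: (n.+1%:R : R) n1 n2 N0 => N n1 n2 N0.
  rewrite lee_fin => /le_trans; apply.
  have hN : h / N <= 1 / 2 by rewrite ler_pdivrMr//; lra.
  have y0 : 0 <= h / N by rewrite divr_ge0// ltW.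
  set y := h / N in hN y0 *.
  have hy : h = N * y by rewrite /y; field; rewrite gt_eqF.
  have ey : expR y * (1 - y) <= 1.
    rewrite -[leRHS](expRxMexpNx_1 y) ler_wpM2l ?expR_ge0//.
    by have := expR_ge1Dx (- y); lra.
  have {}ey : expR y - 1 <= y + 2 * y ^+ 2 by nra.
  apply: (le_trans (ler_wpM2l (ltW N0) ey)).
  rewrite hy mulrDr lerD2l; move: n1; rewrite hy => n1.
  by rewrite -(ler_pM2r N0); apply: le_trans n1; rewrite le_eqVlt; apply/orP; left; apply/eqP; ring.
have [n [n1 n2]] := nlarge _ e0; have /andP[+ _] := bnd n.
have N0 : 0 < n.+1%:R :> R by rewrite ltr0n.
  move: (n.+1%:R : R) n1 n2 N0 => N n1 n2 N0.
rewrite lee_fin -lerBlDr => /(le_trans _); apply.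
have y0 : 0 <= h / N by rewrite divr_ge0// ltW.
set y := h / N in y0 *.
have hy : h = N * y by rewrite /y; field; rewrite gt_eqF.
have ey : expR (- y) * (1 + y) <= 1.
  rewrite -[leRHS](expRxMexpNx_1 y) mulrC ler_wpM2r ?expR_ge0//.
  by have := expR_ge1Dx y; lra.
have {}ey : y - y ^+ 2 <= 1 - expR (- y) by have := expR_ge0 (- y); nra.
apply: le_trans (ler_wpM2l (ltW N0) ey).
rewrite hy mulrBr lerB//; move: n1; rewrite hy => n1.
have : N * (N * y ^+ 2) <= N * e.
  have -> : N * (N * y ^+ 2) = (N * y) ^+ 2 by ring.
  by have := sqr_ge0 (N * y); lra.
by rewrite ler_pM2l.
Qed.

End exponential.

(** * One more ring of a clock, given the past *)

Section clock_step.
Context d (Omega : measurableType d) (R : realType) (P : probability Omega R).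
Variables (I : choiceType) (X : I -> Omega -> R).
Hypothesis indX : mutually_independent P X.
Local Notation past S := (g_sigma_algebraType (cylinders X S)).
Variables (S : set I) (i : I).
Hypotheses (Si : ~ S i) (expX : exp1_distributed P (X i)).
Variables (A : set (past S)) (T : past S -> R).
Hypotheses (mA : measurable A) (mT : measurable_fun setT T).

Let mXi : measurable_fun setT (X i).
Proof. by have [+ _] := indX; exact. Qed.

Let mA' : measurable (A : set Omega).
Proof. exact: (past_measurable indX mA). Qed.

Let mT' : measurable_fun setT (T : Omega -> R).
Proof.
move=> _ B mB; apply: (past_measurable indX).
exact: (mT measurableT mB).
Qed.

Let G (J : set R) (h : R -> R) (y : past S * R) : \bar R :=
  (\1_A y.1 * (h (T y.1 + y.2) * \1_J (T y.1 + y.2)))%:E.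

Let mG (J : set R) (h : R -> R) : measurable J -> measurable_fun setT h -> measurable_fun setT (G J h).
Proof.
move=> mJ mh; apply/measurable_EFinP.
have mS : measurable_fun setT (fun y : past S * R => T y.1 + y.2).
  apply: measurable_funD; last exact: measurable_snd.
  exact: (measurableT_comp mT measurable_fst).
apply: measurable_funM.
  exact: (measurableT_comp (measurable_indic mA) measurable_fst).
apply: measurable_funM; first exact: (measurableT_comp mh).
exact: (measurableT_comp (measurable_indic mJ) mS).
Qed.

Let G0 (J : set R) (h : R -> R) : (forall x, 0 <= h x) -> forall y, (0 <= G J h y)%E.
Proof. by move=> h0 y; rewrite lee_fin !mulr_ge0. Qed.

(** Both indicators are put into the integrand [G], and the freezing principle is applied to the
    identity of [past S], so that [A] and [T] are frozen together. *)
Let shift (J : set R) (h : R -> R) : measurable J -> measurable_fun setT h -> (forall x, 0 <= h x) ->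
  (\int[P]_(w in A `&` [set w | J (T w + X i w)%R]) (h (T w + X i w)%R)%:E =
   \int[P]_(w in A) \int[P]_(w' in [set w' | J (T w + X i w')%R]) (h (T w + X i w')%R)%:E)%E.
Proof.
move=> mJ mh h0.
transitivity (\int[P]_w G J h (w, X i w))%E.
  rewrite integral_mkcond; apply: eq_integral => w _.
  rewrite /G /= patchE !indicE in_setI.
  have -> : (w \in [set w | J (T w + X i w)]) = (T w + X i w \in J).
    by apply/idP/idP => /set_mem h1; exact/mem_set.
  by case: (w \in A); case: (T w + X i w \in J); rewrite /= ?mul0r ?mul1r ?mulr0 ?mulr1.
have := @integral_past _ _ _ _ _ _ indX S i _ (past S) id (G J h) Si
  (@measurable_id _ (past S) setT) (mG mJ mh) (G0 _ h0).
move=> ->.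
rewrite [RHS]integral_mkcond; apply: eq_integral => w _.
rewrite patchE /G /= indicE; case: (w \in A); last first.
  by under eq_integral do rewrite mul0r; rewrite integral0.
rewrite [RHS]integral_mkcond; apply: eq_integral => w' _.
rewrite mul1r patchE indicE.
have -> : (w' \in [set w' | J (T w + X i w')]) = (T w + X i w' \in J).
  by apply/idP/idP => /set_mem h1; exact/mem_set.
by case: (T w + X i w' \in J); rewrite ?mulr1 ?mulr0.
Qed.

(** Since [T <= a], the interval from [a - T] to [b - T] lies in the positive half-line, where the
    weighted integral of the waiting time is the length [b - a], whatever [T] is. The factor
    [expR T] is carried along. *)
Lemma clock_step (a b : R) : a <= b -> (forall w, A w -> T w <= a) ->
  (\int[P]_(w in A `&` [set w | (a < T w + X i w <= b)%R]) (expR (T w + X i w)%R)%:E =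
   (b - a)%:E * \int[P]_(w in A) (expR (T w))%:E)%E.
Proof.
move=> ab Ta; have mJ : measurable (`]a, b]%classic : set R) by [].
have := shift mJ (@measurable_expR R) (@expR_ge0 R).
have -> : [set w | `]a, b]%classic (T w + X i w)] = [set w | a < T w + X i w <= b].
  by apply/seteqP; split => w; rewrite /= in_itv.
move=> ->; rewrite -ge0_integralZl_EFin ?subr_ge0//; last first.
  by apply/measurable_EFinP/measurableT_comp => //; exact: measurable_funTS.
apply: eq_integral => w; rewrite in_setE => Aw.
have -> : [set w' | `]a, b]%classic (T w + X i w')] = X i @^-1` `]a - T w, b - T w].
  by apply/seteqP; split => w'; rewrite /= !in_itv/= ltrBlDl lerBrDl.
have Tw := Ta w Aw.
under eq_integral do rewrite expRD EFinM.
rewrite ge0_integralZl_EFin ?expR_ge0//; first last.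
- by apply/measurable_EFinP/measurableT_comp => //; exact: measurable_funTS.
- by rewrite -[_ @^-1` _]setTI; exact: mXi.
rewrite (integral_exp_itv mXi expX) ?subr_ge0//; last by rewrite lerD2r.
rewrite -EFinM -EFinM; congr (_%:E); ring.
Qed.

(** The chance [expR (T - L)] of waiting beyond [L] absorbs the weight [expR T] accumulated by the
    previous rings. *)
Lemma clock_last (L : R) : (forall w, A w -> T w <= L) ->
  (P (A `&` [set w | (L < T w + X i w)%R]) =
   (expR (- L))%:E * \int[P]_(w in A) (expR (T w))%:E)%E.
Proof.
move=> TL; have mJ : measurable (`]L, +oo[%classic : set R) by [].
have := shift mJ (measurable_cst (1 : R)) (fun=> ler01).
have E : [set w | `]L, +oo[%classic (T w + X i w)] = [set w | L < T w + X i w].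
  by apply/seteqP; split => w; rewrite /= in_itv/= andbT.
rewrite E /= integral_cst ?mul1e; last first.
  apply: measurableI => //; rewrite -E.
  rewrite -[[set _ | _]]setTI; apply: (measurable_funD mT' mXi) => //.
move=> ->; rewrite -ge0_integralZl_EFin ?expR_ge0//; last first.
  by apply/measurable_EFinP/measurableT_comp => //; exact: measurable_funTS.
apply: eq_integral => w; rewrite in_setE => Aw.
have -> : [set w' | `]L, +oo[%classic (T w + X i w')] = X i @^-1` `]L - T w, +oo[.
  by apply/seteqP; split => w'; rewrite /= !in_itv/= !andbT ltrBlDl.
rewrite integral_cst ?mul1e/=; last by rewrite -[_ @^-1` _]setTI; exact: mXi.
rewrite (prob_exp_gt expX) ?subr_ge0 ?TL// -EFinM -expRD.
by congr (expR _)%:E; ring.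
Qed.

End clock_step.

(** * The probability of a pattern of rings *)

Section clock_patterns.
Context d (Omega : measurableType d) (R : realType) (P : probability Omega R).
Variables (V E : choiceType) (f0 : V -> Omega -> R) (tau : E -> nat -> Omega -> R).

Definition driving (i : V + (E * nat)) : Omega -> R :=
  match i with inl v => f0 v | inr ek => tau ek.1 ek.2 end.

Hypothesis ind : mutually_independent P driving.
Hypothesis exp_tau : forall e k, exp1_distributed P (tau e k).

(** All initial opinions belong to the past from the outset, so that an event about them can be
    intersected with clock events. *)
Definition used (W : set (E * nat)) : set (V + (E * nat)) :=
  [set i | match i with inl _ => True | inr ek => W ek end].

Local Notation past W := (g_sigma_algebraType (cylinders driving (used W))).

Variable dl : R.
Hypothesis dl0 : 0 < dl.

(** Time after [l] waiting times, so that ring number [n], counted from 0, occurs at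
    [elapsed e n.+1]. *)
Definition elapsed e l w : R := \sum_(k < l) tau e k w.

(** Open on the left and closed on the right, as are the quiet intervals in
    [edge_averaging_path]. *)
Definition in_slot k (t : R) : bool := k%:R * dl < t <= k.+1%:R * dl.

Definition clock_hits (A : set Omega) e (ks : seq nat) m : set Omega :=
  A `&` [set w | forall l, (l < m)%N -> in_slot (nth 0%N ks l) (elapsed e l.+1 w)].

(** The last clause places the next ring beyond the horizon, so that for increasing [ks] below [N]
    the list accounts for every ring up to time [N * dl]. *)
Definition clock_set e (ks : seq nat) N : set Omega :=
  [set w | (forall l, (l < size ks)%N -> in_slot (nth 0%N ks l) (elapsed e l.+1 w)) /\
     N%:R * dl < elapsed e (size ks).+1 w].

Lemma elapsedS e l w : elapsed e l.+1 w = elapsed e l w + tau e l w.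
Proof. by rewrite /elapsed big_ord_recr. Qed.

Lemma clock_hitsS A e ks m : clock_hits A e ks m.+1 =
  clock_hits A e ks m `&` [set w | (nth 0%N ks m)%:R * dl < elapsed e m w + tau e m w
                                    <= (nth 0%N ks m).+1%:R * dl].
Proof.
apply/seteqP; split => w.
  move=> [Aw h]; split; last by have := h m (ltnSn m); rewrite elapsedS.
  by split => // l lm; apply: h; exact: ltnW.
move=> [[Aw h] hm]; split => // l; rewrite ltnS leq_eqVlt => /predU1P[->|/h//].
by rewrite elapsedS.
Qed.

Lemma measurable_elapsed W e l : (forall k, (k < l)%N -> W (e, k)) ->
  measurable_fun setT (elapsed e l : past W -> R).
Proof.
move=> We; apply: measurable_sum => k.
by have /= := @measurable_past_X _ _ _ _ driving (used W) (inr (e, k : nat)); apply; exact: We.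
Qed.

Section one_edge.
Variables (W : set (E * nat)) (e : E) (A : set Omega).
Hypothesis W_fresh : forall k, ~ W (e, k).
Hypothesis mA : <<s cylinders driving (used W) >> A.

Definition used_upto l : set (E * nat) := W `|` [set ek | ek.1 = e /\ (ek.2 < l)%N].

Let upto l k : (k < l)%N -> used_upto l (e, k). Proof. by move=> kl; right. Qed.

Let mS l (J : set R) : measurable J ->
  <<s cylinders driving (used (used_upto l.+1)) >>
    [set w | J (elapsed e l w + tau e l w)].
Proof.
move=> mJ.
have h : measurable_fun setT (elapsed e l.+1 : past (used_upto l.+1) -> R).
  by apply: measurable_elapsed => k /upto.
have := h measurableT J mJ; rewrite setTI.
by rewrite (_ : elapsed e l.+1 @^-1` J = [set w | J (elapsed e l w + tau e l w)]) //;
  apply/seteqP; split => w; rewrite /= elapsedS.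
Qed.

Lemma clock_hits_past ks m :
  <<s cylinders driving (used (used_upto m)) >> (clock_hits A e ks m).
Proof.
elim: m => [|m IH].
  rewrite (_ : clock_hits _ _ _ _ = A).
    by apply: past_sub mA => -[//|ek] /= ?; left.
  by apply/seteqP; split => w; [case|].
rewrite clock_hitsS.
have mC := @measurableI _ (past (used_upto m.+1)).
apply: mC.
  apply: past_sub IH => -[//|ek] /= [?|[? lm]]; [by left|right; split => //].
  exact: ltnW.
have := @mS m `](nth 0%N ks m)%:R * dl, (nth 0%N ks m).+1%:R * dl] (measurable_itv _).
congr (<<s _ >> _); apply/seteqP; split => w; by rewrite /= in_itv.
Qed.

(** The slots increase strictly, so the previous ring is over before slot number [m] of the list
    opens; this is the hypothesis [T <= a] of [clock_step]. *)
Lemma clock_hits_le ks m w : sorted ltn ks -> (m < size ks)%N ->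
  clock_hits A e ks m w -> elapsed e m w <= (nth 0%N ks m)%:R * dl.
Proof.
move=> ks_s; case: m => [|m] mk [_ h].
  by rewrite /elapsed big_ord0 mulr_ge0// ltW.
have /andP[_] := h m (ltnSn m); move=> /le_trans; apply.
rewrite ler_wpM2r ?(ltW dl0)// ler_nat.
exact: (sorted_ltn_nth ltn_trans 0%N ks_s m m.+1 (ltnW mk) mk (ltnSn m)).
Qed.

(* Against the weight [expR (elapsed e m w)] a new ring has density 1, so that each slot contributes
   exactly its length. *)
Lemma integral_clock_hits ks m : sorted ltn ks -> (m <= size ks)%N ->
  (\int[P]_(w in clock_hits A e ks m) (expR (elapsed e m w))%:E = (dl ^+ m)%:E * P A)%E.
Proof.
move=> ks_s; elim: m => [|m IH] mk.
  rewrite (_ : clock_hits _ _ _ _ = A); last first.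
    by apply/seteqP; split => w; [case|].
  under eq_integral do rewrite /elapsed big_ord0 expR0.
  by rewrite integral_cst//; exact: (past_measurable ind mA).
rewrite clock_hitsS; under eq_integral do rewrite elapsedS.
have fresh : ~ used (used_upto m) (inr (e, m)).
  by move=> [/W_fresh//|[_]]; rewrite /= ltnn.
have := @clock_step _ _ _ P _ driving ind (used (used_upto m)) (inr (e, m)) fresh
  (exp_tau e m) (clock_hits A e ks m) (elapsed e m) (@clock_hits_past ks m)
  (measurable_elapsed (@upto m)) ((nth 0%N ks m)%:R * dl) ((nth 0%N ks m).+1%:R * dl).
move=> ->.
- rewrite IH ?(ltnW mk)// -mulrBl -natrB// subSnn mul1r exprS EFinM.
  by rewrite muleA.
- by rewrite ler_wpM2r ?(ltW dl0)// ler_nat.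
- by move=> w; exact: clock_hits_le.
Qed.

Lemma prob_clock_set ks N : sorted ltn ks -> all (fun k => (k < N)%N) ks ->
  (P (A `&` clock_set e ks N) = (expR (- (N%:R * dl)) * dl ^+ size ks)%:E * P A)%E.
Proof.
move=> ks_s ksN; set m := size ks.
have fresh : ~ used (used_upto m) (inr (e, m)).
  by move=> [/W_fresh//|[_]]; rewrite /= ltnn.
have := @clock_last _ _ _ P _ driving ind (used (used_upto m)) (inr (e, m)) fresh
  (exp_tau e m) (clock_hits A e ks m) (elapsed e m) (@clock_hits_past ks m)
  (measurable_elapsed (@upto m)) (N%:R * dl).
rewrite integral_clock_hits// muleA -EFinM => <-.
  congr (P _); apply/seteqP; split => w.
    by move=> [Aw [h1 h2]]; split; [split|rewrite /= -elapsedS].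
  by move=> [[Aw h1]]; rewrite /= -elapsedS => h2; split.
move=> w; case: (posnP m) => [->|m0] [_ h].
  by rewrite /elapsed big_ord0 mulr_ge0// ltW.
have := h m.-1; rewrite prednK// => /(_ (leqnn _)) /andP[_] /le_trans; apply.
rewrite ler_wpM2r ?(ltW dl0)// ler_nat.
by apply: (allP ksN); rewrite mem_nth// /m prednK.
Qed.

Lemma clock_set_past ks N :
  <<s cylinders driving (used (W `|` [set ek | ek.1 = e])) >> (A `&` clock_set e ks N).
Proof.
have mI := @measurableI _ (past (W `|` [set ek | ek.1 = e])).
have -> : A `&` clock_set e ks N = clock_hits A e ks (size ks) `&`
    [set w | `]N%:R * dl, +oo[%classic (elapsed e (size ks) w + tau e (size ks) w)].
  apply/seteqP; split => w; rewrite /= in_itv/= andbT.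
    by move=> [Aw [h1 h2]]; split; [split|rewrite /= -elapsedS].
  by move=> [[Aw h1]]; rewrite /= -elapsedS => h2; split.
apply: mI.
  by apply: past_sub (@clock_hits_past ks (size ks)) => -[//|ek] /= [?|[? _]]; [left|right].
have := @mS (size ks) `]N%:R * dl, +oo[ (measurable_itv _).
by apply: past_sub => -[//|ek] /= [?|[? _]]; [left|right].
Qed.

End one_edge.

Section pattern_event.
Variables (B : set Omega) (x : seq (option E)).
Hypothesis mB : <<s cylinders driving (used set0) >> B.

Definition slots e : seq nat := [seq k <- iota 0 (size x) | nth None x k == Some e].

(** The recursion adds one edge at a time: its clock is fresh with respect to the initial opinions
    and the clocks already treated. *)
Fixpoint pattern_event (F : seq E) : set Omega :=
  if F is e :: F' then pattern_event F' `&` clock_set e (slots e) (size x) else B.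

Lemma slots_sorted e : sorted ltn (slots e).
Proof. by apply: sorted_filter; [exact: ltn_trans|exact: iota_ltn_sorted]. Qed.

Lemma slots_lt e : all (fun k => (k < size x)%N) (slots e).
Proof. by apply/allP => k; rewrite mem_filter mem_iota => /andP[_]. Qed.

Lemma pattern_event_past F :
  <<s cylinders driving (used [set ek | ek.1 \in F]) >> (pattern_event F).
Proof.
elim: F => [|e F IH] /=.
  by apply: past_sub mB => -[//|ek].
have h := @clock_set_past [set ek | ek.1 \in F] e _ IH (slots e) (size x).
apply: past_sub h => -[//|ek] /=.
by rewrite inE => -[->|->]; rewrite ?eqxx ?orbT.
Qed.

Lemma prob_pattern_event F : uniq F -> P (pattern_event F) =
  ((\prod_(e <- F) (expR (- ((size x)%:R * dl)) * dl ^+ size (slots e)))%:E * P B)%E.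
Proof.
elim: F => [|e F IH] /=; first by rewrite big_nil mul1e.
move=> /andP[eF uF]; rewrite big_cons.
rewrite (prob_clock_set (W := [set ek | ek.1 \in F]))//.
- by rewrite IH// muleA EFinM.
- by move=> k /=; apply/negP.
- exact: pattern_event_past.
- exact: slots_sorted.
- exact: slots_lt.
Qed.

Lemma pattern_eventP F w : pattern_event F w <->
  B w /\ forall e, e \in F -> clock_set e (slots e) (size x) w.
Proof.
elim: F => [|e F IH] /=; first by split=> [?|[]].
split=> [[/IH[Bw h] ew]|[Bw h]].
  by split => // e'; rewrite inE => /predU1P[->|/h].
split; last by apply: h; exact: mem_head.
by apply/IH; split => // e' e'F; apply: h; rewrite inE e'F orbT.
Qed.

End pattern_event.

Lemma size_slots x e : size (slots x e) = count_mem (Some e) x.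
Proof.
rewrite /slots size_filter -[in RHS](mkseq_nth None x) /mkseq count_map.
by apply: eq_count => k /=.
Qed.

Lemma sum_slots (F : seq E) x : uniq F -> {subset x <= marks F} ->
  (\sum_(e <- F) size (slots x e) = count isSome x)%N.
Proof.
move=> uF xF; under eq_bigr do rewrite size_slots.
elim: x xF => [|a x IH] xF /=; first by rewrite big1.
rewrite big_split/= IH; last by move=> y yx; apply: xF; rewrite inE yx orbT.
congr (_ + _)%N; have := xF a (mem_head _ _).
case: a xF => [e _|_ _] /=; last by rewrite big1.
rewrite inE/= mem_map => [eF|? ? []//].
rewrite (bigD1_seq e)//= eqxx big1 ?addn0// => e' /negPf ee'.
by case: eqP => // -[] /eqP; rewrite eq_sym ee'.
Qed.

Lemma pattern_weightE (F : seq E) x :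
  pattern_weight F dl x = dl ^+ count isSome x / (1 + dl * (size F)%:R) ^+ size x.
Proof.
rewrite /pattern_weight; elim: x => [|a x IH]; first by rewrite big_nil !expr0 divr1.
by rewrite big_cons IH /mark_weight /= exprD exprS invfM; case: a => [?|] /=;
  rewrite ?expr1 ?expr0; ring.
Qed.

(* With [y = dl * size F], the factor [(1 + y) * expR (- y)] is the probability that a slot contains at
   most one ring of [F]. *)
Definition pattern_coverage (F : seq E) N : R :=
  ((1 + dl * (size F)%:R) * expR (- (dl * (size F)%:R))) ^+ N.

(** Each ring contributes [dl] and each slot [expR (- y)]; taking out the normalization [1 + y] per
    slot leaves [pattern_coverage], which is the same for all patterns of a given length. *)
Lemma prob_pattern_weight (F : seq E) B x :
  <<s cylinders driving (used set0) >> B -> uniq F -> {subset x <= marks F} ->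
  P (pattern_event B x F) =
  ((pattern_weight F dl x * pattern_coverage F (size x))%:E * P B)%E.
Proof.
move=> mB uF xF; rewrite prob_pattern_event//; congr (_%:E * _)%E.
rewrite big_split/= big_const_seq count_predT iter_mulr_1 prodrXr sum_slots//.
have -> : expR (- ((size x)%:R * dl)) ^+ size F = expR (- (dl * (size F)%:R)) ^+ size x.
  by rewrite -!expRM_natl; congr expR; ring.
have F0 : (1 + dl * (size F)%:R) ^+ size x != 0.
  by rewrite expf_neq0// gt_eqF// ltr_wpDr// mulr_ge0// ltW.
by rewrite pattern_weightE /pattern_coverage exprMn; field.
Qed.

Lemma pattern_coverage_le1 F N : pattern_coverage F N <= 1.
Proof.
apply: exprn_ile1; first by rewrite mulr_ge0 ?expR_ge0// addr_ge0// mulr_ge0// ltW.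
rewrite -[leRHS](expRxMexpNx_1 (dl * (size F)%:R)) ler_wpM2r ?expR_ge0//.
exact: expR_ge1Dx.
Qed.

(** From [expR (- y) >= 1 - y], each slot has coverage at least [1 - y ^ 2]. With a number of slots
    of order [1 / dl], the total defect is of order [dl]. *)
Lemma pattern_coverage_ge F N : dl * (size F)%:R <= 1 ->
  1 - N%:R * (dl * (size F)%:R) ^+ 2 <= pattern_coverage F N.
Proof.
set y := dl * _ => y1; have y0 : 0 <= y by rewrite mulr_ge0// ltW.
have h : 1 - y ^+ 2 <= (1 + y) * expR (- y).
  rewrite [leLHS](_ : _ = (1 + y) * (1 - y)); last by ring.
  by rewrite ler_wpM2l ?addr_ge0// expR_ge1Dx.
have y2 : 0 <= 1 - y ^+ 2 by rewrite subr_ge0 expr_le1.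
rewrite /pattern_coverage -/y; elim: N => [|N IH]; first by rewrite mul0r subr0 expr0.
have z0 : 0 <= (1 + y) * expR (- y) by exact: le_trans h.
rewrite [leRHS]exprSr; apply: le_trans (ler_wpM2l (exprn_ge0 N z0) h).
apply: le_trans (ler_wpM2r y2 IH); rewrite -addn1 natrD.
have : 0 <= N%:R * y ^+ 2 * y ^+ 2 by apply: mulr_ge0; [apply: mulr_ge0|]; rewrite ?sqr_ge0 ?ler0n.
by move: (N%:R : R) (y ^+ 2) => a b; lra.
Qed.

Lemma in_slot_inj k k' t : in_slot k t -> in_slot k' t -> k = k'.
Proof.
have lt_contra a b : (a < b)%N -> in_slot a t -> in_slot b t -> False.
  move=> ab /andP[_ h1] /andP[h2 _].
  move: (lt_le_trans h2 h1); rewrite ltr_pM2r// ltr_nat ltnS => h.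
  by move: ab; rewrite ltnNge h.
move=> h1 h2; case: (ltngtP k k') => // h.
- by case: (lt_contra _ _ h h1 h2).
- by case: (lt_contra _ _ h h2 h1).
Qed.

Lemma clock_set_inj e ks ks' N w :
  all (fun k => (k < N)%N) ks -> all (fun k => (k < N)%N) ks' ->
  clock_set e ks N w -> clock_set e ks' N w -> ks = ks'.
Proof.
have size_le ks1 ks2 : all (fun k => (k < N)%N) ks2 ->
    clock_set e ks1 N w -> clock_set e ks2 N w -> (size ks2 <= size ks1)%N.
  move=> ks2N [_ h1] [h2 _]; rewrite leqNgt; apply/negP => s12.
  have /andP[_] := h2 _ s12; apply/negP; rewrite -ltNge; apply: le_lt_trans h1.
  rewrite ler_wpM2r ?(ltW dl0)// ler_nat.
  by apply: (allP ks2N); exact: mem_nth.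
move=> kN kN' h h'; have ss : size ks = size ks'.
  by apply/eqP; rewrite eqn_leq (size_le _ _ _ h' h)// (size_le _ _ _ h h').
apply: (@eq_from_nth _ 0%N) => // l lk.
by apply: in_slot_inj (h.1 l lk) _; apply: h'.1; rewrite -ss.
Qed.

(** The clocks determine the slots of each edge, and those slots determine the pattern. *)
Lemma pattern_event_disjoint F x y B w : size x = size y ->
  {subset x <= marks F} -> {subset y <= marks F} ->
  pattern_event B x F w -> pattern_event B y F w -> x = y.
Proof.
move=> sxy xF yF /pattern_eventP[_ hx] /pattern_eventP[_ hy].
have slots_eq e : e \in F -> slots x e = slots y e.
  move=> eF; apply: (clock_set_inj _ _ (hx e eF)); last by rewrite sxy; exact: hy.
    exact: slots_lt.
  by rewrite sxy; exact: slots_lt.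
have mem_slot (z : seq (option E)) e k : (k < size z)%N ->
    (k \in slots z e) = (nth None z k == Some e).
  by move=> kz; rewrite mem_filter mem_iota leq0n add0n kz !andbT.
apply: (@eq_from_nth _ None) => // k kx.
have mF (z : seq (option E)) e : {subset z <= marks F} -> (k < size z)%N ->
    nth None z k = Some e -> e \in F.
  move=> zF kz ze; have := zF _ (mem_nth None kz).
  by rewrite ze mem_marks.
have ky : (k < size y)%N by rewrite -sxy.
case xk : (nth None x k) => [e|].
  have eF := mF _ _ xF kx xk; apply/esym/eqP.
  by rewrite -mem_slot// -slots_eq// mem_slot// xk.
case yk : (nth None y k) => [e|//].
have eF := mF _ _ yF ky yk.
by have := mem_slot x e k kx; rewrite slots_eq// mem_slot// yk xk eqxx.
Qed.

End clock_patterns.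

(** * A moment inequality *)

Section moment_inequality.
Variable R : realType.
Implicit Types p s a y h r x : R.

Lemma powR_sub2 p x : 2 < p -> 0 <= x -> x `^ (p - 2) * x ^+ 2 = x `^ p.
Proof.
move=> p2 x0; rewrite -powR_mulrn// -powRD; first by congr (_ `^ _); lra.
by apply/implyP => /eqP; lra.
Qed.

Lemma powR_le1D p r x : 0 <= r <= p -> 0 <= x -> x `^ r <= 1 + x `^ p.
Proof.
move=> /andP[r0 rp] x0; have [x1|x1] := leP x 1.
  rewrite (le_trans (_ : _ <= 1 `^ r))//; first by apply: ge0_ler_powR; rewrite ?nnegrE.
  by rewrite powR1 lerDl powR_ge0.
by rewrite (le_trans (ler_powR (ltW x1) rp))// lerDr.
Qed.

(** With [z = p * r] the power is at most [expR z], hence at most [1 / (1 - z)], and [|z| <= 1 / 2]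
    allows a quadratic bound. *)
Lemma powR_Dl1_le p r : 1 <= p -> `|r| <= 1 / (2 * p) ->
  (1 + r) `^ p <= 1 + p * r + 2 * p ^+ 2 * r ^+ 2.
Proof.
move=> p1; rewrite ler_norml ler_pdivlMr ?mulr_gt0//; last by lra.
move=> /andP[r1 r2].
have pr1 : -1 <= 2 * (p * r).
  move: r1; rewrite lerNl ler_pdivlMr ?mulr_gt0//; [lra|lra].
have r1' : -1 < r by nra.
have r0 : 0 < 1 + r by lra.
rewrite /powR gt_eqF//; apply: (@le_trans _ _ (expR (p * r))).
  by rewrite ler_expR ler_wpM2l ?le_ln1Dx//; lra.
have e1 : expR (p * r) * (1 - p * r) <= 1.
  rewrite -[leRHS](expRxMexpNx_1 (p * r)) ler_wpM2l ?expR_ge0//.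
  exact: expR_ge1Dx.
rewrite (_ : 2 * p ^+ 2 * r ^+ 2 = 2 * (p * r) ^+ 2); last by ring.
have z1 : 2 * (p * r) <= 1 by lra.
set z := p * r in pr1 e1 z1 *.
have e2 : 1 <= (1 + z + 2 * z ^+ 2) * (1 - z).
  rewrite (_ : _ * _ = 1 + z ^+ 2 * (1 - 2 * z)); last by ring.
  by rewrite lerDl mulr_ge0 ?sqr_ge0//; lra.
rewrite -(@ler_pM2r _ (1 - z)); first exact: le_trans e1 e2.
lra.
Qed.

(** One term for each case of the next proof: the first for an increment comparable to or larger
    than [s], the second from the quadratic expansion for a small one. *)
Definition moment_const p : R := (2 * p + 1) `^ p * (1 + p) + 2 * p ^+ 2.

Lemma moment_const_ge0 p : 0 <= p -> 0 <= moment_const p.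
Proof. by move=> p0; rewrite addr_ge0 ?mulr_ge0 ?powR_ge0 ?addr_ge0 ?sqr_ge0. Qed.

(* The term linear in [y] vanishes in expectation, so that adding an independent centred variable with
   coefficient [a] multiplies [E |s| ^ p + 1] by at most [1 + O(a ^ 2)]. *)
Lemma powR_norm_add_le p s a y : 2 < p -> `|a| <= 1 ->
  `|s + a * y| `^ p + 1 <=
  (`|s| `^ p + 1) * (1 + moment_const p * a ^+ 2 * (1 + 2 * `|y| `^ p)) +
  p * a * (s * `|s| `^ (p - 2)) * y.
Proof.
move=> p2 a1; have p0 : 0 <= p by lra.
have sp0 : 0 <= `|s| `^ p by exact: powR_ge0.
have yp0 : 0 <= `|y| `^ p by exact: powR_ge0.
have a20 : 0 <= a ^+ 2 by exact: sqr_ge0.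
have ap : `|a| `^ p <= a ^+ 2.
  rewrite -real_normK ?num_real// -powR_mulrn//.
  have := normr_ge0 a; rewrite le_eqVlt => /predU1P[<-|a0].
    by rewrite !powR0//; lra.
  by rewrite ger_powR ?a0// ltW.
set h := a * y; have hE : p * a * (s * `|s| `^ (p - 2)) * y = p * (s * `|s| `^ (p - 2) * h).
  by rewrite /h; ring.
rewrite hE; set K := 2 * p.
have K1 : 1 <= K by rewrite /K; lra.
(* Large increment: the new power and the linear term are each bounded by a multiple of [|h| ^ p],
   and [|h| ^ p <= a ^ 2 * |y| ^ p] because [|a| <= 1] and [p > 2]. *)
have [sK|Ks] := leP `|s| (K * `|h|).
  have hp : `|h| `^ p <= a ^+ 2 * `|y| `^ p.
    by rewrite /h normrM powRM// ler_wpM2r.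
  have Kh0 : 0 <= K * `|h| by rewrite mulr_ge0//; lra.
  have KK : (K * `|h|) `^ p <= (K + 1) `^ p * `|h| `^ p.
    rewrite -powRM//; last by lra.
    by apply: ge0_ler_powR; rewrite ?nnegrE ?mulr_ge0 ?ler_wpM2r//; lra.
  have b1 : `|s + h| `^ p <= (K + 1) `^ p * `|h| `^ p.
    rewrite -powRM//; last by lra.
    apply: ge0_ler_powR; rewrite ?nnegrE ?mulr_ge0//; try lra.
    by rewrite (le_trans (ler_normD _ _))// mulrDl mul1r lerD2r.
  have b2 : - (s * `|s| `^ (p - 2) * h) <= (K + 1) `^ p * `|h| `^ p.
    clearbody h; apply: le_trans KK; rewrite (le_trans (ler_norm _))// normrN !normrM.
    rewrite (ger0_norm (powR_ge0 _ _)) -(powR_sub2 p2 Kh0) mulrAC mulrC.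
    apply: ler_pM; rewrite ?powR_ge0 ?mulr_ge0//.
      by apply: ge0_ler_powR => //; rewrite ?nnegrE//; lra.
    rewrite expr2 ler_pM//; rewrite ler_peMl//.
  have C1 : (K + 1) `^ p * (1 + p) <= moment_const p.
    by rewrite /moment_const lerDl mulr_ge0 ?sqr_ge0.
  have b3 : `|s + h| `^ p <= moment_const p * (a ^+ 2 * `|y| `^ p) + p * (s * `|s| `^ (p - 2) * h).
    rewrite -lerBlDr; apply: (@le_trans _ _ ((K + 1) `^ p * (1 + p) * `|h| `^ p)).
      by have := ler_wpM2l p0 b2; lra.
    by apply: ler_pM => //; rewrite ?mulr_ge0 ?powR_ge0//; lra.
  have M0 := moment_const_ge0 p0.
  have t0 : 0 <= moment_const p * (a ^+ 2 * `|y| `^ p).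
    by apply: mulr_ge0 => //; exact: mulr_ge0.
  have t1 : 0 <= moment_const p * a ^+ 2 by exact: mulr_ge0.
  have t2 : 0 <= `|s| `^ p * (moment_const p * a ^+ 2 * (1 + 2 * `|y| `^ p)).
    by apply: mulr_ge0 => //; apply: mulr_ge0 => //; rewrite addr_ge0// mulr_ge0.
  move: b3 t0 t1 t2 sp0; move: (p * (_ * h)) (`|s + h| `^ p) => u1 u2.
  move: (moment_const p) (a ^+ 2) (`|y| `^ p) (`|s| `^ p) => u3 u4 u5 u6; lra.
(* Small increment: expansion around [s] in the ratio [h / s], which is at most [1 / (2 * p)] in
   absolute value. *)
have s0 : 0 < `|s| by rewrite (le_lt_trans _ Ks)// mulr_ge0//; lra.
have sN0 : s != 0 by rewrite -normr_gt0.
set r := h / s; have hr : h = s * r by rewrite /r; field.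
have r1 : `|r| <= 1 / (2 * p).
  rewrite /r normrM normfV ler_pdivrMr// mulrC mulrA ler_pdivlMr; last by lra.
  by rewrite mulr1 mulrC ltW.
have p1 : 1 <= p by lra.
have main := powR_Dl1_le p1 r1.
have s2 : `|s| `^ (p - 2) * s ^+ 2 = `|s| `^ p.
  by rewrite -(powR_sub2 p2 (normr_ge0 s)) real_normK ?num_real.
have psiE : s * `|s| `^ (p - 2) * h = `|s| `^ p * r.
  by rewrite hr -s2; ring.
have r0 : 0 <= 1 + r.
  have : - r <= 1 / (2 * p) by rewrite (le_trans _ r1)// -normrN ler_norm.
  have : 1 / (2 * p) <= 1 by rewrite ler_pdivrMr; lra.
  lra.
have b1 : `|s + h| `^ p <= `|s| `^ p + p * (s * `|s| `^ (p - 2) * h) + 2 * p ^+ 2 * (`|s| `^ (p - 2) * h ^+ 2).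
  have -> : s + h = s * (1 + r) by rewrite hr; ring.
  rewrite normrM powRM// (ger0_norm r0) psiE.
  have -> : `|s| `^ (p - 2) * h ^+ 2 = `|s| `^ p * r ^+ 2.
    by rewrite -s2 hr; ring.
  by have := ler_wpM2l sp0 main; lra.
have b2 : `|s| `^ (p - 2) * h ^+ 2 <= (1 + `|s| `^ p) * (a ^+ 2 * (1 + `|y| `^ p)).
  apply: ler_pM; rewrite ?powR_ge0 ?sqr_ge0//.
    by apply: powR_le1D => //; lra.
  rewrite /h exprMn ler_wpM2l// -real_normK ?num_real// -powR_mulrn//.
  by apply: powR_le1D => //; lra.
have C2 : 2 * p ^+ 2 <= moment_const p.
  by rewrite /moment_const lerDr mulr_ge0 ?powR_ge0//; lra.
have b3 : 2 * p ^+ 2 * (`|s| `^ (p - 2) * h ^+ 2) <=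
    moment_const p * ((1 + `|s| `^ p) * (a ^+ 2 * (1 + `|y| `^ p))).
  apply: ler_pM => //; first by apply: mulr_ge0 => //; exact: sqr_ge0.
  by apply: mulr_ge0; [exact: powR_ge0|exact: sqr_ge0].
have t1 : 0 <= moment_const p * ((1 + `|s| `^ p) * (a ^+ 2 * `|y| `^ p)).
  apply: mulr_ge0; first exact: moment_const_ge0.
  by apply: mulr_ge0; [exact: addr_ge0|exact: mulr_ge0].
move: b1 b3 t1; move: (p * (_ * h)) (2 * p ^+ 2 * _) (`|s + h| `^ p) => u1 u0 u2.
move: (moment_const p) (a ^+ 2) (`|y| `^ p) (`|s| `^ p) => u3 u4 u5 u6; lra.
Qed.

End moment_inequality.

Section moment_of_sums.
Context d (Omega : measurableType d) (R : realType) (P : probability Omega R).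
Variables (I : choiceType) (X : I -> Omega -> R).
Hypothesis indX : mutually_independent P X.
Variables (p c nu : R).
Hypothesis p2 : 2 < p.
Hypothesis nu0 : 0 <= nu.

Let mX i : measurable_fun setT (X i).
Proof. by have [+ _] := indX; exact. Qed.

Lemma measurable_powR_norm d' (T : measurableType d') (g : T -> R) :
  measurable_fun setT g -> measurable_fun setT (fun w => `|g w| `^ p).
Proof.
move=> mg; apply: (measurableT_comp (measurable_powR p)).
exact: measurableT_comp.
Qed.

Let K := moment_const p * (1 + 2 * nu).

Lemma moment_step (Z : Omega -> R) (s a : R) : measurable_fun setT Z ->
  P.-integrable setT (EFin \o Z) -> (\int[P]_w (Z w)%:E = c%:E)%E ->
  (\int[P]_w (`|Z w - c| `^ p)%:E <= nu%:E)%E -> `|a| <= 1 ->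
  (\int[P]_w (`|s + a * (Z w - c)| `^ p + 1)%:E <=
   ((`|s| `^ p + 1) * (1 + K * a ^+ 2))%:E)%E.
Proof.
move=> mZ iZ EZ nuZ a1.
have mY : measurable_fun setT (fun w => Z w - c) by exact: measurable_funB.
pose B := (`|s| `^ p + 1) * (moment_const p * a ^+ 2 * 2).
pose A := (`|s| `^ p + 1) * (1 + moment_const p * a ^+ 2).
pose D := p * a * (s * `|s| `^ (p - 2)).
have M0 : 0 <= moment_const p by apply: moment_const_ge0; move: p2; lra.
have s0 : 0 <= `|s| `^ p + 1 by rewrite addr_ge0 ?powR_ge0.
have B0 : 0 <= B by rewrite mulr_ge0// mulr_ge0// mulr_ge0// sqr_ge0.
have iY : P.-integrable setT (fun w => (`|Z w - c| `^ p)%:E).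
  apply/integrableP; split; first exact/measurable_EFinP/measurable_powR_norm.
  under eq_integral do rewrite gee0_abs ?lee_fin ?powR_ge0//.
  by rewrite (le_lt_trans nuZ)// ltry.
have icst k : P.-integrable setT (EFin \o cst k).
  exact: finite_measure_integrable_cst.
have iZc : P.-integrable setT (fun w => (Z w - c)%:E).
  exact: (integrableB measurableT iZ (icst c)).
have EZc : (\int[P]_w (Z w - c)%:E = 0)%E.
  under eq_integral do rewrite EFinB.
  rewrite integralB//; last exact: icst.
  by rewrite EZ integral_cst//= probability_setT mule1 subee.
have iB : P.-integrable setT (fun w => (B%:E * (`|Z w - c| `^ p)%:E)%E) by exact: integrableZl.
have iD : P.-integrable setT (fun w => (D%:E * (Z w - c)%:E)%E) by exact: integrableZl.
have iA : P.-integrable setT (fun w => A%:E) by exact: icst.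
have iAB : P.-integrable setT (fun w => (A%:E + B%:E * (`|Z w - c| `^ p)%:E)%E).
  exact: integrableD.
apply: (@le_trans _ _
    (\int[P]_w (A%:E + B%:E * (`|Z w - c| `^ p)%:E + D%:E * (Z w - c)%:E))%E).
  apply: ge0_le_integral => //.
  - apply/measurable_EFinP/measurable_funD => //; apply: measurable_powR_norm.
    by apply: measurable_funD => //; exact: measurable_funM.
  - exact: (measurable_int P (integrableD _ iAB iD)).
  move=> w _; rewrite -!EFinM -!EFinD lee_fin.
  apply: (le_trans (powR_norm_add_le _ _ p2 a1)).
  by rewrite le_eqVlt; apply/orP; left; apply/eqP; rewrite /A /B /D; ring.
rewrite integralD// integralD// integralZl// integralZl// EZc mule0 adde0.
rewrite integral_cst//= probability_setT mule1.
apply: (le_trans (leeD (lexx _) (lee_wpmul2l _ nuZ))); first by rewrite lee_fin.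
rewrite -EFinM -EFinD lee_fin le_eqVlt; apply/orP; left; apply/eqP.
by rewrite /A /B /K; ring.
Qed.

Variable a : I -> R.

(** The partial sum is frozen while one more variable is integrated, which costs a factor
    [1 + K * a j ^ 2 <= expR (K * a j ^ 2)]. The added 1 keeps this multiplicative and starts the
    induction at 1. *)
Lemma moment_sum (J : seq I) : uniq J ->
  (forall j, j \in J -> `|a j| <= 1) ->
  (forall j, j \in J -> [/\ P.-integrable setT (EFin \o X j),
    (\int[P]_w (X j w)%:E = c%:E)%E &
    (\int[P]_w (`|X j w - c| `^ p)%:E <= nu%:E)%E]) ->
  (\int[P]_w (`|\sum_(j <- J) a j * (X j w - c)| `^ p + 1)%:E <=
   (expR (K * \sum_(j <- J) a j ^+ 2))%:E)%E.
Proof.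
have K0 : 0 <= K.
  apply: mulr_ge0; first by apply: moment_const_ge0; move: p2; lra.
  by rewrite addr_ge0// mulr_ge0.
elim: J => [|j J IH].
  have p0 : p != 0 by rewrite gt_eqF// (lt_trans _ p2).
  move=> _ _ _; under eq_integral do rewrite big_nil normr0 powR0// add0r.
  by rewrite integral_cst//= probability_setT mule1 big_nil mulr0 expR0.
move=> /andP[jJ uJ] a1 mom.
have {}IH : (\int[P]_w (`|\sum_(j <- J) a j * (X j w - c)| `^ p + 1)%:E <=
   (expR (K * \sum_(j <- J) a j ^+ 2))%:E)%E.
  by apply: IH => // i iJ; [apply: a1|apply: mom]; rewrite inE iJ orbT.
pose S w := \sum_(j <- J) a j * (X j w - c).
have mS : measurable_fun setT (S : g_sigma_algebraType (cylinders X [set` J]) -> R).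
  rewrite (_ : S = fun w => \sum_(i <- J) (if i \in J then a i * (X i w - c) else 0)); last first.
    by apply/funext => w; rewrite /S big_seq big_mkcond.
  apply: measurable_sum => i; have [iJ|_] := boolP (i \in J); last exact: measurable_cst.
  apply: measurable_funM; first exact: measurable_cst.
  apply: measurable_funB; last exact: measurable_cst.
  exact: measurable_past_X.
have [iX EX nuX] := mom j (mem_head _ _).
have aj1 := a1 j (mem_head _ _).
pose G (y : R * R) := (`|y.1 + a j * (y.2 - c)| `^ p + 1)%:E.
have mG : measurable_fun setT G.
  apply/measurable_EFinP/measurable_funD => //; apply: measurable_powR_norm.
  apply: measurable_funD => //; apply: measurable_funM => //.
  exact: measurable_funB.
have G0 y : (0 <= G y)%E by rewrite lee_fin addr_ge0// powR_ge0.
have jN : ~ [set` J] j by exact/negP.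
have mS' : measurable_fun setT S.
  by move=> _ B mB; apply: (past_measurable indX); exact: (mS measurableT B mB).
have a2 : 0 <= 1 + K * a j ^+ 2 by rewrite addr_ge0// mulr_ge0// sqr_ge0.
rewrite (eq_integral (fun w => G (S w, X j w))); last first.
  by move=> w _; rewrite /G /S /= big_cons (addrC (a j * _)).
rewrite (integral_past indX jN mS mG G0).
apply: (@le_trans _ _ (\int[P]_w ((1 + K * a j ^+ 2)%:E * (`|S w| `^ p + 1)%:E))%E).
  have mF : measurable_fun setT (fun s => (\int[P]_w' G (s, X j w'))%E).
    pose Xj : {mfun Omega >-> R} := mfun_Sub (mem_set (mX j)).
    have := @measurable_fun_fubini_tonelli_F _ _ R R R (distribution P Xj) G mG G0.
    rewrite /fubini_F; congr measurable_fun; apply/funext => s.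
    by rewrite (ge0_integral_distribution Xj)//; exact: measurableT_comp.
  apply: ge0_le_integral => //.
  - by move=> w _; exact: integral_ge0.
  - exact: (measurableT_comp mF mS').
  - apply/measurable_EFinP/measurable_funM => //; apply: measurable_funD => //.
    exact: measurable_powR_norm.
  move=> w _; rewrite -EFinM [(1 + _) * _]mulrC; exact: (moment_step (S w) (mX j) iX EX nuX aj1).
rewrite ge0_integralZl_EFin//; last first.
  by apply/measurable_EFinP/measurable_funD => //; exact: measurable_powR_norm.
apply: (le_trans (lee_wpmul2l _ IH)); first by rewrite lee_fin.
rewrite -EFinM lee_fin big_cons mulrDr expRD ler_wpM2r ?expR_ge0//.
exact: expR_ge1Dx.
Qed.

End moment_of_sums.

Section tail.
Context d (Omega : measurableType d) (R : realType) (P : probability Omega R).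
Variables (I : choiceType) (X : I -> Omega -> R).
Hypothesis indX : mutually_independent P X.

(** Dividing the coefficients by the root of their sum of squares makes the exponential bound a
    constant; scaling back in Markov's inequality produces the power [p / 2] of that sum. *)
Lemma tail_of_weighted_sum (p c nu : R) (J : seq I) (m : I -> R) (eps : R) :
  2 < p -> 0 <= nu -> uniq J -> 0 < eps -> 0 < \sum_(j <- J) m j ^+ 2 ->
  (forall j, j \in J -> [/\ P.-integrable setT (EFin \o X j),
    (\int[P]_w (X j w)%:E = c%:E)%E &
    (\int[P]_w (`|X j w - c| `^ p)%:E <= nu%:E)%E]) ->
  (P [set w | (eps < `|\sum_(j <- J) m j * (X j w - c)|)%R] <=
   (expR (moment_const p * (1 + 2 * nu)) * eps `^ (- p) *
    (\sum_(j <- J) m j ^+ 2) `^ (p / 2))%:E)%E.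
Proof.
move=> p2 nu0 uJ e0 q0 mom; set q := \sum_(j <- J) _ in q0 *.
have p0 : 0 <= p by lra.
set r := Num.sqrt q; have r0 : 0 < r by rewrite sqrtr_gt0.
have rq : r ^+ 2 = q by rewrite sqr_sqrtr// ltW.
pose a j := m j / r.
have a2 : \sum_(j <- J) a j ^+ 2 = 1.
  under eq_bigr do rewrite exprMn exprVn.
  by rewrite -mulr_suml -/q rq divff// gt_eqF.
have a1 j : j \in J -> `|a j| <= 1.
  move=> jJ; rewrite -(@expr_le1 _ 2)// real_normK ?num_real// -a2 (bigD1_seq j)//= lerDl.
  by rewrite sumr_ge0// => i _; exact: sqr_ge0.
have := moment_sum indX p2 nu0 uJ a1 mom; rewrite a2 mulr1; set K := expR _ => mK.
set A := [set w | _]; pose S w := \sum_(j <- J) a j * (X j w - c).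
have mX j : measurable_fun setT (X j) by have [+ _] := indX; exact.
have mS : measurable_fun setT S.
  apply: measurable_sum => j; apply: measurable_funM; first exact: measurable_cst.
  by apply: measurable_funB.
have SE w : \sum_(j <- J) m j * (X j w - c) = r * S w.
  by rewrite /S mulr_sumr; apply: eq_bigr => j _; rewrite /a; field; rewrite gt_eqF.
have mA : measurable A.
  have -> : A = S @^-1` [set z | eps < `|r * z|].
    by apply/seteqP; rewrite /A; split => w; rewrite /= SE.
  rewrite -[_ @^-1` _]setTI; apply: mS => //.
  have mn : measurable_fun setT (fun z : R => `|r * z|).
    by apply: measurableT_comp => //; exact: measurable_funM.
  have := mn measurableT `]eps, +oo[%classic (measurable_itv _); rewrite setTI.
  by congr measurable; apply/seteqP; split => z; rewrite /= in_itv/= andbT.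
have low : (((eps / r)%R `^ p)%:E * P A <= K%:E)%E.
  rewrite -(integral_cst P mA); apply: le_trans mK.
  apply: (@le_trans _ _ (\int[P]_(w in A) (`|S w| `^ p + 1)%:E)%E).
    apply: ge0_le_integral => //.
    - by move=> w _; rewrite lee_fin powR_ge0.
    - apply/measurable_EFinP/measurable_funTS/measurable_funD => //.
      exact: measurable_powR_norm.
    - move=> w; rewrite /A /= SE normrM (gtr0_norm r0) -ltr_pdivrMl// mulrC => /ltW h.
      rewrite lee_fin -[leLHS]addr0 lerD//.
      by apply: ge0_ler_powR => //; rewrite ?nnegrE// divr_ge0 ?ltW.
  apply: ge0_subset_integral => //.
  - apply/measurable_EFinP/measurable_funD => //; exact: measurable_powR_norm.
have PA : P A \is a fin_num by rewrite fin_num_measure.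
rewrite -(fineK PA) in low *; move: low; rewrite -EFinM !lee_fin.
have er : (eps / r) `^ p = (eps `^ (- p) * q `^ (p / 2))^-1.
  have -> : q `^ (p / 2) = r `^ p.
    by rewrite -rq -powR_mulrn ?(ltW r0)// -powRrM; congr (_ `^ _); field.
  have rV : r^-1 `^ p = (r `^ p)^-1.
    by rewrite -(powR_inv1 (ltW r0)) -powRrM mulN1r powRN.
  by rewrite powRM ?invr_ge0 ?(ltW r0) ?(ltW e0)// rV powRN invfM invrK.
rewrite er -mulrA mulrC ler_pdivrMr// mulr_gt0// powR_gt0//.
Qed.

End tail.

(** * The dynamics along a pattern *)

Section deterministic.
Context d (Omega : measurableType d).
Variables (R : realType) (V E : choiceType) (ends : E -> V * V).
Variables (tau : E -> nat -> Omega -> R) (w : Omega).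
Variables (g0 : V -> R) (f : R -> V -> R).
Let tauw e k := tau e k w.
Hypothesis path_f : edge_averaging_path ends g0 tauw f.
Variables (dl : R) (F : seq E) (x : seq (option E)) (inner : V -> Prop).
Hypothesis dl0 : 0 < dl.
Hypothesis tau_gt0 : forall e k, e \in F -> 0 < tau e k w.
Hypothesis F_inner : forall u e, inner u -> incident ends e u -> e \in F.
Hypothesis clocks : forall e, e \in F -> clock_set tau dl e (slots x e) (size x) w.

Let T e n := ring_time tauw e n.

Let T_mono e m n : e \in F -> (m <= n)%N -> T e m <= T e n.
Proof.
move=> eF /subnK <-; elim: (n - m)%N => [|i IH]; first by rewrite add0n.
apply: (le_trans IH); rewrite addSn /T /ring_time [leRHS]big_ord_recr/= lerDl ltW//.
exact: tau_gt0.
Qed.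

(** Positive waiting times make rings increase, so every ring that is not listed in [slots x e]
    comes after the horizon. *)
Lemma ring_in_slot e n k : e \in F -> (k < size x)%N -> in_slot dl k (T e n) ->
  (n < size (slots x e))%N /\ nth 0%N (slots x e) n = k.
Proof.
move=> eF kx Tk; have [hits late] := clocks eF.
have nx : (n < size (slots x e))%N.
  rewrite ltnNge; apply/negP => le_n.
  have h1 : (size x)%:R * dl < T e n := lt_le_trans late (T_mono eF le_n).
  have /andP[_ h2] := Tk; have := lt_le_trans h1 h2.
  by rewrite ltr_pM2r// ltr_nat ltnS leqNgt kx.
split => //; exact: (in_slot_inj dl0 (hits n nx) Tk).
Qed.

Lemma ring_mark e n k : e \in F -> (k < size x)%N -> in_slot dl k (T e n) ->
  nth None x k = Some e.
Proof.
move=> eF kx Tk; have [nx nk] := ring_in_slot eF kx Tk.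
have := mem_nth 0%N nx; rewrite nk mem_filter => /andP[/eqP //].
Qed.

Lemma ring_unique e m n k : e \in F -> (k < size x)%N ->
  in_slot dl k (T e m) -> in_slot dl k (T e n) -> m = n.
Proof.
move=> eF kx /(ring_in_slot eF kx)[mx mk] /(ring_in_slot eF kx)[nx nk].
apply/eqP; rewrite -(nth_uniq 0%N mx nx) ?mk ?nk//.
by apply: filter_uniq; exact: iota_uniq.
Qed.

Lemma mark_ring e k : e \in F -> (k < size x)%N -> nth None x k = Some e ->
  exists n, in_slot dl k (T e n).
Proof.
move=> eF kx xk; have [hits _] := clocks eF.
have ks : k \in slots x e by rewrite mem_filter mem_iota xk eqxx leq0n add0n kx.
exists (index k (slots x e)); rewrite -[X in in_slot dl X](nth_index 0%N ks).
by apply: hits; rewrite index_mem.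
Qed.

Lemma no_ring_before u k e n s : inner u -> (k < size x)%N -> nth None x k = Some e ->
  in_slot dl k (T e n) -> k%:R * dl <= s -> s < T e n -> f s u = f (k%:R * dl) u.
Proof.
move=> iu kx xk Tk ks sT; have [_ [quiet _]] := path_f.
apply: quiet => //; first by rewrite mulr_ge0// ltW.
move=> e' n' e'u /andP[h1 h2]; have e'F := F_inner iu e'u.
have /andP[_ T2] := Tk.
have Tk' : in_slot dl k (T e' n').
  by rewrite /in_slot h1 (le_trans h2)// (le_trans (ltW sT)).
have := ring_mark e'F kx Tk'; rewrite xk => -[ee]; subst e'.
have nn := ring_unique e'F kx Tk Tk'; subst n'.
by move: (le_lt_trans h2 sT); rewrite ltxx.
Qed.

Lemma no_ring_after u k e n s : inner u -> (k < size x)%N -> nth None x k = Some e ->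
  in_slot dl k (T e n) -> T e n <= s -> s <= k.+1%:R * dl -> f s u = f (T e n) u.
Proof.
move=> iu kx xk Tk Ts sk; have [_ [quiet _]] := path_f.
have /andP[T1 T2] := Tk; have k0 : 0 <= k%:R * dl by rewrite mulr_ge0// ltW.
apply: quiet => //; first by rewrite (le_trans k0)// ltW.
move=> e' n' e'u /andP[h1 h2]; have e'F := F_inner iu e'u.
have Tk' : in_slot dl k (T e' n').
  by rewrite /in_slot (lt_trans T1 h1) (le_trans h2).
have := ring_mark e'F kx Tk'; rewrite xk => -[ee]; subst e'.
have nn := ring_unique e'F kx Tk Tk'; subst n'.
by move: h1; rewrite ltxx.
Qed.

(** The dynamics only provides some left limit at a ring. It is the value at the start of the slot
    because nothing else rings near an inner vertex within the slot. *)
Lemma left_limit u k e n L : inner u -> (k < size x)%N -> nth None x k = Some e ->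
  in_slot dl k (T e n) -> f^~ u @ (T e n)^'- --> L -> L = f (k%:R * dl) u.
Proof.
move=> iu kx xk Tk fL.
have : f^~ u @ (T e n)^'- --> f (k%:R * dl) u.
  apply: cvg_near_cst; have /andP[T1 _] := Tk.
  near=> s; apply: (no_ring_before iu kx xk Tk).
    by near: s; exact: nbhs_left_ge.
  by near: s; exact: nbhs_left_lt.
by move=> fL'; exact: (cvg_unique (@Rhausdorff R) fL fL').
Unshelve. all: by end_near. Qed.

Definition touches (e : E) (u : V) : bool := (u == (ends e).1) || (u == (ends e).2).

Lemma touchesP e u : reflect (incident ends e u) (touches e u).
Proof.
by apply: (iffP orP) => [[/eqP ->|/eqP ->]|[<-|<-]]; [left|right|left|right].
Qed.

Lemma no_ring_slot u k s : inner u -> (k < size x)%N ->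
  (forall e, nth None x k = Some e -> ~~ touches e u) ->
  k%:R * dl <= s -> s <= k.+1%:R * dl -> f s u = f (k%:R * dl) u.
Proof.
move=> iu kx xk ks sk; have [_ [quiet _]] := path_f.
apply: quiet => //; first by rewrite mulr_ge0// ltW.
move=> e' n' e'u /andP[h1 h2]; have e'F := F_inner iu e'u.
have Tk' : in_slot dl k (T e' n') by rewrite /in_slot h1 (le_trans h2).
by have /negP := xk _ (ring_mark e'F kx Tk'); apply; exact/touchesP.
Qed.

(** During a slot the opinion takes only its two boundary values, so continuous time reduces to slot
    boundaries. Both endpoints must be inner, as the left limits at both enter the average. *)
Lemma slot_update u k : inner u -> (k < size x)%N ->
  (forall e, nth None x k = Some e -> touches e u ->
     inner (ends e).1 /\ inner (ends e).2) ->
  f (k.+1%:R * dl) u = act ends (nth None x k) (f (k%:R * dl)) u /\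
  (forall s, k%:R * dl <= s -> s <= k.+1%:R * dl ->
     f s u = f (k%:R * dl) u \/ f s u = f (k.+1%:R * dl) u).
Proof.
move=> iu kx both; have kk : k%:R * dl <= k.+1%:R * dl by rewrite ler_wpM2r ?ler_nat ?(ltW dl0).
have idle : (forall e, nth None x k = Some e -> ~~ touches e u) ->
  f (k.+1%:R * dl) u = f (k%:R * dl) u /\
  (forall s, k%:R * dl <= s -> s <= k.+1%:R * dl ->
     f s u = f (k%:R * dl) u \/ f s u = f (k.+1%:R * dl) u).
  by move=> h; split=> [|s ks sk]; [exact: no_ring_slot|left; exact: no_ring_slot].
case xk : (nth None x k) => [e|] /=; last by apply: idle => e; rewrite xk.
have [eu|eu] := boolP (touches e u); last first.
  rewrite average_out; first by apply: idle => e'; rewrite xk => -[<-].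
  by move: eu; rewrite negb_or.
have [i1 i2] := both e xk eu.
have eF : e \in F by apply: F_inner iu _; exact/touchesP.
have [n Tk] := mark_ring eF kx xk.
have [_ [_ jump]] := path_f; have /= := jump e n; rewrite -/(T e n).
move=> [L1 [L2 [l1 [l2 [f1 f2]]]]].
have T2 : T e n <= k.+1%:R * dl by have /andP[] := Tk.
have fT : f (T e n) u = average ends e (f (k%:R * dl)) u.
  move: f1 f2; rewrite (left_limit i1 kx xk Tk l1) (left_limit i2 kx xk Tk l2).
  rewrite /average; move=> f1 f2; move: eu; rewrite /touches => eu; rewrite eu.
  by case/orP: eu => /eqP ->.
have fend := no_ring_after iu kx xk Tk T2 (lexx _).
split; first by rewrite fend fT.
move=> s ks sk; have [sT|Ts] := ltP s (T e n).
  by left; exact: (no_ring_before iu kx xk Tk).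
by right; rewrite fend; exact: (no_ring_after iu kx xk Tk).
Qed.

Variable v : V.
Hypothesis supp_inner : forall u, 0 < weights R ends v x u -> inner u.

(** Positivity of [m k u] marks the vertices whose opinion at the start of slot [k] influences the
    root at the end. These supports shrink as [k] grows, so all lie in the support of the whole
    pattern. *)
Let m k := weights R ends v (drop k x).

Let m_step k : (k < size x)%N -> m k = act ends (nth None x k) (m k.+1).
Proof. by move=> kx; rewrite /m (drop_nth None kx). Qed.

Let supp_step k u : (k < size x)%N -> 0 < m k.+1 u -> 0 < m k u.
Proof.
move=> kx mu; rewrite m_step//; case: (nth None x k) => //= e.
by apply: average_gt0 mu => z; exact: weights_ge0.
Qed.

Let supp_all k u : (k <= size x)%N -> 0 < m k u -> inner u.
Proof.
elim: k u => [|k IH] u kx mu; first by apply: supp_inner; rewrite /m drop0 in mu.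
by apply: (IH u (ltnW kx)); exact: supp_step.
Qed.

Let supp_root k : (k <= size x)%N -> 0 < m k v.
Proof.
move=> kx; have : (size x - k <= size x)%N by rewrite leq_subr.
rewrite -[in m k](subKn kx); elim: (size x - k)%N => [|i IH] ix.
  by rewrite subn0 /m drop_size /= eqxx ltr01.
have sx : (size x - i.+1 < size x)%N by rewrite ltn_subrL /= (leq_ltn_trans _ ix).
by apply: supp_step => //; rewrite -subSn// subSS; apply: IH; exact: ltnW.
Qed.

Let supp_edge k u e : (k < size x)%N -> 0 < m k.+1 u -> nth None x k = Some e ->
  touches e u -> 0 < m k (ends e).1 /\ 0 < m k (ends e).2.
Proof.
move=> kx mu xk eu; rewrite m_step// xk /=.
by split; apply: (average_incident_gt0 _ eu) => //; rewrite ?eqxx ?orbT// => z;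
  exact: weights_ge0.
Qed.

(** The identity is claimed on the backward support only: elsewhere, edges outside [F] may ring
    unnoticed. An averaging edge at a supported vertex has both ends in the previous support, which
    closes the induction. *)
Lemma path_evolve k u : (k <= size x)%N -> 0 < m k u ->
  f (k%:R * dl) u = evolve ends (take k x) g0 u.
Proof.
elim: k u => [|k IH] u kx mu.
  by rewrite mul0r take0 /=; have [+ _] := path_f; exact.
have mu' := supp_step kx mu; have iu := supp_all (ltnW kx) mu'.
have [|-> _] := slot_update iu kx.
  move=> e xk eu; have [m1 m2] := supp_edge kx mu xk eu.
  by split; [apply: supp_all m1|apply: supp_all m2]; exact: ltnW.
rewrite (take_nth None kx) -cats1 evolve_cat /=.
case xk : (nth None x k) => [e|] /=; last exact: IH (ltnW kx) mu'.
rewrite /average; case: ifP => eu; last exact: IH (ltnW kx) mu'.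
have [m1 m2] := supp_edge kx mu xk eu.
by rewrite !IH// ltnW.
Qed.

Lemma path_root n t : (n <= size x)%N -> n%:R * dl <= t <= (size x)%:R * dl ->
  exists k, [/\ (n <= k <= size x)%N & f t v = evolve ends (take k x) g0 v].
Proof.
move=> nx /andP[nt]; rewrite -[in X in t <= X](subnKC nx).
have : (n + (size x - n) <= size x)%N by rewrite subnKC.
elim: (size x - n)%N => [|i IH] ix ti.
  rewrite addn0 in ti ix; exists n; split; first by rewrite leqnn.
  by rewrite -path_evolve ?supp_root//; congr f; apply/le_anti/andP.
have [ti'|ti'] := leP t ((n + i)%:R * dl).
  by apply: IH ti'; rewrite (leq_trans _ ix)// addnS.
rewrite addnS in ix ti; have iv := supp_all ix (supp_root ix).
have [|_ /(_ t (ltW ti') ti)] := slot_update iv ix.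
  move=> e xk eu; have [m1 m2] := supp_edge ix (supp_root ix) xk eu.
  by split; [apply: supp_all m1|apply: supp_all m2]; exact: ltnW.
have ni : (n <= n + i)%N by rewrite leq_addr.
case=> ->; [exists (n + i)%N|exists (n + i).+1]; split.
- by rewrite ni ltnW.
- by rewrite path_evolve ?supp_root// ltnW.
- by rewrite ix (leq_trans ni).
- by rewrite path_evolve ?supp_root.
Qed.

End deterministic.

(** * Balls in the graph *)

Section balls.
Variables (V E : choiceType) (ends : E -> V * V).
Hypothesis simple : simple_graph ends.
Hypothesis conn : connected_graph ends.
Hypothesis inf : infinite_graph V.
Variables (D : nat) (inc : V -> seq E).
Hypothesis inc_size : forall u, (size (inc u) <= D)%N.
Hypothesis incP : forall e u, (e \in inc u) = touches ends e u.
Variable v : V.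

Fixpoint gball (r : nat) : seq V :=
  if r is r'.+1 then
    undup (gball r' ++ flatten [seq flatten [seq [:: (ends e).1; (ends e).2] | e <- inc u]
                              | u <- gball r'])
  else [:: v].

Lemma ballS r u : (u \in gball r.+1) =
  (u \in gball r) || [exists z : seq_sub (gball r), has (fun e => touches ends e u) (inc (val z))].
Proof.
rewrite /= mem_undup mem_cat; congr (_ || _); apply/idP/idP.
  move=> /flatten_mapP[z zr /flatten_mapP[e ez]]; rewrite !inE => eu.
  by apply/existsP; exists (SeqSub zr); apply/hasP; exists e.
move=> /existsP[[z zr] /hasP[e ez eu]]; apply/flatten_mapP; exists z => //.
by apply/flatten_mapP; exists e => //; rewrite !inE.
Qed.

Lemma gball_touch r u z e : z \in gball r -> touches ends e z -> touches ends e u ->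
  u \in gball r.+1.
Proof.
move=> zr ez eu; rewrite ballS; apply/orP; right; apply/existsP; exists (SeqSub zr).
by apply/hasP; exists e; rewrite ?incP.
Qed.

Lemma ballSP r u : u \in gball r.+1 ->
  u \in gball r \/ exists z e, [/\ z \in gball r, touches ends e z & touches ends e u].
Proof.
rewrite ballS => /orP[|/existsP[[z zr] /hasP[e ez eu]]]; first by left.
by right; exists z, e; split => //; rewrite -incP.
Qed.

Lemma gball_uniq r : uniq (gball r).
Proof. by case: r => [//|r]; exact: undup_uniq. Qed.

Lemma gball_mono r s : (r <= s)%N -> {subset gball r <= gball s}.
Proof.
move=> /subnK <- u ur; elim: (s - r)%N => // i IH.
by rewrite addSn ballS IH.
Qed.

Lemma gball_root r : v \in gball r.
Proof. by apply: (gball_mono (leq0n r)); exact: mem_head. Qed.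

Definition gball_edges r : seq E :=
  [seq e <- undup (flatten [seq inc u | u <- gball r])
     | ((ends e).1 \in gball r) && ((ends e).2 \in gball r)].

Lemma mem_ball_edges r e :
  (e \in gball_edges r) = ((ends e).1 \in gball r) && ((ends e).2 \in gball r).
Proof.
rewrite mem_filter mem_undup; apply: andb_idr => /andP[h _].
by apply/flatten_mapP; exists (ends e).1 => //; rewrite incP /touches eqxx.
Qed.

Lemma gball_edges_uniq r : uniq (gball_edges r).
Proof. by rewrite filter_uniq ?undup_uniq. Qed.

Lemma gball_edges_ends r e : e \in gball_edges r ->
  [/\ (ends e).1 \in gball r, (ends e).2 \in gball r & (ends e).1 != (ends e).2].
Proof.
rewrite mem_ball_edges => /andP[? ?]; split => //.
by apply/eqP; have [+ _] := simple; exact.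
Qed.

Lemma gball_edges_deg (R : realType) r u :
  \sum_(e <- gball_edges r) ((u == (ends e).1)%:R + (u == (ends e).2)%:R) <= D%:R :> R.
Proof.
have -> : \sum_(e <- gball_edges r) ((u == (ends e).1)%:R + (u == (ends e).2)%:R) =
    (size [seq e <- gball_edges r | touches ends e u])%:R :> R.
  rewrite size_filter -sum1_count natr_sum big_mkcond [RHS]big_mkcond/=.
  apply: eq_bigr => e _; have ne := simple.1 e.
  rewrite /touches; case: eqP => [->|_]; case: eqP => [h|_] //=; rewrite ?addr0 ?add0r//.
rewrite ler_nat (leq_trans _ (inc_size u))// uniq_leq_size ?filter_uniq ?undup_uniq//.
by move=> e; rewrite mem_filter incP => /andP[].
Qed.

Lemma adj_in_touches r z u e : z \in gball r -> u \in gball r -> z != u ->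
  touches ends e z -> touches ends e u -> adj_in ends (gball_edges r) z u.
Proof.
move=> zr ur zu ez eu; apply/hasP; exists e.
  rewrite mem_ball_edges; case/orP: ez zu zr => /eqP -> zu zr;
  case/orP: eu zu ur => /eqP -> zu ur; rewrite ?zr ?ur//; by rewrite eqxx in zu.
case/orP: ez zu zr => /eqP -> zu zr; case/orP: eu zu ur => /eqP -> zu ur;
  rewrite ?eqxx in zu *; rewrite //= -surjective_pairing eqxx ?orbT//.
Qed.

Lemma gball_path r u : u \in gball r ->
  exists2 p, path (adj_in ends (gball_edges r)) v p & last v p = u.
Proof.
elim: r u => [|r IH] u; first by rewrite inE => /eqP ->; exists [::].
have lift z : z \in gball r ->
    exists2 p, path (adj_in ends (gball_edges r.+1)) v p & last v p = z.
  move=> /IH[p pp pz]; exists p => //; apply: sub_path pp => a b /hasP[e er ab].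
  apply/hasP; exists e => //; move: er; rewrite !mem_ball_edges => /andP[h1 h2].
  by rewrite !(gball_mono (leqnSn r)).
move=> ur; have [/lift//|[z [e [zr ez eu]]]] := ballSP ur.
have [->|zu] := eqVneq u z; first exact: lift.
have [p pp pz] := lift z zr; exists (rcons p u); last by rewrite last_rcons.
rewrite rcons_path pp pz (adj_in_touches _ ur _ ez eu)//; last by rewrite eq_sym.
exact: (gball_mono (leqnSn r)).
Qed.

(** A ball equal to the next one is closed under adjacency, hence by connectivity is the whole
    infinite vertex set. *)
Lemma gball_grows r : exists2 u, u \in gball r.+1 & u \notin gball r.
Proof.
apply: contrapT => /forall2NP H.
have closed u : u \in gball r.+1 -> u \in gball r.
  by move=> ur; have [//|/negP] := H u; rewrite negbK.
apply: inf; apply: (@sub_finite_set _ _ [set` gball r]); last exact: finite_seq.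
have step a b : Defs.adjacent ends a b -> a \in gball r -> b \in gball r.
  by move=> [e ab] ar; apply: closed; apply: (gball_touch (e := e) ar);
    case: ab => ab; rewrite /touches ab /= eqxx ?orbT.
have reach a b : Relation_Operators.clos_refl_trans V (Defs.adjacent ends) a b ->
    a \in gball r -> b \in gball r.
  by elim=> {a b} [a b /step//|//|a b c _ h1 _ h2 /h1].
by move=> u _; exact: reach (conn v u) (gball_root r).
Qed.

Lemma gball_size r : (r < size (gball r))%N.
Proof.
elim: r => [//|r IH]; have [u uS ur] := gball_grows r.
apply: (leq_ltn_trans IH); rewrite -[(size (gball r)).+1]/(size (u :: gball r)).
apply: uniq_leq_size; first by rewrite /= ur gball_uniq.
by move=> z; rewrite inE => /predU1P[->//|]; exact: (gball_mono (leqnSn r)).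
Qed.

(* [minn r (d(v, u))] for the graph distance [d]. *)
Definition dist_upto r u : nat := count (fun i => u \notin gball i) (iota 0 r).

Lemma dist_root r : dist_upto r v = 0%N.
Proof. by apply/eqP; rewrite -leqn0 leqNgt -has_count; apply/hasPn => i _; rewrite negbK gball_root. Qed.

(** If [z] is in a ball, [u] is in the next one: the two counts compare after a shift of the radius
    by one, which costs at most the term of radius 0. *)
Lemma dist_touch r e u z : touches ends e u -> touches ends e z ->
  (dist_upto r u <= (dist_upto r z).+1)%N.
Proof.
move=> eu ez; case: r => [//|r]; rewrite /dist_upto.
apply: (@leq_trans (count (fun i => z \notin gball i) (iota 0 r)).+1).
  have -> : count (fun i => u \notin gball i) (iota 0 r.+1) =
      ((u \notin gball 0) + count (fun i => u \notin gball i.+1) (iota 0 r))%N.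
    by rewrite -[r.+1]add1n iotaD count_cat [in LHS]/= addn0 (iotaDl 1 0) count_map.
  rewrite -add1n leq_add ?leq_b1//; apply: sub_count => i; apply: contra => zi.
  exact: (gball_touch zi ez eu).
by rewrite ltnS -addn1 iotaD count_cat leq_addr.
Qed.

Lemma dist_lt r u : (dist_upto r u < r)%N -> exists2 i, (i < r)%N & u \in gball i.
Proof.
rewrite -[X in (_ < X)%N](size_iota 0 r) -(count_predC (fun i => u \notin gball i)).
rewrite -[X in (X < _)%N]addn0 ltn_add2l -has_count => /hasP[i].
by rewrite mem_iota /= negbK => ir ui; exists i.
Qed.

End balls.

(** * The exceptional event *)

Section measurability.
Context d (T : measurableType d) (R : realType) (V E : choiceType) (ends : E -> V * V).

Lemma measurable_act a (g : T -> V -> R) : (forall u, measurable_fun setT (g^~ u)) ->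
  forall u, measurable_fun setT (fun w => act ends a (g w) u).
Proof.
move=> mg u; case: a => [e|] //=; rewrite /average.
case: ((u == (ends e).1) || (u == (ends e).2)) => //.
by apply: measurable_funM => //; exact: measurable_funD.
Qed.

Lemma measurable_evolve y (g : T -> V -> R) : (forall u, measurable_fun setT (g^~ u)) ->
  forall u, measurable_fun setT (fun w => evolve ends y (g w) u).
Proof.
elim: y g => [//|a y IH] g mg u /=.
by apply: (IH (fun w => act ends a (g w))); exact: measurable_act.
Qed.

Lemma measurable_ever (v : V) (b : R -> bool) y (g : T -> V -> R) :
  measurable [set z | b z] -> (forall u, measurable_fun setT (g^~ u)) ->
  measurable [set w | ever ends v b y (g w)].
Proof.
move=> mb; elim: y g => [|a y IH] g mg /=.
  rewrite (_ : [set _ | _] = g^~ v @^-1` [set z | b z]).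
    by rewrite -[_ @^-1` _]setTI; exact: mg.
  by apply/seteqP; split => w /=; rewrite orbF.
rewrite (_ : [set _ | _] = (g^~ v @^-1` [set z | b z]) `|`
    [set w | ever ends v b y (act ends a (g w))]); last first.
  by apply/seteqP; split => w /= => [/orP[]|[]-> ]; [left|right| |rewrite orbT].
apply: measurableU; first by rewrite -[_ @^-1` _]setTI; exact: mg.
by apply: (IH (fun w => act ends a (g w))); exact: measurable_act.
Qed.

End measurability.

Lemma indic_bool (T : Type) (R : realType) (b : T -> bool) w :
  \1_[set w | b w] w = (b w)%:R :> R.
Proof.
rewrite indicE; congr (_%:R); congr nat_of_bool.
by apply/idP/idP => [/set_mem//|h]; exact/mem_set.
Qed.

Section finite_unions.
Context d (T : measurableType d) (R : realType) (P : probability T R).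

Lemma bigsetUP (I : eqType) (s : seq I) (A : I -> set T) w :
  (\big[setU/set0]_(i <- s) A i) w <-> exists2 i, i \in s & A i w.
Proof.
elim: s => [|i s IH]; first by rewrite big_nil; split => // -[].
rewrite big_cons; split=> [[Aw|/IH[j js Aj]]|[j]].
- by exists i; rewrite ?mem_head.
- by exists j => //; rewrite inE js orbT.
- by rewrite inE => /predU1P[->|js] Aj; [left|right; apply/IH; exists j].
Qed.

Lemma bigsetU_meas (I : Type) (s : seq I) (A : I -> set T) :
  (forall i, measurable (A i)) -> measurable (\big[setU/set0]_(i <- s) A i).
Proof.
move=> mA; elim: s => [|i s IH]; first by rewrite big_nil.
by rewrite big_cons; exact: measurableU.
Qed.

Lemma prob_setU_le (A B : set T) : measurable A -> measurable B ->
  (P (A `|` B) <= P A + P B)%E.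
Proof. exact: measureU2. Qed.

Lemma prob_bigsetU_le (I : Type) (s : seq I) (A : I -> set T) :
  (forall i, measurable (A i)) ->
  (P (\big[setU/set0]_(i <- s) A i) <= \sum_(i <- s) P (A i))%E.
Proof.
move=> mA; elim: s => [|i s IH]; first by rewrite !big_nil measure0.
rewrite !big_cons; apply: le_trans (leeD (lexx _) IH).
by apply: measureU2 => //; exact: bigsetU_meas.
Qed.

Lemma prob_bigsetU_disjoint (I : eqType) (s : seq I) (A : I -> set T) : uniq s ->
  (forall i, measurable (A i)) ->
  (forall i j w, i \in s -> j \in s -> A i w -> A j w -> i = j) ->
  P (\big[setU/set0]_(i <- s) A i) = (\sum_(i <- s) P (A i))%E.
Proof.
move=> us mA; elim: s us => [|i s IH] /=; first by rewrite !big_nil measure0.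
move=> /andP[is_ us] disj; rewrite !big_cons.
rewrite -IH//; last by move=> j k w js ks; apply: disj; rewrite inE ?js ?ks orbT.
apply: measureU => //; first exact: bigsetU_meas.
- apply/seteqP; split => // w [Aw /bigsetUP[j js Aj]].
  have ij : i = j by apply: disj Aw Aj; rewrite ?mem_head// inE js orbT.
  by rewrite ij js in is_.
Qed.

End finite_unions.

Lemma patterns_uniq (E : choiceType) (F : seq E) n : uniq F -> uniq (patterns F n).
Proof.
move=> uF; elim: n => [//|n IH]; rewrite patternsS.
apply: allpairs_uniq => //.
  rewrite /marks /= map_inj_uniq => [|? ? []//]; rewrite uF andbT.
  by apply/mapP => -[? _].
by move=> [a x] [b y] _ _ /= [-> ->].
Qed.

Lemma weights_support (R : realType) (V E : choiceType) (ends : E -> V * V)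
    (U : seq V) (F : seq E) (v : V) x u :
  (forall e, e \in F -> (ends e).1 \in U /\ (ends e).2 \in U) -> v \in U ->
  {subset x <= marks F} -> 0 < weights R ends v x u -> u \in U.
Proof.
move=> FU vU; elim: x u => [|a x IH] u xF /=.
  by case: eqP => [-> //|_]; rewrite ltxx.
have {}IH := IH ^~ (fun y yx => xF y (mem_behead (s := a :: x) yx)).
have := xF a (mem_head _ _); case: a {xF} => [e|_] /=; last exact: IH.
rewrite mem_marks => /FU[e1 e2]; rewrite /average.
by case: ifP => [/orP[]/eqP ->|_ /IH].
Qed.

Section cover.
Context d (Omega : measurableType d) (R : realType) (P : probability Omega R).
Variables (V E : choiceType) (ends : E -> V * V).
Variables (f0 : V -> Omega -> R) (tau : E -> nat -> Omega -> R).
Hypothesis ind : mutually_independent P (driving f0 tau).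
Hypothesis exp_tau : forall e k, exp1_distributed P (tau e k).
Variables (U : seq V) (F : seq E) (D : nat) (v : V).
Hypothesis U_uniq : uniq U.
Hypothesis F_uniq : uniq F.
Hypothesis F_ends : forall e, e \in F ->
  [/\ (ends e).1 \in U, (ends e).2 \in U & (ends e).1 != (ends e).2].
Hypothesis F_deg : forall u,
  \sum_(e <- F) ((u == (ends e).1)%:R + (u == (ends e).2)%:R) <= D%:R :> R.
Hypothesis D_gt0 : (0 < D)%N.
Hypothesis vU : v \in U.
Hypothesis U_conn : forall u, u \in U ->
  exists2 p, path (adj_in ends F) v p & last v p = u.
Variables (dist : V -> nat) (r : nat).
Hypothesis dist_v : dist v = 0%N.
Hypothesis dist_lip : forall e, e \in F ->
  (dist (ends e).1 <= (dist (ends e).2).+1)%N /\ (dist (ends e).2 <= (dist (ends e).1).+1)%N.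
Variables (p mu nu eps dl : R).
Hypothesis p2 : 2 < p.
Hypothesis nu0 : 0 <= nu.
Hypothesis eps0 : 0 < eps.
Hypothesis dl0 : 0 < dl.
Hypothesis dl1 : dl <= 1.
Hypothesis moments : forall u, [/\ P.-integrable setT (EFin \o f0 u),
    (\int[P]_w (f0 u w)%:E = mu%:E)%E &
    (\int[P]_w (`|f0 u w - mu| `^ p)%:E <= nu%:E)%E].
Let q := ring_prob F dl.
Hypothesis qD : D%:R * q <= 1 / 2.

Definition off (z : R) : bool := eps < `|z - mu|.

Let g0 w u := f0 u w.

Lemma measurable_off : measurable [set z | off z].
Proof.
have mn : measurable_fun setT (fun z : R => `|z - mu|).
  by apply: measurableT_comp => //; exact: measurable_funB.
have := mn measurableT `]eps, +oo[%classic (measurable_itv _); rewrite setTI.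
by congr measurable; apply/seteqP; split => z; rewrite /= in_itv/= andbT.
Qed.

Local Notation past0 := (g_sigma_algebraType (cylinders (driving f0 tau) (used set0))).

Let mg0 u : measurable_fun setT ((g0 : past0 -> V -> R)^~ u).
Proof. by apply: (@measurable_past_X _ _ _ _ (driving f0 tau) (used set0) (inl u)). Qed.

(** The pattern being fixed, this is an event about the initial opinions alone, hence independent of
    the clocks. *)
Definition off_set n1 x : set Omega :=
  [set w | ever ends v off (drop n1 x) (evolve ends (take n1 x) (g0 w))].

Definition off_end x : set Omega := [set w | off (evolve ends x (g0 w) v)].

Lemma off_set_past n1 x :
  <<s cylinders (driving f0 tau) (used set0) >> (off_set n1 x).
Proof.
apply: (@measurable_ever _ past0 _ _ _ ends v off (drop n1 x)
   (fun w => evolve ends (take n1 x) (g0 w)) measurable_off).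
by move=> u; apply: (@measurable_evolve _ past0 _ _ _ ends (take n1 x) g0 mg0).
Qed.

Lemma off_end_past x :
  <<s cylinders (driving f0 tau) (used set0) >> (off_end x).
Proof.
have := @measurable_evolve _ past0 _ _ _ ends x g0 mg0 v measurableT _ measurable_off.
by rewrite setTI.
Qed.

Let mE S : <<s cylinders (driving f0 tau) (used set0) >> S -> measurable S.
Proof. exact: (past_measurable ind). Qed.

Lemma prob_off_end x : {subset x <= marks F} ->
  (P (off_end x) <= (expR (moment_const p * (1 + 2 * nu)) * eps `^ (- p) *
     energy U (weights R ends v x) `^ (p / 2))%:E)%E.
Proof.
move=> xF; set m := weights R ends v x.
(* The tail bound concerns the whole driving family, so the weights are extended by 0 to the
   clocks. *)
pose m' (i : V + (E * nat)) : R := if i is inl u then m u else 0.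
have eE : \sum_(j <- map inl U) m' j ^+ 2 = energy U m by rewrite big_map.
have e0 : 0 < energy U m by apply: energy_gt0 xF.
have := @tail_of_weighted_sum _ _ _ P _ _ ind p mu nu (map inl U) m' eps p2 nu0.
rewrite map_inj_uniq => [/(_ U_uniq eps0)|? ? []//]; rewrite eE => /(_ e0).
move=> H; apply: le_trans (H _); last by move=> _ /mapP[u _ ->]; exact: moments.
rewrite le_eqVlt; apply/orP; left; apply/eqP; congr (P _).
have key w : evolve ends x (g0 w) v - mu =
    \sum_(j <- map inl U) m' j * (driving f0 tau j w - mu).
  rewrite (evolve_weights U_uniq F_ends _ vU xF) big_map /=.
  under [RHS]eq_bigr do rewrite mulrBr.
  by rewrite sumrB -mulr_suml (sum_weights R U_uniq F_ends vU xF) mul1r.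
by apply/seteqP; split => w; rewrite /off_end /off /= key.
Qed.

Lemma integral_pmean N (A : seq (option E) -> set Omega) : (forall x, measurable (A x)) ->
  (\int[P]_w (pmean F dl N (fun x => \1_(A x) w))%:E =
   \sum_(x <- patterns F N) (pattern_weight F dl x)%:E * P (A x))%E.
Proof.
move=> mA; have W0 x := pattern_weight_ge0 F dl0 x.
transitivity (\int[P]_w \sum_(x <- patterns F N) (pattern_weight F dl x * \1_(A x) w)%:E)%E.
  by apply: eq_integral => w _; rewrite /pmean -sumEFin.
rewrite ge0_integral_sum//.
- apply: eq_bigr => x _; under eq_integral do rewrite EFinM.
  rewrite ge0_integralZl_EFin//; last exact/measurable_EFinP/measurable_indic.
  by rewrite integral_indic// setIT.
- by move=> x; apply/measurable_EFinP/measurable_funM => //; exact: measurable_indic.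
- by move=> x w _; rewrite lee_fin mulr_ge0.
Qed.

Let c := 1 - D%:R * q.

Let c0 : 0 < c. Proof. by rewrite /c; move: qD; lra. Qed.

Lemma pmean_off n1 n w :
  c ^+ n * pmean F dl (n1 + n) (fun x => \1_(off_set n1 x) w) <=
  pmean F dl (n1 + n) (fun x => \1_(off_end x) w).
Proof.
have qD1 : D%:R * q <= 1 by apply: le_trans qD _; lra.
rewrite !pmean_cat// -pmeanZ; apply: pmean_le => // x1 s1 _.
have h := pmean_maximal v F_deg dl0 qD1 off n (evolve ends x1 (g0 w)).
apply: le_trans (le_trans h _).
  rewrite ler_wpM2l ?exprn_ge0 ?(ltW c0)//; apply: pmean_le => // x2 _ _.
  by rewrite /off_set indic_bool take_size_cat// drop_size_cat.
apply: pmean_le => // x2 _ _.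
by rewrite /off_end indic_bool evolve_cat.
Qed.

(** The maximal inequality is applied for frozen opinions, where only the pattern is averaged, and
    then integrated over the opinions. *)
Lemma sum_prob_off n1 n :
  ((c ^+ n)%:E * \sum_(x <- patterns F (n1 + n)) (pattern_weight F dl x)%:E * P (off_set n1 x) <=
   \sum_(x <- patterns F (n1 + n)) (pattern_weight F dl x)%:E * P (off_end x))%E.
Proof.
have m1 x : measurable (off_set n1 x) by apply: mE; exact: off_set_past.
have m2 x : measurable (off_end x) by apply: mE; exact: off_end_past.
have mp (A : seq (option E) -> set Omega) : (forall x, measurable (A x)) ->
    measurable_fun setT (fun w => (pmean F dl (n1 + n) (fun x => \1_(A x) w))%:E).
  move=> mA; apply/measurable_EFinP; apply: measurable_sum => x.
  by apply: measurable_funM => //; exact: measurable_indic.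
have p0 (A : seq (option E) -> set Omega) w :
    0 <= pmean F dl (n1 + n) (fun x => \1_(A x) w).
  by apply: sumr_ge0 => x _; rewrite mulr_ge0// pattern_weight_ge0.
rewrite -!integral_pmean// -ge0_integralZl_EFin ?exprn_ge0 ?(ltW c0)//; last first.
- exact: mp.
- by move=> w _; rewrite lee_fin.
apply: ge0_le_integral => //.
- by move=> w _; rewrite -EFinM lee_fin mulr_ge0// exprn_ge0// ltW.
- by apply: measurable_funeM; exact: mp.
- exact: mp.
- by move=> w _; rewrite -EFinM lee_fin; exact: pmean_off.
Qed.

Definition exits x : bool :=
  has (fun u => (r <= dist u)%N && (0 < weights R ends v x u)%R) U.

Let K1 := expR (moment_const p * (1 + 2 * nu)) * eps `^ (- p).

(** Three failures: no pattern fits the clocks, the fitting pattern carries weight to distance [r],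
    or along it the root is off at some slot boundary from [n1] on. *)
Definition uncovered n1 N : set Omega :=
  ~` (\big[setU/set0]_(x <- patterns F N) pattern_event tau dl setT x F) `|`
  ((\big[setU/set0]_(x <- [seq x <- patterns F N | exits x]) pattern_event tau dl setT x F) `|`
   (\big[setU/set0]_(x <- patterns F N) pattern_event tau dl (off_set n1 x) x F)).

Let mPE S x : <<s cylinders (driving f0 tau) (used set0) >> S ->
  measurable (pattern_event tau dl S x F).
Proof.
move=> mS; have h := @pattern_event_past _ _ _ _ _ f0 tau dl S x mS F.
exact: (past_measurable ind h).
Qed.

Let past_setT : <<s cylinders (driving f0 tau) (used set0) >> setT.
Proof. exact: (@measurableT _ past0). Qed.

Lemma uncovered_measurable n1 N : measurable (uncovered n1 N).
Proof.
apply: measurableU; first by apply/measurableC/bigsetU_meas => x; exact: mPE.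
apply: measurableU; apply: bigsetU_meas => x; apply: mPE => //.
exact: off_set_past.
Qed.

Lemma prob_uncovered n1 n :
  4 * (1 + decay_rate D (p / 2) * q * (n1 + n)%:R : R) < (size U)%:R ^+ 2 ->
  (P (uncovered n1 (n1 + n)) <=
   ((1 - pattern_coverage dl F (n1 + n)) + (1 + 2 * D%:R * q) ^+ (n1 + n) / 2 ^+ r +
    (c ^+ n)^-1 * (K1 * (2 * (1 + decay_rate D (p / 2) * q * (n1 + n)%:R) `^ (- (p / 2 / 2)))))%:E)%E.
Proof.
move=> Ubig; set N := (n1 + n)%N.
have W0 x := pattern_weight_ge0 F dl0 x.
have xM x : x \in patterns F N -> size x = N /\ {subset x <= marks F} by exact: mem_patterns.
have PE S x : <<s cylinders (driving f0 tau) (used set0) >> S -> x \in patterns F N ->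
    P (pattern_event tau dl S x F) =
    ((pattern_weight F dl x * pattern_coverage dl F N)%:E * P S)%E.
  by move=> mS /xM[sx xF]; rewrite (prob_pattern_weight ind exp_tau dl0 mS)// sx.
have sumW : \sum_(x <- patterns F N) pattern_weight F dl x = 1.
  rewrite -[RHS](pmean_cst F dl0 N 1); apply: eq_bigr => x _; by rewrite mulr1.
rewrite /uncovered; set S1 := \big[setU/set0]_(x <- patterns F N) _.
have mS1 : measurable S1 by apply: bigsetU_meas => x; exact: mPE.
have P1 : P (~` S1) = (1 - pattern_coverage dl F N)%:E.
  rewrite probability_setC// prob_bigsetU_disjoint ?patterns_uniq//.
  - rewrite big_seq (eq_bigr (fun x => (pattern_weight F dl x * pattern_coverage dl F N)%:E)).
      by rewrite -big_seq sumEFin -mulr_suml sumW mul1r.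
    by move=> x xN; rewrite PE// probability_setT mule1.
  - by move=> x; exact: mPE.
  - move=> x y w /xM[sx xF] /xM[sy yF]; apply: (pattern_event_disjoint dl0) => //.
    by rewrite sx.
have mS2 : measurable (\big[setU/set0]_(x <- [seq x <- patterns F N | exits x])
    pattern_event tau dl setT x F) by apply: bigsetU_meas => x; exact: mPE.
have mS3 : measurable (\big[setU/set0]_(x <- patterns F N) pattern_event tau dl (off_set n1 x) x F).
  by apply: bigsetU_meas => x; apply: mPE; exact: off_set_past.
apply: (le_trans (prob_setU_le P _ _)); [exact: measurableC|exact: measurableU|].
rewrite P1 -addrA [leRHS]EFinD; apply: leeD => //.
apply: (le_trans (prob_setU_le P _ _)) => //; rewrite [leRHS]EFinD; apply: leeD.
  apply: (le_trans (prob_bigsetU_le _ _ _)); first by move=> x; exact: mPE.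
  apply: (@le_trans _ _ (pmean F dl N (fun x => (exits x)%:R))%:E); last first.
    rewrite lee_fin; exact: (pmean_exit U_uniq F_ends F_deg vU dl0 dist_v dist_lip).
  rewrite big_filter big_mkcond /pmean -sumEFin !big_seq; apply: lee_sum => x xN.
  case: (exits x); last by rewrite mulr0.
  rewrite PE// probability_setT mule1 lee_fin mulr1 ler_piMr//.
  exact: pattern_coverage_le1.
have offW : (\sum_(x <- patterns F N) P (pattern_event tau dl (off_set n1 x) x F) <=
    \sum_(x <- patterns F N) (pattern_weight F dl x)%:E * P (off_set n1 x))%E.
  rewrite !big_seq; apply: lee_sum => x xN; rewrite PE//; last exact: off_set_past.
  apply: lee_wpmul2r => //; rewrite lee_fin ler_piMr//.
  exact: pattern_coverage_le1.
apply: (le_trans (prob_bigsetU_le _ _ _)); first by move=> x; apply: mPE; exact: off_set_past.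
apply: (le_trans offW); rewrite EFinM lee_pdivlMl ?exprn_gt0//.
apply: (le_trans (sum_prob_off n1 n)); rewrite -/N.
apply: (@le_trans _ _ (K1 * pmean F dl N (fun x => energy U (weights R ends v x) `^ (p / 2)))%:E).
  rewrite -pmeanZ /pmean -sumEFin !big_seq; apply: lee_sum => x /xM[_ xF].
  by rewrite EFinM; apply: lee_wpmul2l; rewrite ?lee_fin//; exact: prob_off_end.
(* The energy decay is used with [k = p / 2], whence the exponent [p / 2 / 2 = p / 4]. *)
have p1 : 1 <= p / 2 by move: p2; lra.
have dec := energy_decay U_uniq F_ends F_deg D_gt0 vU U_conn dl0 dl1 p1 Ubig.
rewrite lee_fin ler_wpM2l// /K1.
by rewrite mulr_ge0 ?expR_ge0 ?powR_ge0.
Qed.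

Lemma covered n1 N w : ~ uncovered n1 N w -> exists x,
  [/\ size x = N, {subset x <= marks F}, forall e, e \in F -> clock_set tau dl e (slots x e) N w,
      forall u, 0 < weights R ends v x u -> (dist u < r)%N /\ u \in U &
      ~~ ever ends v off (drop n1 x) (evolve ends (take n1 x) (g0 w))].
Proof.
move=> /not_orP[/contrapT/bigsetUP[x xN xw] /not_orP[w2 w3]].
have [sx xF] := mem_patterns xN; have [_ cl] := (pattern_eventP tau dl setT x F w).1 xw.
exists x; split => //; first by rewrite -sx.
  move=> u wu; have uU : u \in U.
    by apply: (weights_support _ vU xF wu) => e /F_ends[].
  split => //; rewrite ltnNge; apply/negP => ru; apply: w2; apply/bigsetUP.
  exists x => //; rewrite mem_filter xN andbT; apply/hasP; exists u => //.
  by rewrite ru.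
apply/negP => ev; apply: w3; apply/bigsetUP; exists x => //.
by apply/pattern_eventP; split.
Qed.

End cover.

(** * Summation over time windows *)

(** Comparison with an integral, by telescoping: convexity of the power [- (a - 1)] bounds each term
    by a multiple of the difference [t j - t j.+1]. *)
Lemma sum_powR_le (R : realType) (a b : R) n : 1 < a -> 0 < b ->
  \sum_(0 <= j < n) (1 + b * j.+1%:R) `^ (- a) <= (b * (a - 1))^-1.
Proof.
move=> a1 b0; have be0 : 0 < a - 1 by rewrite subr_gt0.
pose t j := (1 + b * j%:R) `^ (- (a - 1)).
have term (j : nat) : (1 + b * j.+1%:R) `^ (- a) <= (b * (a - 1))^-1 * (t j - t j.+1).
  rewrite [leRHS]mulrC ler_pdivlMr ?mulr_gt0//.
  set y := 1 + b * j.+1%:R.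
  have y0 : 0 < y by rewrite ltr_wpDr// mulr_ge0// ltW.
  have yb : 1 + b * j%:R = y * (1 - b / y).
    by rewrite /y -addn1 natrD; field; rewrite natr1 gt_eqF.
  have z0 : 0 < 1 - b / y.
    rewrite -(pmulr_rgt0 _ y0) -yb ltr_wpDr// mulr_ge0//; exact: ltW.
  rewrite /t -/y yb powRM ?(ltW y0) ?(ltW z0)//.
  have h : 1 + (a - 1) * (b / y) <= (1 - b / y) `^ (- (a - 1)).
    rewrite /powR gt_eqF// (le_trans (expR_ge1Dx _))// ler_expR mulNr -mulrN.
    rewrite ler_wpM2l ?(ltW be0)// lerNr (le_trans (le_ln1Dx _))//.
    by rewrite ltrNl opprK; rewrite subr_gt0 in z0.
  have ya : y `^ (- a) = y `^ (- (a - 1)) / y.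
    rewrite -[X in _ / X]powRr1 ?(ltW y0)// -powRN -powRD; last by apply/implyP => _; rewrite gt_eqF.
    by congr (_ `^ _); ring.
  have yp : 0 <= y `^ (- (a - 1)) by exact: powR_ge0.
  have := ler_wpM2l yp h; rewrite ya => h'.
  rewrite lerBrDr; apply: le_trans h'.
  by rewrite le_eqVlt; apply/orP; left; apply/eqP; field; rewrite gt_eqF.
apply: (@le_trans _ _ (\sum_(0 <= j < n) (b * (a - 1))^-1 * (t j - t j.+1))).
  by apply: ler_sum => j _; exact: term.
rewrite -mulr_sumr; have c0 : 0 <= (b * (a - 1))^-1 by rewrite invr_ge0 mulr_ge0// ltW.
rewrite ler_piMr//; under eq_bigr do rewrite -opprB.
rewrite sumrN telescope_sumr// opprB /t mulr0 addr0 powR1.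
by rewrite gerBl powR_ge0.
Qed.

(** * Mean and moments of a common law *)

Section law.
Context d (Omega : measurableType d) (R : realType) (P : probability Omega R).

Lemma same_law_integral (X Y : Omega -> R) (g : R -> \bar R) :
  measurable_fun setT X -> measurable_fun setT Y -> same_law P X Y ->
  measurable_fun setT g -> (forall z, 0 <= g z)%E ->
  (\int[P]_w g (X w) = \int[P]_w g (Y w))%E.
Proof.
move=> mX mY XY mg g0.
pose X' : {mfun Omega >-> R} := mfun_Sub (mem_set mX).
pose Y' : {mfun Omega >-> R} := mfun_Sub (mem_set mY).
have := @ge0_integral_distribution _ _ _ _ _ P X' g mg g0 => /= <-.
have := @ge0_integral_distribution _ _ _ _ _ P Y' g mg g0 => /= <-.
by apply: eq_measure_integral => A mA _; exact: XY.
Qed.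

Lemma same_law_mean (X Y : Omega -> R) :
  measurable_fun setT X -> measurable_fun setT Y -> same_law P X Y ->
  (\int[P]_w (X w)%:E = \int[P]_w (Y w)%:E)%E.
Proof.
move=> mX mY XY; rewrite [LHS]integralE [RHS]integralE.
have mE : measurable_fun setT (EFin : R -> \bar R) by exact: EFin_measurable.
have pos (Z : Omega -> R) w : ((fun w => (Z w)%:E)^\+ w = (EFin : R -> \bar R)^\+ (Z w))%E.
  by rewrite !funeposE.
have neg (Z : Omega -> R) w : ((fun w => (Z w)%:E)^\- w = (EFin : R -> \bar R)^\- (Z w))%E.
  by rewrite !funenegE.
congr (_ - _)%E.
  under eq_integral do rewrite pos; under [RHS]eq_integral do rewrite pos.
  apply: (same_law_integral mX mY XY); last by move=> z; exact: funepos_ge0.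
  exact: measurable_funepos.
under eq_integral do rewrite neg; under [RHS]eq_integral do rewrite neg.
apply: (same_law_integral mX mY XY); last by move=> z; exact: funeneg_ge0.
exact: measurable_funeneg.
Qed.

Lemma moments_of_Lp (I : Type) (X : I -> Omega -> R) (p : R) (i0 : I) : 1 <= p ->
  (forall i, measurable_fun setT (X i)) -> (forall i j, same_law P (X i) (X j)) ->
  (forall i, \int[P]_w (`|X i w| `^ p)%:E < +oo)%E ->
  let mu := fine (\int[P]_w (X i0 w)%:E) in
  exists2 nu : R, 0 <= nu & forall i, [/\ P.-integrable setT (EFin \o X i),
    (\int[P]_w (X i w)%:E = mu%:E)%E &
    (\int[P]_w (`|X i w - mu| `^ p)%:E <= nu%:E)%E].
Proof.
move=> p1 mX XX Lp mu; have p0 : 0 <= p by lra.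
have mpow (m : R) : measurable_fun setT (fun z : R => (`|z - m| `^ p)%:E).
  by apply/measurable_EFinP/measurable_powR_norm; exact: measurable_funB.
have mpow0 : measurable_fun setT (fun z : R => (`|z| `^ p)%:E).
  exact/measurable_EFinP/measurable_powR_norm.
have iX i : P.-integrable setT (EFin \o X i).
  apply/integrableP; split; first exact/measurable_EFinP.
  apply: (@le_lt_trans _ _ (\int[P]_w (1 + (`|X i w| `^ p)%:E))%E).
    apply: ge0_le_integral => //.
    - by apply: measurableT_comp => //; exact/measurable_EFinP.
    - by apply: emeasurable_funD => //; exact: (measurableT_comp mpow0 (mX i)).
    - move=> w _; rewrite /= lee_fin -[leLHS]powRr1//.
      by apply: powR_le1D => //; rewrite ler01.
  rewrite ge0_integralD//; last exact: (measurableT_comp mpow0 (mX i)).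
  by rewrite integral_cst//= probability_setT mule1 lte_add_pinfty// ltry.
have Emu i : (\int[P]_w (X i w)%:E = mu%:E)%E.
  rewrite (same_law_mean (mX i) (mX i0) (XX i i0)) /mu fineK//.
  exact: (integrable_fin_num measurableT (iX i0)).
pose nu := fine (\int[P]_w (`|X i0 w - mu| `^ p)%:E).
exists nu; first by apply: fine_ge0; apply: integral_ge0 => w _; rewrite lee_fin powR_ge0.
move=> i; split => //.
rewrite (same_law_integral (g := fun z => (`|z - mu| `^ p)%:E) (mX i) (mX i0) (XX i i0))//.
rewrite /nu fineK// ge0_fin_numE; last first.
  by apply: integral_ge0 => w _; rewrite lee_fin powR_ge0.
apply: (@le_lt_trans _ _ (\int[P]_w
    ((2 `^ p * `|mu| `^ p)%:E + (2 `^ p)%:E * (`|X i0 w| `^ p)%:E))%E).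
  apply: ge0_le_integral => //.
  - exact: (measurableT_comp (mpow mu) (mX i0)).
  - apply: emeasurable_funD => //; apply: measurable_funeM.
    exact: (measurableT_comp mpow0 (mX i0)).
  - move=> w _; rewrite -EFinM -EFinD lee_fin -!powRM//.
    have le2 (y : R) : 0 <= y -> `|X i0 w - mu| <= 2 * y ->
        `|X i0 w - mu| `^ p <= (2 * y) `^ p.
      by move=> y0 h; apply: ge0_ler_powR; rewrite ?nnegrE ?mulr_ge0.
    have := ler_normB (X i0 w) mu.
    have [h1|h1] := leP `|X i0 w| `|mu| => h2.
      rewrite (le_trans (le2 `|mu| _ _))// ?lerDl ?powR_ge0//; lra.
    rewrite (le_trans (le2 `|X i0 w| _ _))// ?lerDr ?powR_ge0//; lra.
rewrite ge0_integralD//; last first.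
- by apply: measurable_funeM; exact: (measurableT_comp mpow0 (mX i0)).
rewrite integral_cst//= probability_setT mule1.
rewrite ge0_integralZl_EFin ?powR_ge0//; last exact: (measurableT_comp mpow0 (mX i0)).
rewrite lte_add_pinfty ?ltry// lte_mul_pinfty ?lee_fin ?powR_ge0//.
Qed.

End law.

Lemma nat_above (R : realType) (x : R) : exists n : nat, x < n%:R.
Proof. by exists (Num.truncn x).+1; exact: truncnS_gt. Qed.

Lemma expR_le_1Bx (R : realType) (y : R) : 0 <= y -> y <= 1 / 2 -> expR (- (2 * y)) <= 1 - y.
Proof.
move=> y0 y1; have h := expR_ge1Dx (2 * y).
have e1 : expR (- (2 * y)) * expR (2 * y) = 1 by rewrite mulrC expRxMexpNx_1.
have e0 := expR_gt0 (- (2 * y)).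
rewrite -(ler_pM2r (expR_gt0 (2 * y))) e1.
have h2 : (1 - y) * (1 + 2 * y) <= (1 - y) * expR (2 * y) by rewrite ler_wpM2l//; lra.
by apply: le_trans h2; nra.
Qed.

Lemma powR_neg_anti (R : realType) (a x y : R) : 0 <= a -> 0 < x -> x <= y ->
  y `^ (- a) <= x `^ (- a).
Proof.
move=> a0 x0 xy; have y0 : 0 < y by exact: lt_le_trans xy.
rewrite !powRN lef_pV2 ?posrE ?powR_gt0//.
by apply: ge0_ler_powR; rewrite ?nnegrE// ltW.
Qed.

(** * One time window, then almost sure convergence *)

Section time_window.
Context d (Omega : measurableType d) (R : realType) (P : probability Omega R).
Variables (V E : choiceType) (ends : E -> V * V).
Variables (f0 : V -> Omega -> R) (tau : E -> nat -> Omega -> R).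
Variables (f : R -> V -> Omega -> R).
Hypothesis simple : simple_graph ends.
Hypothesis conn : connected_graph ends.
Hypothesis inf : infinite_graph V.
Hypothesis ind : mutually_independent P (driving f0 tau).
Hypothesis exp_tau : forall e k, exp1_distributed P (tau e k).
Variables (D : nat) (inc : V -> seq E).
Hypothesis D_gt0 : (0 < D)%N.
Hypothesis inc_size : forall u, (size (inc u) <= D)%N.
Hypothesis incP : forall e u, (e \in inc u) = touches ends e u.
Variables (v : V) (p mu nu eps : R).
Hypothesis p2 : 2 < p.
Hypothesis nu0 : 0 <= nu.
Hypothesis eps0 : 0 < eps.
Hypothesis moments : forall u, [/\ P.-integrable setT (EFin \o f0 u),
    (\int[P]_w (f0 u w)%:E = mu%:E)%E &
    (\int[P]_w (`|f0 u w - mu| `^ p)%:E <= nu%:E)%E].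

Let mtau e k : measurable_fun setT (tau e k).
Proof. by have [+ _] := ind; move=> /(_ (inr (e, k))). Qed.

(** Exponential waiting times are positive only almost surely, whereas the pathwise analysis needs
    every ring time of [F] to increase. *)
Lemma nonpositive_clock (F : seq E) : exists N : set Omega,
  [/\ measurable N, P N = 0%E & forall w, ~ N w -> forall e k, e \in F -> 0 < tau e k w].
Proof.
pose Z e k := tau e k @^-1` `]-oo, 0%R].
have mZ e k : measurable (Z e k) by rewrite -[Z e k]setTI; exact: mtau.
have Z0 e k : P (Z e k) = 0%E.
  have -> : Z e k = ~` (tau e k @^-1` `]0%R, +oo[).
    by apply/seteqP; split => w; rewrite /Z /= !in_itv/= andbT leNgt => /negP.
  rewrite probability_setC; last by rewrite -[_ @^-1` _]setTI; exact: mtau.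
  by rewrite (prob_exp_gt (@exp_tau e k))// oppr0 expR0 subee.
pose Y e := \bigcup_k Z e k.
have mY e : measurable (Y e) by exact: bigcup_measurable.
have Y0 e : P (Y e) = 0%E.
  apply: measure_negligible => //; apply: negligible_bigcup => k.
  by apply/negligibleP => //; exact: Z0.
exists (\big[setU/set0]_(e <- F) Y e); split.
- exact: bigsetU_meas.
- apply/eqP; rewrite eq_le measure_ge0 andbT.
  by apply: (le_trans (prob_bigsetU_le _ _ _)) => //; rewrite big1.
- move=> w wN e k eF; rewrite ltNge; apply/negP => h; apply: wN.
  by apply/bigsetUP; exists e => //; exists k => //; rewrite /Z /= in_itv.
Qed.

(** [expR (2 * D)] is the price for no ring at the root during unit time; the other factors come
    from the tail bound, and 2 from [energy_decay]. *)
Definition window_const : R :=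
  expR (2 * D%:R) * (expR (moment_const p * (1 + 2 * nu)) * eps `^ (- p) * 2).

(* [f t v] is not assumed to be measurable, whence the covering event [M]. *)
Lemma window_cover (j : nat) (eta : R) : 0 < eta -> exists M : set Omega,
  [/\ measurable M,
      (P M <= (window_const * (1 + decay_rate D (p / 2) / 2 * j.+1%:R) `^ (- (p / 2 / 2)) + eta)%:E)%E &
      forall w, ~ M w ->
        edge_averaging_path ends (fun u => f0 u w) (fun e k => tau e k w) (fun t u => f t u w) ->
        forall t, j%:R <= t <= j.+1%:R -> `|f t v w - mu| <= eps].
Proof.
move=> eta0; set kap := decay_rate D (p / 2).
have kap0 : 0 < kap by apply: decay_rate_gt0 => //; move: p2; lra.
set L : R := j.+1%:R; have L0 : 0 < L by rewrite ltr0n.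
have D1 : 1 <= D%:R :> R by rewrite ler1n.
(* The first term makes the exit probability at most [eta / 2], through [2 ^ r > r]; the second
   makes the ball large enough for [energy_decay], through [size U > r]. *)
have [r0 r0P] := nat_above (expR (2 * D%:R * L) * 2 / eta + 4 * (1 + kap * L)).
pose r := r0.+1.
have t1 : 0 <= expR (2 * D%:R * L) * 2 / eta by rewrite divr_ge0 ?mulr_ge0 ?expR_ge0// ltW.
have t2 : 0 < 4 * (1 + kap * L) by rewrite mulr_gt0// addr_gt0// mulr_gt0.
pose U := gball ends inc v r; pose F := gball_edges ends inc v r.
have U_size : 4 * (1 + kap * L) < (size U)%:R ^+ 2.
  have s1 : (r0%:R : R) <= (size U)%:R.
    by rewrite ler_nat ltnW// ltnW//; exact: (gball_size conn inf incP).
  have s2 : 1 <= (size U)%:R :> R by rewrite ler1n (leq_ltn_trans _ (gball_size conn inf incP v r)).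
  apply: (@lt_le_trans _ _ (size U)%:R); first by lra.
  by rewrite expr2 ler_peMl//; lra.
(* The three terms give, in turn, [D * q <= 1 / 2], [dl * size F <= 1], and a coverage defect
   [L * size F ^ 2 / n] of at most [eta / 2]. *)
have [n0 n0P] := nat_above (2 * D%:R + (size F)%:R + 2 * L * (size F)%:R ^+ 2 / eta).
pose n := n0.
have t3 : 0 <= 2 * L * (size F)%:R ^+ 2 / eta.
  by rewrite divr_ge0 ?mulr_ge0 ?sqr_ge0// ltW.
have F0 : 0 <= (size F)%:R :> R by [].
have n0R : 0 < n%:R :> R by rewrite /n; lra.
have n_D : 2 * D%:R <= n%:R :> R by rewrite /n; lra.
have n_F : (size F)%:R <= n%:R :> R by rewrite /n; lra.
have n_eta : 2 * L * (size F)%:R ^+ 2 <= n%:R * eta.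
  by rewrite -ler_pdivrMr//; rewrite /n; lra.
pose dl : R := n%:R^-1.
have dl0 : 0 < dl by rewrite invr_gt0.
have dl1 : dl <= 1 by rewrite invf_le1//; lra.
pose q := ring_prob F dl.
have q0 : 0 <= q by exact: ring_prob_ge0.
have qdl : q <= dl by exact: ring_prob_le.
have qn : q * n%:R <= 1 by rewrite -ler_pdivlMr// mul1r.
have dlF : dl * (size F)%:R <= 1 by rewrite mulrC ler_pdivrMr// mul1r.
(* The normalization of the marks is at most 2; hence the halved decay rate in the statement, free
   of the ball and of [n]. *)
have q_low : dl / 2 <= q.
  rewrite /q /ring_prob ler_wpM2l ?(ltW dl0)// lef_pV2 ?posrE//; first by lra.
  by rewrite ltr_wpDr// mulr_ge0// ltW.
have qD : D%:R * q <= 1 / 2.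
  apply: (@le_trans _ _ (D%:R * dl)); first by rewrite ler_wpM2l.
  by rewrite ler_pdivrMr//; lra.
pose N := (n * j + n)%N.
have NL : (N%:R : R) = n%:R * L by rewrite /N -mulnSr natrM.
have Ndl : N%:R * dl = L by rewrite NL /dl mulrAC divff ?mul1r// gt_eqF.
have qN : q * N%:R <= L by rewrite NL mulrA ler_piMl// ltW.
have qN_low : L / 2 <= q * N%:R.
  by rewrite -Ndl mulrAC -mulrA mulrC; apply: ler_wpM2r => //; rewrite mulrC.
pose dist := dist_upto ends inc v r.
have [N0 [mN0 PN0 posN0]] := nonpositive_clock F.
have F_ends := @gball_edges_ends _ _ ends simple inc incP v r.
have F_deg := @gball_edges_deg _ _ ends simple D inc inc_size incP v R r.
have vU : v \in U by exact: gball_root.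
have mF e : e \in F -> touches ends e (ends e).1 /\ touches ends e (ends e).2.
  by move=> _; rewrite /touches !eqxx orbT.
have dist_lip e : e \in F -> (dist (ends e).1 <= (dist (ends e).2).+1)%N /\
    (dist (ends e).2 <= (dist (ends e).1).+1)%N.
  by move=> /mF[a1 a2]; split; [exact: (dist_touch incP v r a1 a2)|exact: (dist_touch incP v r a2 a1)].
have UN : 4 * (1 + kap * q * N%:R) < (size U)%:R ^+ 2.
  by apply: le_lt_trans U_size; rewrite ler_pM2l// lerD2l -mulrA ler_wpM2l// ltW.
have PM := @prob_uncovered _ _ _ P _ _ ends f0 tau ind exp_tau U F D v (gball_uniq _ _ _ _)
  (gball_edges_uniq _ _ _ _) F_ends F_deg D_gt0 vU (@gball_path _ _ _ _ incP v r) dist r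
  (dist_root _ _ _ _) dist_lip p mu nu eps dl p2 nu0 eps0 dl0 dl1 moments qD (n * j) n UN.
set M := uncovered ends f0 tau U F v dist r mu eps dl (n * j) (n * j + n) in PM.
have mM : measurable M by exact: (uncovered_measurable ends ind).
exists (M `|` N0); split; first exact: measurableU.
  apply: (le_trans (prob_setU_le P mM mN0)); rewrite PN0 adde0; apply: (le_trans PM).
  rewrite lee_fin -/N -/q -/kap.
  have cov := pattern_coverage_ge dl0 N dlF.
  have h1 : 1 - pattern_coverage dl F N <= eta / 2.
    have : N%:R * (dl * (size F)%:R) ^+ 2 <= eta / 2.
      have -> : N%:R * (dl * (size F)%:R) ^+ 2 = L * (size F)%:R ^+ 2 / n%:R.
        by rewrite -Ndl /dl; field; rewrite gt_eqF.
      by rewrite ler_pdivrMr//; lra.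
    by move: cov; lra.
  have h2 : (1 + 2 * D%:R * q) ^+ N / 2 ^+ r <= eta / 2.
    have e1 : (1 + 2 * D%:R * q) ^+ N <= expR (2 * D%:R * L).
      apply: (@le_trans _ _ (expR (2 * D%:R * q) ^+ N)).
        apply: lerXn2r; rewrite ?nnegrE ?expR_ge0 ?expR_ge1Dx//.
        by rewrite addr_ge0// mulr_ge0// mulr_ge0.
      rewrite -expRM_natl ler_expR (_ : N%:R * _ = 2 * D%:R * (q * N%:R)); last by ring.
      by rewrite ler_wpM2l// mulr_ge0.
    rewrite ler_pdivrMr ?exprn_gt0//; apply: (le_trans e1).
    have e2 : expR (2 * D%:R * L) * 2 / eta <= 2 ^+ r.
      apply: (@le_trans _ _ r0%:R); first by lra.
      by rewrite -natrX ler_nat ltnW// (ltn_trans (ltnSn r0))// ltn_expl.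
    by move: e2; rewrite ler_pdivrMr//; lra.
  have h3 : (1 + kap * q * N%:R) `^ (- (p / 2 / 2)) <=
      (1 + kap / 2 * L) `^ (- (p / 2 / 2)).
    apply: powR_neg_anti; first by move: p2; lra.
      by rewrite addr_gt0// mulr_gt0// divr_gt0.
    rewrite lerD2l (_ : kap / 2 * L = kap * (L / 2)); last by ring.
    by rewrite -[kap * q * _]mulrA ler_wpM2l// ltW.
  have h4 : ((1 - D%:R * q) ^+ n)^-1 <= expR (2 * D%:R).
    have c1 : expR (- (2 * (D%:R * q))) <= 1 - D%:R * q.
      by apply: expR_le_1Bx => //; rewrite mulr_ge0.
    rewrite -[leRHS]invrK -expRN lef_pV2 ?posrE ?expR_gt0//; last first.
      by rewrite exprn_gt0//; lra.
    apply: (@le_trans _ _ (expR (- (2 * (D%:R * q))) ^+ n)).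
      rewrite -expRM_natl ler_expR mulrN lerN2 (_ : n%:R * _ = 2 * D%:R * (q * n%:R)); last by ring.
      by rewrite ler_piMr// mulr_ge0.
    by apply: lerXn2r; rewrite ?nnegrE ?expR_ge0//; lra.
  set K1 := expR _ * eps `^ _.
  have K10 : 0 <= K1 by rewrite mulr_ge0 ?expR_ge0 ?powR_ge0.
  have h5 : ((1 - D%:R * q) ^+ n)^-1 * (K1 * (2 * (1 + kap * q * N%:R) `^ (- (p / 2 / 2)))) <=
      window_const * (1 + kap / 2 * L) `^ (- (p / 2 / 2)).
    have -> : window_const = expR (2 * D%:R) * (K1 * 2) by [].
    clearbody K1; rewrite -[leRHS]mulrA -[K1 * 2 * _]mulrA; apply: ler_pM => //.
    - by rewrite invr_ge0 exprn_ge0//; lra.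
    - by apply: mulr_ge0 => //; apply: mulr_ge0 => //; exact: powR_ge0.
    - by rewrite ler_wpM2l// ler_wpM2l.
  by move: h1 h2 h5; lra.
move=> w wM pathw t /andP[jt tj].
have wM1 : ~ M w by move=> h; apply: wM; left.
have wN0 : ~ N0 w by move=> h; apply: wM; right.
have [x [sx xF clocks supp notoff]] := covered F_ends vU wM1.
(* Strictly inside the radius, so that every incident edge has both ends in the ball and belongs to
   [F]. *)
pose inner u := exists2 i, (i < r)%N & u \in gball ends inc v i.
have F_inner u e : inner u -> incident ends e u -> e \in F.
  move=> [i ir ui] /touchesP eu; rewrite mem_ball_edges//.
  have [a1 a2] : touches ends e (ends e).1 /\ touches ends e (ends e).2.
    by rewrite /touches !eqxx orbT.
  by rewrite !(gball_mono ir (gball_touch incP ui eu _)).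
have supp_inner u : 0 < weights R ends v x u -> inner u.
  by move=> /supp[du _]; exact: dist_lt du.
have clocks' e : e \in F -> clock_set tau dl e (slots x e) (size x) w.
  by rewrite sx; exact: clocks.
have jx : (n * j <= size x)%N by rewrite sx leq_addr.
have tx : (n * j)%:R * dl <= t <= (size x)%:R * dl.
  rewrite sx Ndl tj andbT natrM mulrAC /dl divff ?mul1r// gt_eqF//.
have [k [/andP[jk kx] ftv]] := path_root pathw dl0 (posN0 w wN0) F_inner clocks' supp_inner jx tx.
rewrite ftv leNgt; apply/negP => offk; move/negP: notoff; apply.
apply: (@ever_take _ _ _ _ v (off mu eps) (drop (n * j) x) _ (k - n * j)).
  by rewrite size_drop leq_sub2r.
rewrite -evolve_cat; have -> : take (n * j) x ++ take (k - n * j) (drop (n * j) x) = take k x.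
  by rewrite -takeD subnKC.
by [].
Qed.

Lemma opinion_eventually_close :
  4 < p ->
  {ae P, forall w, edge_averaging_path ends (fun u => f0 u w) (fun e k => tau e k w)
                     (fun t u => f t u w)} ->
  {ae P, forall w, exists J : nat, forall t, J%:R <= t -> `|f t v w - mu| <= eps}.
Proof.
move=> p4 pathP; set b := decay_rate D (p / 2) / 2; set a := p / 2 / 2.
have a1 : 1 < a by rewrite /a; lra.
have b0 : 0 < b by rewrite divr_gt0// decay_rate_gt0//; lra.
(* Errors that are summable over the windows, with total at most 1. *)
have eta0 (j : nat) : 0 < (1 / 2) ^+ j.+1 :> R by rewrite exprn_gt0.
have [M MP] := choice (fun j => window_cover j (eta0 j)).
have W0 : 0 <= window_const.
  by rewrite mulr_ge0 ?expR_ge0// mulr_ge0// mulr_ge0 ?expR_ge0 ?powR_ge0.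
have sumM : (\sum_(j <oo) P (M j) < +oo)%E.
  apply: (@le_lt_trans _ _ (window_const * (b * (a - 1))^-1 + 1)%:E); last exact: ltry.
  apply: lime_le; first by apply: is_cvg_nneseries => j _ _; exact: measure_ge0.
  apply: nearW => n.
  apply: (@le_trans _ _ (\sum_(0 <= j < n)
      (window_const * (1 + b * j.+1%:R) `^ (- a) + (1 / 2) ^+ j.+1)%:E)%E).
    by apply: lee_sum => j _; have [] := MP j.
  rewrite sumEFin lee_fin big_split/= -mulr_sumr lerD//.
    by rewrite ler_wpM2l// sum_powR_le.
  have geo k : \sum_(0 <= j < k) (1 / 2) ^+ j.+1 = 1 - (1 / 2) ^+ k :> R.
    elim: k => [|k IH]; first by rewrite big_geq// expr0 subrr.
    by rewrite big_nat_recr//= IH [in RHS]exprS exprS; field.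
  by rewrite geo gerBl exprn_ge0.
have mM j : measurable (M j) by have [] := MP j.
have lim0 := lim_sup_set_cvg0 mM sumM.
have mlim : measurable (lim_sup_set M).
  by apply: bigcapT_measurable => k; apply: bigcup_measurable => j _; exact: mM.
have limN : P.-negligible (lim_sup_set M) by apply/negligibleP.
apply: negligibleS (negligibleU pathP limN) => w /= wbad.
have [pw|pw] := pselect (edge_averaging_path ends (fun u => f0 u w) (fun e k => tau e k w)
                     (fun t u => f t u w)); last by left.
right=> J _; apply: contrapT => notM; apply: wbad; exists J => t Jt.
have t0 : 0 <= t by apply: le_trans Jt.
have /andP[tj1 tj2] := truncn_itv t0.
have [_ _ close] := MP (Num.truncn t).
apply: close => //; last by rewrite tj1 ltW.
move=> Mt; apply: notM; exists (Num.truncn t) => //=.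
by rewrite /= truncn_ge_nat.
Qed.

End time_window.

Lemma incident_edges (V E : choiceType) (ends : E -> V * V) : bounded_degree ends ->
  exists D (inc : V -> seq E), [/\ (0 < D)%N, forall u, (size (inc u) <= D)%N &
    forall e u, (e \in inc u) = touches ends e u].
Proof.
(* The successor makes the bound positive; filtering is needed because the given lists may contain
   edges that are not incident. *)
move=> [D /choice[s sP]]; exists D.+1, (fun u => [seq e <- s u | touches ends e u]).
split => // [u|e u].
  by rewrite size_filter (leq_trans (count_size _ _))// ltnW// ltnS; have [] := sP u.
rewrite mem_filter; apply: andb_idr => /touchesP eu.
by apply/List_InE; have [_] := sP u; exact.
Qed.

Lemma averaging_converges (V E : choiceType) (ends : E -> V * V)
  (d : measure_display) (Omega : measurableType d) (R : realType) (P : probability Omega R)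
  (f0 : V -> Omega -> R) (tau : E -> nat -> Omega -> R) (f : R -> V -> Omega -> R) (p : R) :
  simple_graph ends -> connected_graph ends -> infinite_graph V -> bounded_degree ends ->
  mutually_independent P (driving f0 tau) ->
  (forall e k, exp1_distributed P (tau e k)) ->
  (forall u v, same_law P (f0 u) (f0 v)) ->
  4 < p ->
  (forall v, (\int[P]_w (`|f0 v w| `^ p)%:E < +oo)%E) ->
  {ae P, forall w, edge_averaging_path ends (fun v => f0 v w)
                     (fun e k => tau e k w) (fun t v => f t v w)} ->
  forall v : V,
    let mu := fine (\int[P]_w (f0 v w)%:E) in
    {ae P, forall w, (fun t => f t v w) @ +oo --> mu}.
Proof.
move=> simple conn inf /incident_edges[D [inc [D0 inc_size incP]]] ind exp_tau same p4 Lp pathP v mu.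
have mf0 u : measurable_fun setT (f0 u) by have [+ _] := ind; move=> /(_ (inl u)).
have p1 : 1 <= p by lra.
have p2 : 2 < p by lra.
have [nu nu0 moments] := moments_of_Lp v p1 mf0 same Lp.
have e0 i : 0 < i.+1%:R^-1 :> R by rewrite invr_gt0.
have close i := opinion_eventually_close simple conn inf ind exp_tau D0 inc_size incP v p2 nu0
  (e0 i) moments p4 pathP.
apply: negligibleS (negligible_bigcup close) => w /= wbad.
apply: contrapT => good; apply: wbad; apply/cvgrPdist_le => e epos.
have [i ie] : exists i : nat, i.+1%:R^-1 <= e.
  have [i ie] := nat_above e^-1; exists i; rewrite -[leRHS]invrK lef_pV2 ?posrE ?invr_gt0//.
  by rewrite (le_trans (ltW ie))// ler_nat.
have [J JP] : exists J : nat, forall t, J%:R <= t -> `|f t v w - mu| <= i.+1%:R^-1.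
  by apply: contrapT => h; apply: good; exists i.
near=> t; rewrite distrC (le_trans (JP t _))//.
Unshelve. all: by end_near. Qed.

Unset Implicit Arguments.

(* V, E, ends : an infinite, connected, simple graph of bounded degree.
   (Omega, P) : probability space.
   f0 v     : initial opinion at v;
   tau e k  : k-th inter-arrival time of the rate-one Poisson clock of edge e;
   f t v w  : opinion f_t(v) at time t in the realization w.
   Hypotheses: the f0 v and all tau e k are mutually independent, the f0 v
   are identically distributed and in L^p for some p > 4, the tau e k are
   Exp(1) (so each edge carries an independent rate-one Poisson clock,
   independent of the initial opinions), and almost surely f follows the
   edge-averaging dynamics driven by f0 and tau. *)
Theorem theorem1p4
  (V E : Type) (ends : E -> V * V)
  (d : measure_display) (Omega : measurableType d) (R : realType)
  (P : probability Omega R)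
  (f0 : V -> Omega -> R) (tau : E -> nat -> Omega -> R)
  (f : R -> V -> Omega -> R) (p : R) :
  simple_graph ends -> connected_graph ends -> infinite_graph V ->
  bounded_degree ends ->
  mutually_independent P
    (fun i : V + (E * nat) =>
       match i with inl v => f0 v | inr ek => tau ek.1 ek.2 end) ->
  (forall e k, exp1_distributed P (tau e k)) ->
  (forall u v, same_law P (f0 u) (f0 v)) ->
  4 < p ->
  (forall v, (\int[P]_w (`|f0 v w| `^ p)%:E < +oo)%E) ->
  {ae P, forall w, edge_averaging_path ends (fun v => f0 v w)
                     (fun e k => tau e k w) (fun t v => f t v w)} ->
  forall v : V,
    let mu := fine (\int[P]_w (f0 v w)%:E) in
    {ae P, forall w, (fun t => f t v w) @ +oo --> mu}.
(* [{classic V}] and [{classic E}] equip the bare types with the choice structure that finite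
   sequences of vertices and edges rely on. *)
Proof. exact: (@averaging_converges {classic V} {classic E}). Qed.
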